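(* Let $1<r<\infty$, let $\alpha=n\left(1-\frac1r\right)$, and let $g$ be a nonnegative radially decreasing function in $L^{r,\infty}(\mathbb{R}^n)$. Suppose that $$\left(\frac1{p_1},\frac1{p_2}\right)\in\mathcal{P}_\alpha$$ and define $0<p<\infty$ by $$\frac1p+\frac{\alpha}{n}=\frac1{p_1}+\frac1{p_2}.$$ Then there exists a positive constant $C=C(n,r,p_1,p_2)$ such that $$\big\|T_g(f_1,f_2)\big\|_p\leq C\,\|f_1\|_{p_1}\,\|f_2\|_{p_2}\,\|g\|_{r,\infty}$$ for all $f_1\in L^{p_1}(\mathbb{R}^n)$ and $f_2\in L^{p_2}(\mathbb{R}^n)$.
   Context: Here $n$ is a positive integer. For measurable functions $f_1,f_2,g$ on $\mathbb{R}^n$, $$T_g(f_1,f_2)(x)=\int_{\mathbb{R}^n}f_1(x+y)\,f_2(x-y)\,g(y)\,dy,$$ defined where the integral converges absolutely. For nonnegative functions it is well defined with values in $[0,\infty]$. Since $|T_g(f_1,f_2)|\le T_{|g|}(|f_1|,|f_2|)$, one uses the standard reduction to nonnegative functions. $\|f\|_p=\left(\int_{\mathbb{R}^n}|f|^p\,dx\right)^{1/p}$ for $0<p<\infty$. $\|g\|_{r,\infty}=\sup_{\lambda>0}\lambda\,|\{|g|>\lambda\}|^{1/r}$, and $L^{r,\infty}(\mathbb{R}^n)$ is the space of measurable functions for which it is finite. A nonnegative measurable function $g$ on $\mathbb{R}^n$ is radially decreasing if there exists a nonincreasing function $\psi:(0,\infty)\to[0,\infty)$ such that $g(y)=\psi(|y|)$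 for a.e. $y\in\mathbb{R}^n$. For $0<\alpha<n$, $\mathcal{P}_\alpha$ denotes the interior of the pentagon in $[0,1]^2$ with vertices $(1,1)$, $(1,0)$, $(\alpha/n,0)$, $(0,\alpha/n)$, $(0,1)$. *)

(* Defs.v *)
From HB Require Import structures.
From mathcomp Require Import all_boot all_order all_algebra.
From mathcomp Require Import all_classical all_reals all_analysis.
From mathcomp Require Import complex.

Set Implicit Arguments.
Unset Strict Implicit.
Unset Printing Implicit Defensive.

Import Order.TTheory GRing.Theory Num.Theory.
Import numFieldNormedType.Exports.

Local Open Scope classical_set_scope.
Local Open Scope ring_scope.

(* n-fold product of the one-dimensional Lebesgue measure, on the product
   (Borel) sigma-algebra of n.-tuple R, by integrating the measures of the
   sections {t | (x, t) \in A}. *)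
Fixpoint product_volume (R : realType) (n : nat) :
    set (n.-tuple (measurableTypeR R)) -> \bar R :=
  match n with
  | 0 => \d_([tuple] : 0.-tuple (measurableTypeR R))
  | m.+1 => fun A => (\int[@lebesgue_measure R]_x
      @product_volume R m [set t | A (cons_tuple x t)])%E
  end.

(* The Lebesgue outer measure of R^n: infimum over countable covers by Borel
   sets. *)
Definition lebesgue_outer (R : realType) (n : nat) (A : set 'rV[R]_n) : \bar R :=
  mu_ext (@product_volume R n) [set t | A (\row_i tnth t i)].

Section lebesgue_outer_instance.
Variables (R : realType) (n : nat).

Lemma product_volume_ge0 m (A : set (m.-tuple (measurableTypeR R))) :
  (0 <= product_volume A)%E.
Proof.
elim: m A => [|m IHm] A //=.
by apply: integral_ge0 => x _; exact: IHm.
Qed.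

Lemma product_volume0 m :
  product_volume (set0 : set (m.-tuple (measurableTypeR R))) = 0%E.
Proof.
elim: m => [|m IHm] /=; first exact: measure0.
by apply: integral0_eq => x _; exact: IHm.
Qed.

Lemma lebesgue_outer0 : @lebesgue_outer R n set0 = 0%E.
Proof.
by apply: mu_ext0; [exact: product_volume0 | exact: product_volume_ge0].
Qed.

Lemma lebesgue_outer_ge0 A : (0 <= @lebesgue_outer R n A)%E.
Proof. by apply: mu_ext_ge0; exact: product_volume_ge0. Qed.

Lemma le_lebesgue_outer :
  {homo @lebesgue_outer R n : A B / A `<=` B >-> (A <= B)%E}.
Proof. by move=> A B AB; apply: le_mu_ext => t; exact: AB. Qed.

Lemma lebesgue_outer_sigma_subadditive :
  sigma_subadditive (@lebesgue_outer R n).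
Proof.
move=> A; rewrite /lebesgue_outer.
apply: (mu_ext_sigma_subadditive (@product_volume_ge0 n)
  (fun k => [set t | A k (\row_i tnth t i)])).
Qed.

HB.instance Definition _ := isOuterMeasure.Build R 'rV[R]_n
  (@lebesgue_outer R n) lebesgue_outer0 lebesgue_outer_ge0
  le_lebesgue_outer lebesgue_outer_sigma_subadditive.

End lebesgue_outer_instance.

(* 'rV[R]_n with the sigma-algebra of all Lebesgue measurable sets, i.e. the
   completion of the Borel one. *)
Definition Rn (R : realType) (n : nat) : measurableType _ :=
  caratheodory_type (@lebesgue_outer R n).

Section lebesgue_measure_Rn.
Variables (R : realType) (n : nat).

Definition leb : set (Rn R n) -> \bar R := @lebesgue_outer R n.

Let leb0 : leb set0 = 0%E.
Proof. exact: lebesgue_outer0. Qed.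

Let leb_ge0 A : (0 <= leb A)%E.
Proof. exact: lebesgue_outer_ge0. Qed.

Let leb_sigma_additive : semi_sigma_additive leb.
Proof. by move=> F mF tF mUF; exact: caratheodory_measure_sigma_additive. Qed.

HB.instance Definition _ := isMeasure.Build _ _ _ leb
  leb0 leb_ge0 leb_sigma_additive.

End lebesgue_measure_Rn.

Definition eucl_norm (R : realType) (n : nat) (x : 'rV[R]_n) : R :=
  Num.sqrt (\sum_(i < n) x 0 i ^+ 2).

Section complex_functions.
Variables (R : realType) (n : nat).
Implicit Types (f : 'rV[R]_n -> R[i]).

Definition cmeasurable f :=
  measurable_fun [set: Rn R n] (fun x : Rn R n => complex.Re (f x)) /\
  measurable_fun [set: Rn R n] (fun x : Rn R n => complex.Im (f x)).

Definition cmod f : Rn R n -> \bar R := fun x => (Normc.normc (f x))%:E.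

Definition cintegrable f :=
  cmeasurable f /\ (\int[@leb R n]_x cmod f x < +oo)%E.

Definition cintegral f : R[i] := Complex
  (\int[@leb R n]_(x in [set: Rn R n]) complex.Re (f x))%R
  (\int[@leb R n]_(x in [set: Rn R n]) complex.Im (f x))%R.

Definition normLp (p : R) f : \bar R := ('N[@leb R n]_(p%:E)[cmod f])%E.

Definition inLp (p : R) f := cmeasurable f /\ (normLp p f < +oo)%E.

End complex_functions.

Section weak_Lr.
Variables (R : realType) (n : nat).
Implicit Types (g : 'rV[R]_n -> R).

Definition norm_weakLr (r : R) g : \bar R :=
  ereal_sup [set (l%:E * (@leb R n [set y : Rn R n | (l < `|g y|)%R]) `^ r^-1)%E
            | l in [set l : R | 0 < l]].

Definition in_weakLr (r : R) g :=
  measurable_fun [set: Rn R n] (g : Rn R n -> R) /\ (norm_weakLr r g < +oo)%E.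

Definition radially_decreasing g :=
  exists psi : R -> R,
    [/\ forall s, 0 < s -> 0 <= psi s,
        forall s t, 0 < s -> s <= t -> psi t <= psi s &
        {ae @leb R n, forall y : Rn R n, g y = psi (eucl_norm y)}].

End weak_Lr.

Section bilinear_operator.
Variables (R : realType) (n : nat).
Implicit Types (g : 'rV[R]_n -> R).

Definition T_integrand g (f1 f2 : 'rV[R]_n -> R[i]) (x y : 'rV[R]_n) : R[i] :=
  f1 (x + y) * f2 (x - y) * Complex (g y) 0.

Definition T_defined g (f1 f2 : 'rV[R]_n -> R[i]) (x : 'rV[R]_n) :=
  cintegrable (T_integrand g f1 f2 x).

(* Only meaningful at the points x where T_defined g f1 f2 x holds; elsewhere
   cintegral returns an arbitrary value. *)
Definition T_op g (f1 f2 : 'rV[R]_n -> R[i]) (x : 'rV[R]_n) : R[i] :=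
  cintegral (T_integrand g f1 f2 x).

End bilinear_operator.

(* Convex hull of the five vertices; convex_set needs the R^o structure of
   R-module, the topology used for the interior is the usual one of R * R. *)
Definition pentagon (R : realType) (n : nat) (alpha : R) : set (R^o * R^o) :=
  smallest (@convex_set R (R^o * R^o)%type)
    [set z | z \in [:: (1, 1); (1, 0); (alpha / n%:R, 0);
                       (0, alpha / n%:R); (0, 1)]].

Definition Palpha (R : realType) (n : nat) (alpha : R) : set (R^o * R^o) :=
  (pentagon n alpha)°.

(* Main.v *)
Require Import Defs.
From HB Require Import structures.
From mathcomp Require Import all_boot all_order all_algebra.
From mathcomp Require Import all_classical all_reals all_analysis.
From mathcomp Require Import measurable_realfun complex.
From mathcomp Require Import ring lra.

Set Implicit Arguments.
Unset Strict Implicit.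
Unset Printing Implicit Defensive.

Import Order.TTheory GRing.Theory Num.Theory.
Import numFieldNormedType.Exports.

Local Open Scope classical_set_scope.
Local Open Scope ring_scope.

(** Write x_i = 1/p_i and let |y| be the sup norm.  The proof has three steps.

    Reduction to one kernel.  A level set of a radially decreasing g contains
    a cube minus a null set, so the weak norm controls g pointwise:
    g(y) <= D |g|_{r,oo} |y|^(alpha - n) almost everywhere
    ([radially_decreasing_le_riesz]).  As the modulus of an integral is at
    most twice the integral of the modulus, it remains to bound the positive
    operator [cross_op] with kernel [riesz (n - alpha)] applied to Borel
    functions F_i that agree a.e. with |f_i|.  The pentagon gives 0 < x_i < 1, and
    p > 0 says that alpha / n < x_1 + x_2.

    A level set estimate.  By homogeneity F_i = h_i ^ x_i with h_i >= 0 of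
    integral at most 1.  For some constant K, the set where the operator
    exceeds K has measure at most a constant times the sum of the integrals of
    the v_i = h_i ^ x_i 1_{h_i > 1} ([level_set_unit_scale]).
    To see this, dominate the kernel by 2^(ma) 1_{|y| < 2^-m} and
    2^(-ma) 1_{|y| < 2^m}, with a = n - alpha and m >= 0, and split
    F_i = u_i + v_i with u_i <= 1.  The u_1 u_2 parts, and the large cubes
    against a single v_i, sum to a bounded function.  What is left has small
    L^1 norm, except for the product v_1 v_2 over small cubes, where the factor
    2^(ma) is not compensated.  There the square root is integrated instead:
    for cubes of side s, averaging over translates of the cube and applying
    Cauchy-Schwarz gains s^(n/2) ([integral_sqrt_cross_cube]), and
    2^(ma/2) 2^(-mn/2) is summable because a < n.

    All levels.  The hypothesis 1/p + alpha/n = x_1 + x_2 is exactly the scaling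
    relation of the operator, so a dilation by r turns the estimate above into
    one for the level K r^(n/p), with h_i replaced by h_i / r^n
    ([level_set_all_scales]).  Summing 2^(jn) times the measure of the level set
    over r = 2^j, j in Z, bounds the integral of the p-th power of the operator,
    since the truncated powers telescope to a multiple of the integral of h_i
    ([zseries_powers_le]).  This is [cross_op_riesz_bounded].  No triangle
    inequality in L^p is involved, so p may well be less than 1. *)

(** * The product volume on tuples *)

Section tuple_volume.
Context (R : realType).
Local Notation mT := (measurableTypeR R).

Lemma measurable_cons_tuple m :
  measurable_fun setT (fun z : mT * m.-tuple mT => cons_tuple z.1 z.2).
Proof.
by apply: measurable_cons; [exact: measurable_fst | exact: measurable_snd].
Qed.

Lemma measurable_uncons_tuple m :
  measurable_fun setT (fun t : m.+1.-tuple mT => (thead t, behead_tuple t)).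
Proof.
apply: measurable_fun_pair; first exact: measurable_tnth.
apply/measurable_fun_tnthP => i /=.
rewrite (_ : _ \o _ = (fun t => tnth t (lift ord0 i))); first exact: measurable_tnth.
by apply/funext => t /=; rewrite tnth_behead; congr tnth; apply/val_inj; rewrite /= inordK// ltnS.
Qed.

Lemma sigma_finite_product d1 d2 (T1 : measurableType d1)
    (T2 : measurableType d2) (m1 : {sigma_finite_measure set T1 -> \bar R})
    (m2 : {sigma_finite_measure set T2 -> \bar R}) :
  sigma_finite setT (m1 \x m2)%E.
Proof.
have /sigma_finiteP[F [TF ndF Foo]] := sigma_finiteT m1.
have /sigma_finiteP[G [TG ndG Goo]] := sigma_finiteT m2.
exists (fun k => F k `*` G k).
  rewrite -setXTT TF TG predeqE => -[x y]; split; last first.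
    by move=> [k _ []/= ? ?]; split; exists k.
  move=> [/= [k _ Fkx] [l _ Gly]]; exists (maxn k l) => //; split.
  - by move: x Fkx; exact/subsetPset/ndF/leq_maxl.
  - by move: y Gly; exact/subsetPset/ndG/leq_maxr.
move=> k; have [? ?] := Foo k; have [? ?] := Goo k.
split; first exact: measurableX.
by rewrite product_measure1E// lte_mul_pinfty// ge0_fin_numE.
Qed.

(** Up to the bijection between pairs and tuples, [product_volume] is an iterated
    product measure; sigma-finiteness is carried along because each product
    requires it of its second factor. *)
Lemma product_volume_measure n :
  exists mu : {sigma_finite_measure set (n.-tuple mT) -> \bar R},
    forall A, mu A = product_volume A.
Proof.
elim: n => [|n [mu muE]].
  by exists (\d_([tuple] : 0.-tuple mT)).
pose P : {measure set (mT * n.-tuple mT)%type -> \bar R} :=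
  (@lebesgue_measure R \x mu)%E.
pose f := fun z : mT * n.-tuple mT => cons_tuple z.1 z.2.
have mf : measurable_fun setT f by exact: measurable_cons_tuple.
have PE A : pushforward P f A = product_volume A.
  rewrite /pushforward /P /product_measure1 /=.
  apply: eq_integral => x _ /=; rewrite -muE; congr (mu _).
  by apply/seteqP; split => t /=; rewrite /xsection/= inE.
pose m0 := measure_function_pushforward__canonical__measure_function_Measure P mf.
have sf : sigma_finite setT (m0 : set _ -> \bar R).
  have [F TF Foo] := sigma_finite_product lebesgue_measure mu.
  exists (fun k => (fun t => (thead t, behead_tuple t)) @^-1` F k).
    by rewrite -preimage_bigcup -TF preimage_setT.
  move=> k; have [mFk Fkoo] := Foo k; split.
    by rewrite -[X in measurable X]setTI; exact: measurable_uncons_tuple.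
  rewrite /= /pushforward -comp_preimage.
  rewrite (_ : _ \o f = id) ?preimage_id//.
  by apply/funext => -[x t] /=; rewrite /f/= theadE; congr pair; exact/val_inj.
pose H := Measure_isSigmaFinite.Build _ _ _ m0 sf.
pose m1 : {sigma_finite_measure set (n.+1.-tuple mT) -> \bar R} :=
  HB.pack_for (SigmaFiniteMeasure.type (n.+1.-tuple mT) R) (Measure.sort m0) H.
by exists m1.
Qed.

Lemma measurable_affine (a b : R) :
  measurable_fun setT (fun x : mT => a * x + b : mT).
Proof. by apply: measurable_realfun.measurable_funD => //; apply: measurable_funM. Qed.

(** The scaled pushforward agrees with Lebesgue measure on the intervals
    ]c, d], and these determine it. *)
Lemma lebesgue_measure_affine_gt0 (a b : R) (A : set mT) :
  0 < a -> measurable A ->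
  lebesgue_measure ((fun x => a * x + b) @^-1` A) =
  (a^-1%:E * lebesgue_measure A)%E.
Proof.
move=> a0 mA.
have mf := measurable_affine a b.
pose h (x : mT) : mT := a * x + b.
pose m0 : {measure set mT -> \bar R} :=
  measure_function_pushforward__canonical__measure_function_Measure
    (@lebesgue_measure R) mf.
suff -> : lebesgue_measure A = mscale (NngNum (ltW a0)) m0 A.
  by rewrite /mscale/= /pushforward muleA -EFinM mulVf ?gt_eqF// mul1e.
apply: lebesgue_measure_unique => //= _ [[c d]] _ <-.
rewrite /mscale/= /pushforward.
have -> : (fun x : mT => a * x + b) = h by [].
have -> : h @^-1` [set` `]c, d]] = [set` `](c - b) / a, (d - b) / a]].
  apply/seteqP; split => x /=; rewrite !in_itv/= /h;
  by rewrite ltr_pdivrMr// ler_pdivlMr// ltrBlDr lerBrDr [a * x]mulrC.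
rewrite !lebesgue_measure_itv/= !lte_fin.
rewrite ltr_pM2r ?invr_gt0// ltrD2r; case: ifPn => // _; last by rewrite mule0.
rewrite -!EFinB -EFinM; congr EFin; rewrite -mulrBl mulrC -mulrA mulVf ?gt_eqF//.
ring.
Qed.

Lemma lebesgue_measure_affine (a b : R) (A : set mT) :
  a != 0 -> measurable A ->
  lebesgue_measure ((fun x => a * x + b) @^-1` A) =
  (`|a|^-1%:E * lebesgue_measure A)%E.
Proof.
rewrite neq_lt => /orP[a0|a0] mA; last first.
  by rewrite gtr0_norm// lebesgue_measure_affine_gt0.
rewrite ltr0_norm// -(@lebesgue_measure_affine_gt0 _ b) ?oppr_gt0//.
rewrite -lebesgue_measureN; last first.
  by rewrite -[X in measurable X]setTI; exact: measurable_affine.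
rewrite /pushforward; congr (lebesgue_measure _).
by apply/seteqP; split => x /=; rewrite mulrN mulNr ?opprK.
Qed.

Lemma ge0_integral_affine (a b : R) (f : mT -> \bar R) :
  a != 0 -> measurable_fun setT f -> (forall x, 0 <= f x)%E ->
  (\int[lebesgue_measure]_x f (a * x + b)%R =
   `|a|^-1%:E * \int[lebesgue_measure]_x f x)%E.
Proof.
move=> a0 mf f0.
have ma : 0 <= `|a|^-1 by rewrite invr_ge0.
pose h (x : mT) : mT := a * x + b.
have mh : measurable_fun setT h by exact: measurable_affine.
rewrite -[RHS](@ge0_integral_mscale _ _ _ _ _ _ (NngNum ma))//.
transitivity (\int[pushforward lebesgue_measure h]_x f x)%E.
  by rewrite ge0_integral_pushforward.
apply: eq_measure_integral => A mA _.
exact: lebesgue_measure_affine.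
Qed.

Definition tuple_affine n (a : R) (b : n.-tuple R) (t : n.-tuple mT) :
  n.-tuple mT := [tuple a * tnth t i + tnth b i | i < n].

Lemma measurable_tuple_affine n a (b : n.-tuple R) :
  measurable_fun setT (tuple_affine a b).
Proof.
apply/measurable_fun_tnthP => i.
rewrite (_ : _ \o _ = (fun x => a * x + tnth b i) \o (fun t => tnth t i)).
  by apply: measurableT_comp; [exact: measurable_affine|exact: measurable_tnth].
by apply/funext => t /=; rewrite tnth_mktuple.
Qed.

Lemma tuple_affine_cons n a (b : n.+1.-tuple R) x (t : n.-tuple mT) :
  tuple_affine a b (cons_tuple x t) =
  cons_tuple (a * x + thead b) (tuple_affine a (behead_tuple b) t).
Proof.
apply: eq_from_tnth => i; rewrite tnth_mktuple.
case: (unliftP ord0 i) => [j ->|->].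
  rewrite !tnthS tnth_mktuple tnth_behead; congr (_ + tnth _ _).
  by apply/val_inj; rewrite /= inordK// ltnS.
by rewrite !tnth0.
Qed.

Lemma measurable_product_volume_section n (A : set (n.+1.-tuple mT)) :
  measurable A ->
  measurable_fun setT
    (fun x : mT => product_volume [set t | A (cons_tuple x t)] : \bar R).
Proof.
move=> mA.
have [mu muE] := product_volume_measure n.
under eq_fun do rewrite -muE.
pose f := fun z : mT * n.-tuple mT => cons_tuple z.1 z.2.
have mf : measurable_fun setT f by exact: measurable_cons_tuple.
have mB : measurable (f @^-1` A) by rewrite -[X in measurable X]setTI; exact: mf.
have := measurable_fun_xsection mu mB.
apply: eq_measurable_fun => x _ /=; congr (mu _).
by apply/seteqP; split => t /=; rewrite /xsection/= inE.
Qed.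

Lemma measurable_cons_section n (A : set (n.+1.-tuple mT)) x :
  measurable A -> measurable [set t | A (cons_tuple x t)].
Proof.
move=> mA; rewrite -[X in measurable X]setTI.
have mf : measurable_fun setT (fun t : n.-tuple mT => cons_tuple (x : mT) t).
  by apply: measurable_cons.
exact: mf.
Qed.

(** Induction on n: the section at x of the preimage is the affine preimage of the
    section at a x + b_0. *)
Lemma product_volume_affine n a (b : n.-tuple R) (A : set (n.-tuple mT)) :
  a != 0 -> measurable A ->
  product_volume (tuple_affine a b @^-1` A) =
  ((`|a| ^- n)%:E * product_volume A)%E.
Proof.
move=> a0; elim: n b A => [|n IH] b A mA /=.
  rewrite expr0 invr1 mul1e; congr (\d_ _ _).
  by apply/seteqP; split => t /=; rewrite (tuple0 (tuple_affine _ _ t)) (tuple0 t).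
under eq_integral => x _.
  rewrite (_ : [set t | _] = tuple_affine a (behead_tuple b) @^-1`
      [set t | A (cons_tuple (a * x + thead b) t)]); last first.
    by apply/seteqP; split => t /=; rewrite tuple_affine_cons.
  rewrite IH; last exact: measurable_cons_section.
  over.
rewrite ge0_integralZl//=; last 2 first.
  - have h := measurable_product_volume_section mA.
    by apply: (measurableT_comp h); exact: measurable_affine.
  - by move=> x _; exact: product_volume_ge0.
rewrite (ge0_integral_affine (thead b)
  (f := fun x => product_volume [set t | A (cons_tuple x t)]) a0); last 2 first.
  - exact: measurable_product_volume_section.
  - by move=> x; exact: product_volume_ge0.
by rewrite muleA -EFinM -invfM -exprSr.
Qed.

Lemma product_volume_cube n (s : R) : 0 <= s ->
  product_volume [set t : n.-tuple mT | forall i, `|tnth t i| < s] =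
  ((2 * s) ^+ n)%:E.
Proof.
move=> s0; elim: n => [|n IH] /=.
  rewrite diracE mem_set ?expr0//.
  by case.
transitivity (\int[@lebesgue_measure R]_(x in `](-s)%R, s[%classic) ((2 * s) ^+ n)%:E)%E.
  rewrite [RHS]integral_mkcond; apply: eq_integral => x _.
  rewrite patchE; case: ifPn => [|/negP]; rewrite inE/= in_itv/= -ltr_norml => xs.
    rewrite -IH; congr product_volume; apply/seteqP; split => t /= h i.
      by have := h (lift ord0 i); rewrite tnthS.
    by case: (unliftP ord0 i) => [j ->|->]; rewrite ?tnthS ?tnth0.
  rewrite [X in product_volume X](_ : _ = set0) ?product_volume0//.
  by apply/seteqP; split => // t /= /(_ ord0); rewrite tnth0.
rewrite integral_cst//= lebesgue_measure_itv/= lte_fin.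
rewrite exprSr EFinM; congr (_ * _)%E.
case: ifPn => [_|]; first by rewrite -EFinD opprK -mulr2n mulr_natl.
rewrite -leNgt lerNr -subr_ge0 => ss.
have -> : s = 0 by lra.
by rewrite mulr0.
Qed.

End tuple_volume.

(** * Lebesgue measure on R^n *)

Section lebesgue_Rn.
Context (R : realType) (n : nat).
Local Notation mT := (measurableTypeR R).
Local Notation V := 'rV[R]_n.
Local Notation Rn := (Rn R n).
Local Notation leb := (@leb R n).

Definition row_of_tuple (t : n.-tuple R) : V := \row_i tnth t i.
Definition tuple_of_row (x : V) : n.-tuple R := [tuple x 0 i | i < n].

Lemma row_of_tupleK : cancel row_of_tuple tuple_of_row.
Proof. by move=> t; apply: eq_from_tnth => i; rewrite tnth_mktuple mxE. Qed.

Lemma tuple_of_rowK : cancel tuple_of_row row_of_tuple.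
Proof. by move=> x; apply/rowP => i; rewrite mxE tnth_mktuple. Qed.

Lemma row_of_tuple_affine a b (t : n.-tuple R) :
  row_of_tuple (tuple_affine a b t) = a *: row_of_tuple t + row_of_tuple b.
Proof. by apply/rowP => i; rewrite !mxE tnth_mktuple. Qed.

(** Every Borel cover of A pulls back to a Borel cover of the affine preimage. *)
Lemma le_lebesgue_outer_affine (a : R) (b : V) (A : set V) : a != 0 ->
  (@lebesgue_outer R n [set x | A (a *: x + b)%R] <=
   (`|a| ^- n)%:E * @lebesgue_outer R n A)%E.
Proof.
move=> a0; have c0 : 0 < `|a| ^+ n by rewrite exprn_gt0 // normr_gt0.
rewrite -lee_pdivrMl ?invr_gt0// invrK {2}/lebesgue_outer.
apply: le_ereal_inf_tmp => _ [F [mF AF] <-].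
rewrite muleC -lee_pdivlMr// muleC.
rewrite -nneseriesZl; last by move=> i _; exact: product_volume_ge0.
pose G k := tuple_affine a (tuple_of_row b) @^-1` F k.
under eq_eseriesr => k _.
  rewrite -(@product_volume_affine _ _ _ (tuple_of_row b)) ?mF//; over.
apply: ereal_inf_lbound; exists G => //; split.
  by move=> k; rewrite -[X in measurable X]setTI; exact: measurable_tuple_affine.
move=> t /= At; rewrite -preimage_bigcup; apply: AF => /=.
by rewrite -/(row_of_tuple _) row_of_tuple_affine tuple_of_rowK.
Qed.

Lemma lebesgue_outer_affine (a : R) (b : V) (A : set V) : a != 0 ->
  @lebesgue_outer R n [set x | A (a *: x + b)] =
  ((`|a| ^- n)%:E * @lebesgue_outer R n A)%E.
Proof.
move=> a0; have c0 : 0 < `|a| ^+ n by rewrite exprn_gt0 // normr_gt0.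
apply/eqP; rewrite eq_le le_lebesgue_outer_affine//=.
rewrite muleC lee_pdivrMr// muleC.
have -> : A = [set x | [set x | A (a *: x + b)] (a^-1 *: x + - (a^-1 *: b))].
  apply/seteqP; split => x /=; rewrite scalerDr scalerN !scalerA mulfV// !scale1r subrK//.
have a0' : a^-1 != 0 by rewrite invr_eq0.
apply: (le_trans (le_lebesgue_outer_affine _ _ a0')).
rewrite normfV exprVn invrK.
rewrite [X in (_ <= _ * @lebesgue_outer R n X)%E](_ : _ = [set x | A (a *: x + b)%R])//.
apply/seteqP; split => x /=;
  by rewrite scalerDr scalerN !scalerA mulfV// !scale1r subrK.
Qed.

(** The map is a bijection scaling the outer measure of every set by the same
    factor, so it carries Caratheodory's splitting condition along. *)
Lemma caratheodory_affine (a : R) (b : V) (A : set Rn) : a != 0 ->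
  measurable A -> measurable ([set x | A (a *: (x : V) + b)] : set Rn).
Proof.
move=> a0 mA.
have {}mA : (@lebesgue_outer R n).-caratheodory A by exact: mA.
suff h : (@lebesgue_outer R n).-caratheodory [set x | A (a *: (x : V) + b)].
  exact: h.
move=> X.
have c0 : 0 < `|a| ^+ n by rewrite exprn_gt0 // normr_gt0.
pose Y : set V := [set x | X (a^-1 *: x + - (a^-1 *: b))].
have XE : X = [set x | Y (a *: x + b)].
  apply/seteqP; split => x; rewrite /Y/= scalerDr !scalerA mulVf// scale1r addrK//.
rewrite XE.
rewrite (_ : _ `&` _ = [set x | (Y `&` A) (a *: (x : V) + b)])//.
rewrite (_ : _ `&` ~` _ = [set x | (Y `&` ~` A) (a *: (x : V) + b)])//.
rewrite (lebesgue_outer_affine b Y a0) (lebesgue_outer_affine b (Y `&` A) a0).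
rewrite (lebesgue_outer_affine b (Y `&` ~` A) a0) -muleDr//; first by congr (_ * _)%E; exact: (mA Y).
by rewrite ge0_adde_def// inE; exact: lebesgue_outer_ge0.
Qed.

Lemma measurable_affine_Rn (a : R) (b : V) : a != 0 ->
  measurable_fun setT (fun x : Rn => a *: (x : V) + b : Rn).
Proof. by move=> a0 _ A mA; rewrite setTI; exact: caratheodory_affine. Qed.

Lemma leb_affine (a : R) (b : V) (A : set Rn) : a != 0 ->
  leb [set x | A (a *: (x : V) + b)] = ((`|a| ^- n)%:E * leb A)%E.
Proof. exact: lebesgue_outer_affine. Qed.

Lemma ge0_integral_affine_Rn (a : R) (b : V) (f : Rn -> \bar R) : a != 0 ->
  measurable_fun setT f -> (forall x, 0 <= f x)%E ->
  (\int[leb]_x f (a *: (x : V) + b)%R =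
   (`|a| ^- n)%:E * \int[leb]_x f x)%E.
Proof.
move=> a0 mf f0.
have c0 : 0 <= `|a| ^- n by rewrite invr_ge0 exprn_ge0.
have mh := measurable_affine_Rn b a0.
rewrite -[RHS](@ge0_integral_mscale _ _ _ _ _ _ (NngNum c0))//.
transitivity (\int[pushforward leb (fun x : Rn => (a *: (x : V) + b)%R : Rn)]_x f x)%E.
  by rewrite ge0_integral_pushforward.
by apply: eq_measure_integral => A mA _; exact: leb_affine.
Qed.

Lemma measurable_tuple_of_row :
  measurable_fun [set: Rn] (tuple_of_row : Rn -> n.-tuple mT).
Proof.
move=> _ B mB; rewrite setTI.
have [mu muE] := product_volume_measure R n.
have muE' : @product_volume R n = mu by apply/funext => A; rewrite muE.
have cB := caratheodory_measurable_mu_ext mu mB.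
suff h : (@lebesgue_outer R n).-caratheodory (tuple_of_row @^-1` B).
  exact: h.
move=> X; rewrite /lebesgue_outer muE'.
have := cB [set t | X (\row_i tnth t i)].
rewrite (_ : _ `&` B = [set t | (X `&` tuple_of_row @^-1` B) (\row_i tnth t i)]).
  rewrite (_ : _ `&` ~` B =
    [set t | (X `&` ~` (tuple_of_row @^-1` B)) (\row_i tnth t i)]) => [//|].
  by apply/seteqP; split => t /=; rewrite -/(row_of_tuple t) row_of_tupleK.
by apply/seteqP; split => t /=; rewrite -/(row_of_tuple t) row_of_tupleK.
Qed.

Lemma measurable_tuple_preimage (B : set (n.-tuple mT)) : measurable B ->
  measurable (tuple_of_row @^-1` B : set Rn).
Proof.
by move=> mB; rewrite -[X in measurable X]setTI; exact: measurable_tuple_of_row.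
Qed.

Lemma leb_tuple_of_row (B : set (n.-tuple mT)) : measurable B ->
  leb (tuple_of_row @^-1` B) = product_volume B.
Proof.
move=> mB; have [mu muE] := product_volume_measure R n.
have muE' : @product_volume R n = mu by apply/funext => A; rewrite muE.
rewrite /Defs.leb /lebesgue_outer muE' -measurable_mu_extE//; congr (mu_ext _ _).
by apply/seteqP; split => t /=; rewrite -/(row_of_tuple t) row_of_tupleK.
Qed.

Lemma measurable_coord (i : 'I_n) :
  measurable_fun [set: Rn] (fun x : Rn => (x : V) 0 i : R).
Proof.
have := measurableT_comp (measurable_tnth i) measurable_tuple_of_row.
by apply: eq_measurable_fun => x _ /=; rewrite tnth_mktuple.
Qed.

Lemma measurable_norm_lt d (X : measurableType d) (f : X -> R) s :
  measurable_fun setT f -> measurable [set x | `|f x| < s].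
Proof.
move=> mf; have mnf := measurableT_comp (@normr_measurable R setT) mf.
have := mnf measurableT `]-oo, s[%classic (measurable_itv _).
by rewrite setTI; congr measurable; apply/seteqP; split => x /=; rewrite in_itv.
Qed.

Definition cube (s : R) : set Rn := [set x | forall i, `|(x : V) 0 i| < s].

Lemma measurable_cube s : measurable (cube s).
Proof.
rewrite (_ : cube s = \bigcap_(i in [set: 'I_n]) [set x | `|(x : V) 0 i| < s]).
  apply: fin_bigcap_measurable => // i _.
  by apply: measurable_norm_lt; exact: measurable_coord.
by apply/seteqP; split => x h i; [move=> _|]; exact: h.
Qed.

Lemma leb_cube s : 0 <= s -> leb (cube s) = ((2 * s) ^+ n)%:E.
Proof.
move=> s0; rewrite -product_volume_cube//.
pose B : set (n.-tuple mT) := [set t | forall i, `|tnth t i| < s].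
rewrite -/B -leb_tuple_of_row.
  congr leb; apply/seteqP; split => x /= h i; have := h i;
  by rewrite tnth_mktuple.
rewrite (_ : B = \bigcap_(i in [set: 'I_n]) [set t | `|tnth t i| < s]).
  apply: fin_bigcap_measurable => // i _.
  by apply: measurable_norm_lt; exact: measurable_tnth.
by apply/seteqP; split => x h i; [move=> _|]; exact: h.
Qed.

Lemma bigcup_cube : \bigcup_k cube k%:R = setT.
Proof.
apply/seteqP; split => // x _.
exists (Num.truncn (\sum_i `|(x : V) 0 i|)).+1 => // i.
apply: le_lt_trans (truncnS_gt _).
by rewrite (bigD1 i)//= lerDl sumr_ge0.
Qed.

Lemma sigma_finite_leb : sigma_finite setT leb.
Proof.
exists (fun k => cube k%:R); first by rewrite bigcup_cube.
by move=> k; split; [exact: measurable_cube|rewrite leb_cube// ltry].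
Qed.

HB.instance Definition _ := Measure_isSigmaFinite.Build _ _ _ leb sigma_finite_leb.

(** Borel, as opposed to Lebesgue, measurability is kept as a separate notion: for a
    merely Lebesgue measurable f, the function (x, y) |-> f (x + y) need not be
    measurable on the product of [Rn] with itself, as Tonelli's theorem requires. *)
Definition borel (f : V -> R) :=
  measurable_fun [set: n.-tuple mT] (fun t => f (row_of_tuple t)).

(** Intersect covers whose total volumes exceed the outer measure by less than 1/(k+1). *)
Lemma borel_hull (E : set Rn) : (leb E < +oo)%E ->
  exists B : set (n.-tuple mT), [/\ measurable B, E `<=` tuple_of_row @^-1` B &
    leb (tuple_of_row @^-1` B) = leb E].
Proof.
move=> Eoo.
have Efin : lebesgue_outer E \is a fin_num.
  by rewrite ge0_fin_numE//; exact: lebesgue_outer_ge0.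
have cov k : exists F : (set (n.-tuple mT))^nat,
    measurable_cover [set t | E (row_of_tuple t)] F /\
    (\sum_(0 <= i <oo) product_volume (F i) <
       lebesgue_outer E + (k.+1%:R^-1)%:E)%E.
  have k0 : 0 < k.+1%:R^-1 :> R by rewrite invr_gt0.
  by have [_ [F cF <-] lF] := lb_ereal_inf_adherent k0 Efin; exists F.
have [F cF] := choice cov.
pose U k := \bigcup_i F k i.
have mU k : measurable (U k).
  by apply: bigcupT_measurable => i; have [[/(_ i)]] := cF k.
exists (\bigcap_k U k).
have mB : measurable (\bigcap_k U k) by exact: bigcapT_measurable.
have sB : E `<=` tuple_of_row @^-1` (\bigcap_k U k).
  move=> x Ex k _ /=; have [[_ +] _] := cF k; apply.
  by rewrite /= tuple_of_rowK.
split => //; apply/eqP; rewrite eq_le; apply/andP; split; last first.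
  exact: le_lebesgue_outer.
apply/lee_addgt0Pr => e e0.
have [k ke] : exists k, k.+1%:R^-1 < e.
  exists (Num.truncn e^-1); rewrite invf_plt ?posrE//; exact: truncnS_gt.
rewrite leb_tuple_of_row//.
have [[mFk _] /ltW Fk] := cF k.
apply: (@le_trans _ _ (lebesgue_outer E + (k.+1%:R^-1)%:E)%E); last first.
  by rewrite leeD2l// lee_fin ltW.
apply: le_trans Fk.
have [mu muE] := product_volume_measure R n.
under eq_eseriesr do rewrite -muE.
rewrite -muE; apply: (@le_trans _ _ (mu (U k))).
  by apply: le_measure; rewrite ?inE//; exact: bigcap_inf.
exact: measure_sigma_subadditive.
Qed.

Lemma borel_null_hull (N : set Rn) : leb N = 0%E ->
  exists2 B : set (n.-tuple mT), measurable B &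
    N `<=` tuple_of_row @^-1` B /\ leb (tuple_of_row @^-1` B) = 0%E.
Proof.
move=> N0; have [|B [mB NB BN]] := @borel_hull N; first by rewrite N0 ltry.
by exists B => //; rewrite BN.
Qed.

(** On each cube E has finite measure, so the difference between E and its hull is
    null and is itself covered by a Borel null set Z. *)
Lemma measurable_hull (E : set Rn) : measurable E ->
  exists B Z : set (n.-tuple mT), [/\ measurable B, measurable Z,
    leb (tuple_of_row @^-1` Z) = 0%E &
    E `\` tuple_of_row @^-1` Z = tuple_of_row @^-1` (B `\` Z)].
Proof.
move=> mE.
pose C k : set Rn := cube k%:R.
have hul k : exists BZ : set (n.-tuple mT) * set (n.-tuple mT),
    [/\ measurable BZ.1, measurable BZ.2,
     leb (tuple_of_row @^-1` BZ.2) = 0%E,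
     E `&` C k `<=` tuple_of_row @^-1` BZ.1 &
     tuple_of_row @^-1` BZ.1 `\` (E `&` C k) `<=` tuple_of_row @^-1` BZ.2].
  have mEC : measurable (E `&` C k) by apply: measurableI => //; exact: measurable_cube.
  have foo : (leb (E `&` C k) < +oo)%E.
    apply: (@le_lt_trans _ _ (leb (C k))); last by rewrite leb_cube// ltry.
    by apply: le_measure; rewrite ?inE//; exact: measurable_cube.
  have [B [mB EB BE]] := borel_hull foo.
  have N0 : leb (tuple_of_row @^-1` B `\` (E `&` C k)) = 0%E.
    rewrite measureD//=; first by rewrite setIC (setIidl EB) BE subee// ge0_fin_numE.
    - exact: measurable_tuple_preimage.
    - by rewrite BE.
  have [Z mZ [NZ Z0]] := borel_null_hull N0.
  by exists (B, Z).
have [BZ hBZ] := choice hul.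
exists (\bigcup_k (BZ k).1), (\bigcup_k (BZ k).2); split.
- by apply: bigcupT_measurable => k; have [] := hBZ k.
- by apply: bigcupT_measurable => k; have [] := hBZ k.
- rewrite preimage_bigcup; apply/eqP; rewrite eq_le measure_ge0 andbT.
  apply: (@le_trans _ _ (\sum_(0 <= k <oo) leb (tuple_of_row @^-1` (BZ k).2))%E).
    exact: outer_measure_sigma_subadditive.
  by rewrite eseries0// => k _ _; have [] := hBZ k.
- apply/seteqP; split => x /= [].
    move=> Ex nZ; split => //.
    have [k _ Ck] : (\bigcup_k C k) x by rewrite bigcup_cube.
    by exists k => //; have [_ _ _ + _] := hBZ k; apply.
  move=> [k _ Bk] nZ; split => //; apply: contrapT => nE; apply: nZ.
  exists k => //; have [_ _ _ _ +] := hBZ k; apply; split => //.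
  by case.
Qed.

(** Redefine f as 0 on the union of the Borel null sets attached to the countably
    many sets where f exceeds a rational. *)
Lemma borel_ae_eq (f : Rn -> R) : measurable_fun setT f -> (forall x, 0 <= f x) ->
  exists g : V -> R, [/\ borel g, forall x, 0 <= g x &
    {ae leb, forall x, f x = g x}].
Proof.
move=> mf f0.
pose q k : R := ratr (odflt 0 (unpickle k : option rat)).
have qd (x y : R) : x < y -> exists k, x < q k < y.
  move=> /rat_in_itvoo[r]; rewrite in_itv/= => xry.
  by exists (pickle r); rewrite /q pickleK.
have mE k : measurable [set x | q k < f x].
  have := mf measurableT `]q k, +oo[%classic (measurable_itv _).
  by rewrite setTI; congr measurable; apply/seteqP; split => x /=; rewrite in_itv/= andbT.
have hul k : exists BZ : set (n.-tuple mT) * set (n.-tuple mT),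
    [/\ measurable BZ.1, measurable BZ.2,
    leb (tuple_of_row @^-1` BZ.2) = 0%E &
    [set x | q k < f x] `\` tuple_of_row @^-1` BZ.2 =
    tuple_of_row @^-1` (BZ.1 `\` BZ.2)].
  by have [B [Z [? ? ? ?]]] := measurable_hull (mE k); exists (B, Z).
have [BZ hBZ] := choice hul.
pose Z : set (n.-tuple mT) := \bigcup_k (BZ k).2.
have mZ : measurable Z.
  by apply: bigcupT_measurable => k; have [] := hBZ k.
have Z0 : leb (tuple_of_row @^-1` Z) = 0%E.
  rewrite preimage_bigcup; apply/negligibleP.
    by rewrite -preimage_bigcup; exact: measurable_tuple_preimage.
  apply: negligible_bigcup => k; have [_ mZk Zk0 _] := hBZ k.
  by apply/negligibleP => //; exact: measurable_tuple_preimage.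
pose g x := if tuple_of_row x \in Z then 0 else f x.
have gE k : 0 <= q k :> R ->
    [set t | q k < g (row_of_tuple t)] = (BZ k).1 `\` Z.
  move=> qk; have [_ _ _ E] := hBZ k.
  apply/seteqP; split => t /=; rewrite /g row_of_tupleK.
    case: ifPn => [_|]; first by rewrite ltNge qk.
    rewrite notin_setE => nZ qf; split => //.
    have : ([set x | q k < f x] `\` tuple_of_row @^-1` (BZ k).2) (row_of_tuple t).
      by split => //=; rewrite row_of_tupleK => Zk; apply: nZ; exists k.
    by rewrite E /= row_of_tupleK => -[].
  move=> [Bt nZ]; rewrite ifF; last by apply/negbTE; rewrite notin_setE.
  have : (tuple_of_row @^-1` ((BZ k).1 `\` (BZ k).2)) (row_of_tuple t).
    by rewrite /= row_of_tupleK; split => // Zk; apply: nZ; exists k.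
  by rewrite -E => -[].
exists g; split.
- apply: (measurability _ (RGenOInfty.measurableE R)) => // _ [_ [x ->] <-].
  rewrite setTI; have [x0|x0] := ltP x 0.
    rewrite (_ : _ @^-1` _ = setT)//; apply/seteqP; split => // t _ /=.
    rewrite in_itv/= andbT (lt_le_trans x0)// /g; case: ifP => // _; exact: f0.
  rewrite (_ : _ @^-1` _ = \bigcup_(k in [set k | x < q k]) ((BZ k).1 `\` Z)).
    apply: bigcup_measurable => k _; apply: measurableD => //.
    by have [] := hBZ k.
  apply/seteqP; split => t /=; rewrite in_itv/= andbT.
    move=> /qd[k /andP[xk kg]]; exists k => //.
    by rewrite -gE ?(le_trans x0 (ltW xk)).
  move=> [k xk]; rewrite -gE ?(le_trans x0 (ltW xk))//=.
  exact: lt_trans.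
- by move=> x; rewrite /g; case: ifP.
- exists (tuple_of_row @^-1` Z); split => //; first exact: measurable_tuple_preimage.
  move=> x /= fg; apply: contrapT => nZ; apply: fg; rewrite /g ifF//.
  by apply/negbTE; rewrite notin_setE.
Qed.

End lebesgue_Rn.

(** * Integrals over R^n *)

(** The integral of a nonnegative function is a supremum over the simple functions
    below it, hence monotone even on functions that are not measurable. *)
Lemma le_integralT d (X : measurableType d) (R : realType)
    (mu : {measure set X -> \bar R}) (f1 f2 : X -> \bar R) :
  (forall x, 0 <= f1 x)%E -> (forall x, f1 x <= f2 x)%E ->
  (\int[mu]_x f1 x <= \int[mu]_x f2 x)%E.
Proof.
move=> f10 f12.
rewrite !ge0_integralTE//; last by move=> x; exact: le_trans (f12 x).
apply: ereal_sup_le => _ [h hf <-]; exists h => // x.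
exact: le_trans (f12 x).
Qed.

Section integrals.
Context (R : realType) (n : nat).
Local Notation V := 'rV[R]_n.
Local Notation Rn := (Rn R n).
Local Notation leb := (@leb R n).
Local Open Scope ereal_scope.

Lemma ge0_integral_shift (x : V) (f : Rn -> \bar R) :
  measurable_fun setT f -> (forall y, 0 <= f y) ->
  \int[leb]_y f (x + (y : V))%R = \int[leb]_y f y.
Proof.
move=> mf f0; have := ge0_integral_affine_Rn x (oner_neq0 R) mf f0.
rewrite normr1 expr1n invr1 mul1e => <-.
by apply: eq_integral => y _; rewrite scale1r addrC.
Qed.

Lemma ge0_integral_reflect (x : V) (f : Rn -> \bar R) :
  measurable_fun setT f -> (forall y, 0 <= f y) ->
  \int[leb]_y f (x - (y : V))%R = \int[leb]_y f y.
Proof.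
have N1 : (-1 != 0 :> R)%R by rewrite oppr_eq0 oner_neq0.
move=> mf f0; have := ge0_integral_affine_Rn x N1 mf f0.
rewrite normrN1 expr1n invr1 mul1e => <-.
by apply: eq_integral => y _; rewrite scaleN1r addrC.
Qed.

Lemma ge0_integral_dilate (a : R) (f : Rn -> \bar R) : (0 < a)%R ->
  measurable_fun setT f -> (forall y, 0 <= f y) ->
  \int[leb]_y f (a *: (y : V))%R = (a ^- n)%:E * \int[leb]_y f y.
Proof.
move=> a0 mf f0; have := ge0_integral_affine_Rn 0%R (lt0r_neq0 a0) mf f0.
rewrite gtr0_norm// => <-.
by apply: eq_integral => y _; rewrite addr0.
Qed.

(** Coordinatewise measurability, which suffices to precompose a Borel function; a
    sum of maps into [Rn] need not be measurable for the completed sigma-algebra. *)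
Definition row_measurable d (X : measurableType d) (g : X -> V) :=
  forall i, measurable_fun setT (fun x => g x 0%R i : R).

Section row_measurable.
Context d (X : measurableType d).
Implicit Types g h : X -> V.

Lemma row_measurable_cst (v : V) : row_measurable (fun _ : X => v).
Proof. by move=> i; exact: measurable_cst. Qed.

Lemma row_measurableD g h : row_measurable g -> row_measurable h ->
  row_measurable (fun x => g x + h x)%R.
Proof.
move=> mg mh i; have := measurable_funD (mg i) (mh i).
by apply: eq_measurable_fun => x _ /=; rewrite !mxE.
Qed.

Lemma row_measurableZ (a : R) g : row_measurable g ->
  row_measurable (fun x => a *: g x)%R.
Proof.
move=> mg i; have := measurable_funM (measurable_cst a) (mg i).
by apply: eq_measurable_fun => x _ /=; rewrite !mxE.
Qed.

Lemma row_measurableB g h : row_measurable g -> row_measurable h ->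
  row_measurable (fun x => g x - h x)%R.
Proof.
move=> mg mh; apply: row_measurableD => // i.
have := measurable_funN (mh i).
by apply: eq_measurable_fun => x _ /=; rewrite !mxE.
Qed.

End row_measurable.

Lemma row_measurable_id : row_measurable (fun x : Rn => x : V).
Proof. exact: measurable_coord. Qed.

Lemma row_measurable_comp d d' (X : measurableType d) (Y : measurableType d')
    (g : X -> V) (f : Y -> X) :
  row_measurable g -> measurable_fun setT f -> row_measurable (g \o f).
Proof. by move=> mg mf i; exact: (measurableT_comp (mg i)). Qed.

Lemma row_measurable_fst d (X : measurableType d) :
  row_measurable (fun z : Rn * X => z.1 : V).
Proof. by apply: (row_measurable_comp row_measurable_id); exact: measurable_fst. Qed.

Lemma row_measurable_snd d (X : measurableType d) :
  row_measurable (fun z : X * Rn => z.2 : V).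
Proof. by apply: (row_measurable_comp row_measurable_id); exact: measurable_snd. Qed.

Lemma measurable_borel d (X : measurableType d) (f : V -> R) (g : X -> V) :
  borel f -> row_measurable g -> measurable_fun setT (fun x => f (g x)).
Proof.
move=> bf mg.
have mt : measurable_fun setT (fun x => tuple_of_row (g x) : n.-tuple (measurableTypeR R)).
  apply/measurable_fun_tnthP => i; apply: eq_measurable_fun (mg i) => x _ /=.
  by rewrite tnth_mktuple.
have := measurableT_comp bf mt.
by apply: eq_measurable_fun => x _ /=; rewrite tuple_of_rowK.
Qed.

Lemma measurable_borel_id (f : V -> R) :
  borel f -> measurable_fun [set: Rn] (f : Rn -> R).
Proof. by move=> bf; exact: (measurable_borel bf row_measurable_id). Qed.

(** The map (w, y) |-> (w + y, w - y) multiplies volumes by 2^n; it is the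
    composition of the shear y |-> y - w with w |-> 2 w - y. *)
Lemma integral_cross (f g : V -> R) : borel f -> borel g ->
  (forall x, 0 <= f x)%R -> (forall x, 0 <= g x)%R ->
  \int[leb]_w \int[leb]_y (f ((w : V) + y) * g ((w : V) - y))%:E =
  (2 ^- n)%:E * (\int[leb]_y (f y)%:E * \int[leb]_y (g y)%:E).
Proof.
move=> bf bg f0 g0.
transitivity (\int[leb]_w \int[leb]_y (f y * g (2 *: (w : V) - y))%:E).
  apply: eq_integral => w _.
  pose F := fun y : Rn => (f (y : V) * g (2 *: (w : V) - y))%:E.
  rewrite -[RHS](ge0_integral_shift w (f := F)).
  - by apply: eq_integral => y _; rewrite /F scaler_nat mulr2n opprD addrACA subrr add0r.
  - apply/measurable_EFinP; apply: measurable_funM; first exact: measurable_borel_id.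
    apply: (measurable_borel bg); apply: row_measurableB; last exact: row_measurable_id.
    exact: row_measurable_cst.
  - by move=> y; rewrite lee_fin mulr_ge0.
pose F (z : Rn * Rn) := (f (z.2 : V) * g (2 *: (z.1 : V) - z.2))%:E.
have mF : measurable_fun setT F.
  apply/measurable_EFinP; apply: measurable_funM.
    by apply: (measurable_borel bf); exact: row_measurable_snd.
  apply: (measurable_borel bg); apply: row_measurableB; last exact: row_measurable_snd.
  by apply: row_measurableZ; exact: row_measurable_fst.
rewrite (fubini_tonelli F)//; last by move=> z; rewrite lee_fin mulr_ge0.
have mg : measurable_fun setT (fun y : Rn => (g (y : V))%:E).
  by apply/measurable_EFinP; exact: measurable_borel_id.
transitivity (\int[leb]_y ((f (y : V))%:E * ((2 ^- n)%:E * \int[leb]_y (g (y : V))%:E))).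
  apply: eq_integral => y _; rewrite /F/=.
  have h2 : (2 != 0 :> R)%R by rewrite pnatr_eq0.
  have := ge0_integral_affine_Rn (- (y : V))%R h2 mg.
  rewrite gtr0_norm; last exact: ltr0n.
  move=> <-; last by move=> w; rewrite lee_fin.
  rewrite -ge0_integralZl.
  - by apply: eq_integral => w _; rewrite EFinM.
  - exact: measurableT.
  - apply/measurable_EFinP; apply: (measurable_borel bg); apply: row_measurableD.
      by apply: row_measurableZ; exact: row_measurable_id.
    exact: row_measurable_cst.
  - by move=> w _; rewrite lee_fin.
  - by rewrite lee_fin.
rewrite ge0_integralZr; first by rewrite muleCA.
- exact: measurableT.
- by apply/measurable_EFinP; exact: measurable_borel_id.
- by move=> y _; rewrite lee_fin.
- apply: mule_ge0; first by rewrite lee_fin invr_ge0 exprn_ge0.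
  by apply: integral_ge0 => y _; rewrite lee_fin.
Qed.

(** * Truncations to cubes *)

Definition cross_cube (s : R) (f g : V -> R) (x : V) : \bar R :=
  \int[leb]_y (f (x + y)%R * g (x - y)%R * \1_(cube s) (y : Rn))%:E.

Lemma row_norm_le (x : V) s : (0 <= s)%R ->
  (`|x| <= s)%R <-> (forall i, `|x 0%R i| <= s)%R.
Proof.
move=> s0; rewrite (_ : `|x|%R = mx_norm x)// mx_normrE; split => [|h].
  by move=> /bigmax_leP[_ h] i; exact: (h (0%R, i)).
by apply/bigmax_leP; split => // -[i j] _ /=; rewrite ord1; exact: h.
Qed.

Lemma row_norm_lt (x : V) s : (0 < s)%R -> (`|x| < s)%R <-> cube s x.
Proof.
move=> s0; rewrite (_ : `|x|%R = mx_norm x)// mx_normrE; split => [|h].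
  by move=> /bigmax_ltP[_ h] i; exact: (h (0%R, i)).
by apply/bigmax_ltP; split => // -[i j] _ /=; rewrite ord1; exact: h.
Qed.

Lemma borel_norm : borel (fun x : V => `|x|%R).
Proof.
apply: (measurability _ (RGenOInfty.measurableE R)) => // _ [_ [x ->] <-].
rewrite setTI; have [x0|x0] := ltP x 0%R.
  rewrite (_ : _ @^-1` _ = setT)//; apply/seteqP; split => // t _ /=.
  by rewrite in_itv/= andbT (lt_le_trans x0).
rewrite (_ : _ @^-1` _ = ~` \bigcap_(i in [set: 'I_n]) [set t | (`|tnth t i| <= x)%R]).
  apply: measurableC; apply: fin_bigcap_measurable => // i _.
  have mni := measurableT_comp (@normr_measurable R setT) (@measurable_tnth _ (measurableTypeR R) n i).
  have := mni measurableT `]-oo, x]%classic (measurable_itv _).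
  by rewrite setTI; congr measurable; apply/seteqP; split => t /=; rewrite in_itv.
apply/seteqP; split => t /=; rewrite in_itv/= andbT.
  move=> xt h; move: xt; rewrite ltNge => /negP; apply; apply/row_norm_le => // i.
  by rewrite mxE; exact: h.
move=> h; rewrite ltNge; apply/negP => /row_norm_le h'; apply: h => i _ /=.
by have := h' x0 i; rewrite mxE.
Qed.

Lemma borel_indic_cube s : borel (\1_(cube s) : V -> R).
Proof.
pose B : set (n.-tuple (measurableTypeR R)) := [set t | forall i, (`|tnth t i| < s)%R].
have mB : measurable B.
  rewrite (_ : B = \bigcap_(i in [set: 'I_n]) [set t | (`|tnth t i| < s)%R]).
    apply: fin_bigcap_measurable => // i _.
    by apply: measurable_norm_lt; exact: measurable_tnth.
  by apply/seteqP; split => x h i; [move=> _|]; exact: h.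
have h : measurable_fun setT (\1_B : n.-tuple (measurableTypeR R) -> R).
  exact: measurable_indic.
move: h; apply: eq_measurable_fun => t _; rewrite !indicE; congr (_ %:R); congr (nat_of_bool _).
by apply/idP/idP; rewrite !inE => h i; have := h i; rewrite mxE.
Qed.

Lemma indic_ge0 (X : Type) (A : set X) x : (0 <= \1_A x :> R)%R.
Proof. by rewrite indicE. Qed.

Lemma cross_cube_ge0 s f g x : (forall x, 0 <= f x)%R -> (forall x, 0 <= g x)%R ->
  0 <= cross_cube s f g x.
Proof.
by move=> f0 g0; apply: integral_ge0 => y _; rewrite lee_fin !mulr_ge0.
Qed.

Lemma measurable_cross_cube d (X : measurableType d) (h : X -> V) s f g :
  row_measurable h -> borel f -> borel g ->
  (forall x, 0 <= f x)%R -> (forall x, 0 <= g x)%R ->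
  measurable_fun setT (fun x => cross_cube s f g (h x)).
Proof.
move=> mh bf bg f0 g0.
pose F (z : X * Rn) :=
  (f (h z.1 + (z.2 : V)) * g (h z.1 - z.2) * \1_(cube s) (z.2 : Rn))%:E.
apply: (measurable_fun_fubini_tonelli_F F) => [|z]; last first.
  by rewrite lee_fin !mulr_ge0.
have mh1 : row_measurable (fun z : X * Rn => h z.1).
  by apply: (row_measurable_comp mh); exact: measurable_fst.
apply/measurable_EFinP; apply: measurable_funM; first apply: measurable_funM.
- by apply: (measurable_borel bf); apply: row_measurableD => //; exact: row_measurable_snd.
- by apply: (measurable_borel bg); apply: row_measurableB => //; exact: row_measurable_snd.
- by apply: (measurable_borel (borel_indic_cube s)); exact: row_measurable_snd.
Qed.

Lemma integral_indic_cube s : (0 <= s)%R ->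
  \int[leb]_y (\1_(cube s) (y : Rn))%:E = ((2 * s) ^+ n)%:E.
Proof.
move=> s0; rewrite integral_indic; last exact: measurable_cube.
  by rewrite setIT; exact: leb_cube.
exact: measurableT.
Qed.

Lemma integral_cube_avg (F : Rn * Rn -> \bar R) M s : (0 <= s)%R ->
  measurable_fun setT F -> (forall z, 0 <= F z) ->
  (forall y, \int[leb]_x F (x, y) = M) ->
  \int[leb]_x \int[leb]_y (F (x, y) * (\1_(cube s) (y : Rn))%:E) =
  ((2 * s) ^+ n)%:E * M.
Proof.
move=> s0 mF F0 FM.
have M0 : 0 <= M by rewrite -(FM 0%R); exact: integral_ge0.
pose G (z : Rn * Rn) := F z * (\1_(cube s) (z.2 : Rn))%:E.
have m1 : measurable_fun [set: Rn] (fun y : Rn => (\1_(cube s) y)%:E : \bar R).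
  by apply/measurable_EFinP; exact: (measurable_borel_id (borel_indic_cube s)).
have mG : measurable_fun setT G.
  apply: emeasurable_funM => //.
  by apply: (measurableT_comp m1); exact: measurable_snd.
rewrite (fubini_tonelli G)//; last by move=> z; rewrite mule_ge0// lee_fin indic_ge0.
transitivity (\int[leb]_y (M * (\1_(cube s) (y : Rn))%:E)).
  apply: eq_integral => y _; rewrite /G/=.
  rewrite ge0_integralZr; first by rewrite FM.
  - exact: measurableT.
  - by apply: (measurableT_comp mF); exact: pair2_measurable.
  - by move=> x _; exact: F0.
  - by rewrite lee_fin indic_ge0.
rewrite ge0_integralZl//; first by rewrite integral_indic_cube// muleC.
Qed.

Lemma integral_cube_avg_shift (F : V -> \bar R) s : (0 <= s)%R ->
  measurable_fun [set: Rn] (F : Rn -> \bar R) ->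
  measurable_fun setT (fun z : Rn * Rn => F ((z.1 : V) + z.2)%R) ->
  (forall x, 0 <= F x) ->
  \int[leb]_x \int[leb]_w (F ((x : V) + w)%R * (\1_(cube s) (w : Rn))%:E) =
  ((2 * s) ^+ n)%:E * \int[leb]_x F x.
Proof.
move=> s0 mF mF2 F0.
apply: (integral_cube_avg (F := fun z => F ((z.1 : V) + z.2)%R)).
- exact: s0.
- exact: mF2.
- by move=> z; exact: F0.
- move=> w; rewrite -(ge0_integral_shift (w : V) mF F0).
  by apply: eq_integral => x _; rewrite addrC.
Qed.

(** Young's inequality for sqrt A = sqrt (A / t) sqrt t. Integrated over a set and
    optimised in t, it gives the Cauchy-Schwarz inequality against 1. *)
Lemma sqrte_le (A : \bar R) t : 0 <= A -> (0 < t)%R ->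
  A `^ (2^-1) <= (t^-1)%:E * A + t%:E.
Proof.
move=> + t0; case: A => [a| |]//= a0; last first.
  by rewrite gt0_muley ?lte_fin ?invr_gt0// addye ?leey.
rewrite powR12_sqrt// -EFinM -EFinD lee_fin.
have [h|h] := leP (Num.sqrt a) t.
  by rewrite ler_wpDl// mulr_ge0// invr_ge0 ltW.
rewrite ler_wpDr// ?(ltW t0)// ler_pdivlMl//.
rewrite -{2}(sqr_sqrtr a0) expr2 ler_wpM2r ?sqrtr_ge0 ?ltW//.
Qed.

End integrals.

(** * The square root of a truncated product *)

Section sqrt.
Context (R : realType) (n : nat).
Local Notation V := 'rV[R]_n.
Local Notation Rn := (Rn R n).
Local Notation leb := (@leb R n).
Local Open Scope ereal_scope.

(** The gain [sg] = s^(n/2) is what makes small cubes summable. Let A be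
    [cross_cube s f g] and Gf, Gg the integrals of f, g over the cube of half-side
    2 s at x. Changing variables, the integral of A over the cube of half-side s
    at x is at most Gf Gg, so by Cauchy-Schwarz that of sqrt A is at most a
    multiple of s^(n/2) sqrt (Gf Gg) <= s^(n/2) (Gf + Gg). Integrating in x gives
    (2 s)^n times the integral of sqrt A on the left and (4 s)^n times the
    integrals of f and g on the right. *)
Lemma integral_sqrt_cross_cube (s sg : R) (f g : V -> R) :
  (0 < s)%R -> (0 < sg)%R -> (sg ^+ 2 = s ^+ n)%R ->
  borel f -> borel g -> (forall x, 0 <= f x)%R -> (forall x, 0 <= g x)%R ->
  \int[leb]_x (cross_cube s f g x) `^ (2^-1) <=
  ((1 + 2 ^+ n) * 2 ^+ n * sg)%:E * (\int[leb]_x (f x)%:E + \int[leb]_x (g x)%:E).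
Proof.
move=> s0 sg0 sgE bf bg f0 g0.
have ms h : borel h -> (forall x, 0 <= h x)%R ->
   measurable_fun setT (fun z : Rn * Rn => (h ((z.1 : V) + z.2)%R)%:E).
  move=> bh h0; apply/measurable_EFinP; apply: (measurable_borel bh).
  by apply: row_measurableD; [exact: row_measurable_fst|exact: row_measurable_snd].
have i2 h x : borel h -> measurable_fun setT (fun y : Rn => (h (x + (y : V))%R)%:E).
  move=> bh; apply/measurable_EFinP; apply: (measurable_borel bh).
  by apply: row_measurableD; [exact: row_measurable_cst|exact: row_measurable_id].
pose A := cross_cube s f g.
have A0 x : 0 <= A x by exact: cross_cube_ge0.
have mA2 : measurable_fun setT (fun z : Rn * Rn => A ((z.1 : V) + z.2)%R).
  apply: measurable_cross_cube; [|exact: bf|exact: bg|exact: f0|exact: g0].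
  by apply: row_measurableD; [exact: row_measurable_fst|exact: row_measurable_snd].
have mA1 : measurable_fun setT (fun z : Rn => A (z : V)).
  by apply: measurable_cross_cube; [exact: row_measurable_id|exact: bf|exact: bg|exact: f0|exact: g0].
have s0' : (0 <= s)%R by exact: ltW.
have sqrt0 (a : \bar R) : 0 <= a `^ 2^-1 by exact: poweR_ge0.
have msq : measurable_fun setT (fun a : \bar R => a `^ 2^-1).
  exact: measurable_poweR.
have AE x : A x = cross_cube s f g x by [].
clearbody A.
have avgA : \int[leb]_x \int[leb]_w ((A ((x : V) + w)%R) `^ (2^-1) * (\1_(cube s) (w : Rn))%:E) =
    ((2 * s) ^+ n)%:E * \int[leb]_x (A x) `^ (2^-1).
  apply: (integral_cube_avg_shift (F := fun x => (A x) `^ (2^-1))).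
  - exact: s0'.
  - exact: (measurableT_comp msq mA1).
  - exact: (measurableT_comp msq mA2).
  - by move=> x; exact: sqrt0.
pose G h x := \int[leb]_a ((h (x + (a : V))%R)%:E * (\1_(cube (2 * s)) (a : Rn))%:E).
have avgG h : borel h -> (forall x, 0 <= h x)%R ->
    \int[leb]_x G h x = ((2 * (2 * s)) ^+ n)%:E * \int[leb]_x (h x)%:E.
  move=> bh h0.
  apply: (integral_cube_avg_shift (F := fun x => (h x)%:E)).
  - by apply: mulr_ge0 => //; exact: ler0n.
  - by apply/measurable_EFinP; exact: measurable_borel_id.
  - exact: ms.
  - by move=> x; rewrite lee_fin.
have mG h : borel h -> (forall x, 0 <= h x)%R -> measurable_fun [set: Rn] (G h : Rn -> \bar R).
  move=> bh h0.
  have m1 : measurable_fun setT (fun z : Rn * Rn => (\1_(cube (2 * s)) (z.2 : Rn))%:E : \bar R).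
    apply/measurable_EFinP; apply: (measurable_borel (borel_indic_cube _)).
    exact: row_measurable_snd.
  apply: (measurable_fun_fubini_tonelli_F (fun z : Rn * Rn =>
    (h ((z.1 : V) + z.2)%R)%:E * (\1_(cube (2 * s)) (z.2 : Rn))%:E)).
    by apply: emeasurable_funM; [exact: ms|exact: m1].
  by move=> z; apply: mule_ge0; rewrite lee_fin ?indic_ge0.
have G0 h x : (forall x, 0 <= h x)%R -> 0 <= G h x.
  by move=> h0; apply: integral_ge0 => y _; rewrite mule_ge0// lee_fin.
have crossG x : \int[leb]_w (A (x + (w : V))%R * (\1_(cube s) (w : Rn))%:E) <= G f x * G g x.
  pose phi (h : V -> R) (a : V) : R := (h (x + a) * \1_(cube (2 * s)) (a : Rn))%R.
  have bphi h : borel h -> borel (phi h).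
    move=> bh; rewrite /borel /phi; apply: measurable_funM; last exact: borel_indic_cube.
    apply: (measurable_borel bh) => i.
    have : measurable_fun setT (fun t : n.-tuple (measurableTypeR R) => x 0%R i + tnth t i : R)%R.
      by apply: measurable_funD; [exact: measurable_cst|exact: measurable_tnth].
    by apply: eq_measurable_fun => t _; rewrite !mxE.
  have phi0 h : (forall x, 0 <= h x)%R -> forall a, (0 <= phi h a)%R.
    by move=> h0 a; apply: mulr_ge0; [exact: h0|exact: indic_ge0].
  have Gphi h : G h x = \int[leb]_a (phi h (a : V))%:E.
    by apply: eq_integral => a _; rewrite /phi EFinM.
  have mphi : measurable_fun setT (fun z : Rn * Rn =>
      (phi f ((z.1 : V) + z.2) * phi g ((z.1 : V) - z.2))%:E).
    apply/measurable_EFinP; apply: measurable_funM.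
      apply: (measurable_borel (bphi _ bf)).
      by apply: row_measurableD; [exact: row_measurable_fst|exact: row_measurable_snd].
    apply: (measurable_borel (bphi _ bg)).
    by apply: row_measurableB; [exact: row_measurable_fst|exact: row_measurable_snd].
  have phi20 (w y : V) : 0 <= (phi f (w + y) * phi g (w - y))%:E.
    by rewrite lee_fin; apply: mulr_ge0; exact: phi0.
  apply: (@le_trans _ _ (\int[leb]_w \int[leb]_y (phi f ((w : V) + y) * phi g ((w : V) - y))%:E)); last first.
    rewrite (integral_cross (bphi _ bf) (bphi _ bg) (phi0 _ f0) (phi0 _ g0)) -!Gphi.
    rewrite -[leRHS]mul1e; apply: lee_wpmul2r; first by apply: mule_ge0; exact: G0.
    by rewrite lee_fin invf_le1 ?exprn_ege1 ?exprn_gt0 ?ler1n.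
  apply: le_integralT => w.
    by apply: mule_ge0; [exact: A0|rewrite lee_fin indic_ge0].
  rewrite AE indicE; case: (boolP (_ \in _)) => [|_]; last first.
    by rewrite mule0; apply: integral_ge0 => y _; exact: phi20.
  rewrite inE mule1 => wc; apply: le_integralT => y.
    by rewrite lee_fin; apply: mulr_ge0; [apply: mulr_ge0|exact: indic_ge0].
  rewrite lee_fin [in leLHS]indicE.
  case: (boolP (_ \in _)) => [|_]; last first.
    by rewrite mulr0; apply: mulr_ge0; exact: phi0.
  rewrite inE mulr1 => yc; rewrite /phi.
  have i1 : \1_(cube (2 * s)) ((w : V) + y : Rn)%R = 1%R :> R.
    rewrite indicE mem_set// => i; rewrite mxE.
    by rewrite (le_lt_trans (ler_normD _ _))// mulr_natl mulr2n ltrD.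
  have i2' : \1_(cube (2 * s)) ((w : V) - y : Rn)%R = 1%R :> R.
    rewrite indicE mem_set// => i; rewrite !mxE.
    by rewrite (le_lt_trans (ler_normB _ _))// mulr_natl mulr2n ltrD.
  by rewrite i1 i2' !mulr1 !addrA.
(* Young's inequality with t = (Gf + Gg) / sg; adding e' keeps t positive when
   both integrals vanish *)
have pt x : \int[leb]_w ((A (x + (w : V))%R) `^ (2^-1) * (\1_(cube s) (w : Rn))%:E)
    <= ((1 + 2 ^+ n) * sg)%:E * (G f x + G g x).
  have [Goo|/negP Gfin] := eqVneq (G f x + G g x) +oo.
    by rewrite Goo gt0_muley ?leey// lte_fin; exact: mulr_gt0.
  have Gf0 := G0 f x f0. have Gg0 := G0 g x g0.
  move: (crossG x) Gfin Gf0 Gg0; case: (G f x) => [gf| |]//; case: (G g x) => [gg| |]//.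
  move=> crx _; rewrite !lee_fin => gf0 gg0.
  rewrite -EFinD; apply/lee_addgt0Pr => e e0.
  have K1 : (0 < (1 + 2 ^+ n) * sg)%R.
    exact: mulr_gt0.
  pose e' := (e / ((1 + 2 ^+ n) * sg))%R.
  have e'0 : (0 < e')%R by rewrite divr_gt0.
  pose u := (gf + gg + e')%R.
  have u0 : (0 < u)%R by rewrite ltr_wpDl// addr_ge0.
  pose t := (u / sg)%R.
  have t0 : (0 < t)%R by rewrite divr_gt0.
  have mAx : measurable_fun setT (fun w : Rn => A (x + (w : V))%R).
    exact: (measurableT_comp mA2 (pair1_measurable (x : Rn))).
  have mI : measurable_fun setT (fun w : Rn => (\1_(cube s) w)%:E : \bar R).
    by apply/measurable_EFinP; exact: (measurable_borel_id (borel_indic_cube s)).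
  have I0 (w : Rn) : 0 <= (\1_(cube s) w)%:E :> \bar R by rewrite lee_fin indic_ge0.
  apply: (@le_trans _ _ (\int[leb]_w ((t^-1)%:E * (A (x + (w : V))%R * (\1_(cube s) (w : Rn))%:E)
      + t%:E * (\1_(cube s) (w : Rn))%:E))).
    apply: le_integralT => w.
      by apply: mule_ge0; [exact: sqrt0|exact: I0].
    rewrite muleA -ge0_muleDl; last 2 first.
      by apply: mule_ge0; [rewrite lee_fin invr_ge0 ltW|exact: A0].
      by rewrite lee_fin ltW.
    by apply: lee_wpmul2r; [exact: I0|exact: sqrte_le].
  rewrite ge0_integralD; last first.
  - by apply: emeasurable_funM => //; exact: measurable_cst.
  - by move=> w _; apply: mule_ge0; [rewrite lee_fin ltW|exact: I0].
  - by apply: emeasurable_funM; [exact: measurable_cst|exact: emeasurable_funM].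
  - move=> w _; apply: mule_ge0; first by rewrite lee_fin invr_ge0 ltW.
    by apply: mule_ge0; [exact: A0|exact: I0].
  - exact: measurableT.
  rewrite ge0_integralZl; last first.
  - by rewrite lee_fin invr_ge0 ltW.
  - by move=> w _; apply: mule_ge0; [exact: A0|exact: I0].
  - exact: emeasurable_funM.
  - exact: measurableT.
  rewrite ge0_integralZl; last first.
  - by rewrite lee_fin ltW.
  - by move=> w _; exact: I0.
  - exact: mI.
  - exact: measurableT.
  rewrite (integral_indic_cube _ s0').
  have ti0 : 0 <= (t^-1)%:E by rewrite lee_fin invr_ge0 ltW.
  apply: (@le_trans _ _ ((t^-1)%:E * (gf%:E * gg%:E) + t%:E * ((2 * s) ^+ n)%:E)).
    by apply: leeD2r; exact: lee_wpmul2l.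
  rewrite -!EFinM -!EFinD lee_fin exprMn -sgE /t invf_div.
  have -> : (u / sg * (2 ^+ n * sg ^+ 2) = 2 ^+ n * sg * u)%R.
    by field; rewrite gt_eqF.
  have -> : (sg / u * (gf * gg) = sg * (gf * gg / u))%R by field; rewrite gt_eqF.
  have h1 : (gf * gg / u <= gf + gg)%R.
    rewrite ler_pdivrMr// /u; have := ltW e'0; nra.
  have -> : (e = (1 + 2 ^+ n) * sg * e')%R.
    by rewrite /e'; field; rewrite !gt_eqF// (lt_le_trans ltr01)// lerDl exprn_ge0.
  apply: (@le_trans _ _ (sg * (gf + gg) + 2 ^+ n * sg * u)%R).
    by rewrite lerD2r ler_wpM2l// ltW.
  rewrite /u -subr_ge0.
  have -> : (((1 + 2 ^+ n) * sg * (gf + gg) + (1 + 2 ^+ n) * sg * e' -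
    (sg * (gf + gg) + 2 ^+ n * sg * (gf + gg + e'))) = sg * e')%R by ring.
  by rewrite mulr_ge0// ltW.
have K0 : (0 < (2 * s) ^+ n)%R by rewrite exprn_gt0// mulr_gt0.
have K1 : (0 <= (1 + 2 ^+ n) * sg)%R.
  by rewrite mulr_ge0 ?(ltW sg0)// addr_ge0// exprn_ge0.
suff : ((2 * s) ^+ n)%:E * \int[leb]_x (A x) `^ (2^-1) <=
   ((2 * s) ^+ n)%:E * (((1 + 2 ^+ n) * 2 ^+ n * sg)%:E *
     (\int[leb]_x (f x)%:E + \int[leb]_x (g x)%:E)).
  rewrite lee_pmul2l//; by under eq_integral do rewrite AE.
rewrite -avgA; apply: (@le_trans _ _
    (\int[leb]_x (((1 + 2 ^+ n) * sg)%:E * (G f (x : V) + G g (x : V))))).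
  apply: le_integralT => x; last exact: pt.
  apply: integral_ge0 => w _; apply: mule_ge0; first exact: sqrt0.
  by rewrite lee_fin indic_ge0.
rewrite ge0_integralZl; last first.
- by rewrite lee_fin.
- by move=> x _; apply: adde_ge0; exact: G0.
- by apply: emeasurable_funD; exact: mG.
- exact: measurableT.
rewrite ge0_integralD; last first.
- exact: mG.
- by move=> x _; exact: G0.
- exact: mG.
- by move=> x _; exact: G0.
- exact: measurableT.
rewrite !avgG// -ge0_muleDr; last 2 first.
  by apply: integral_ge0 => x _; rewrite lee_fin.
  by apply: integral_ge0 => x _; rewrite lee_fin.
rewrite !muleA -!EFinM [(2 * (2 * s))%R]mulrC exprMn.
by rewrite le_eqVlt; apply/orP; left; apply/eqP; congr (_%:E * _); ring.
Qed.

End sqrt.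

(** * Elementary bounds *)

Section real_bounds.
Context (R : realType).
Implicit Types (a b r q c : R).

Lemma pow2_unbounded r : exists m, r < 2 ^+ m.
Proof.
exists (Num.truncn r).+1; apply: (lt_le_trans (truncnS_gt r)).
by rewrite -natrX ler_nat ltnW// ltn_expl.
Qed.

Lemma pow2_bracketl r : 1 <= r -> exists m, 2 ^+ m <= r < 2 ^+ m.+1.
Proof.
move=> r1; have := ex_minnP (pow2_unbounded r).
case=> -[|m]; first by rewrite expr0 ltNge r1.
move=> rm hm; exists m; rewrite rm andbT leNgt; apply/negP => /hm.
by rewrite ltnn.
Qed.

Lemma pow2_bracketr r : 1 < r -> exists m, 2 ^+ m < r <= 2 ^+ m.+1.
Proof.
move=> r1; have ub : exists m, r <= 2 ^+ m.
  by have [m /ltW] := pow2_unbounded r; exists m.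
have := ex_minnP ub; case=> -[|m]; first by rewrite expr0 leNgt r1.
move=> rm hm; exists m; rewrite rm andbT ltNge; apply/negP => /hm.
by rewrite ltnn.
Qed.

(** Both factors are at most a power of 1 + a + b >= 1. *)
Lemma powR_mul_le_add a b y1 y2 : 0 <= a -> 0 <= b -> 0 <= y1 -> 0 <= y2 ->
  y1 + y2 <= 1 -> a `^ y1 * b `^ y2 <= 1 + a + b.
Proof.
move=> a0 b0 y10 y20 y12.
have M1 : 1 <= 1 + a + b by lra.
have M0 : 0 <= 1 + a + b by lra.
apply: (@le_trans _ _ ((1 + a + b) `^ y1 * (1 + a + b) `^ y2)).
  apply: ler_pM; rewrite ?powR_ge0//; apply: ge0_ler_powR; rewrite ?nnegrE//; lra.
rewrite -powRD; last by rewrite (gt_eqF (lt_le_trans ltr01 M1)) implybT.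
by rewrite -[leRHS]powRr1//; exact: ler_powR.
Qed.

Lemma nneseries_geometric_le c q : 0 <= c -> 0 <= q -> q < 1 ->
  (\sum_(0 <= m <oo) (c * q ^+ m)%:E <= (c / (1 - q))%:E)%E.
Proof.
move=> c0 q0 q1; apply: lime_le.
  by apply: is_cvg_nneseries => m _ _; rewrite lee_fin mulr_ge0// exprn_ge0.
apply: nearW => N; rewrite sumEFin lee_fin -mulr_sumr ler_wpM2l//.
have q10 : 0 < 1 - q by rewrite subr_gt0.
rewrite -[leRHS]mul1r ler_pdivlMr//; elim: N => [|N IH].
  by rewrite big_nil mul0r ler01.
have -> : (\sum_(0 <= i < N.+1) q ^+ i) * (1 - q) = 1 - q ^+ N.+1.
  elim: {IH} N => [|N IH]; first by rewrite big_nat1 expr0 expr1 mul1r.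
  by rewrite big_nat_recr//= mulrDl IH [q ^+ N.+2]exprS; ring.
by rewrite gerBl exprn_ge0.
Qed.

Lemma nneseries_ge_term (u : nat -> \bar R) k : (forall m, 0 <= u m)%E ->
  (u k <= \sum_(0 <= m <oo) u m)%E.
Proof.
move=> u0; apply: (@le_trans _ _ (\sum_(0 <= m < k.+1) u m)%E).
  by rewrite big_nat_recr//= leeDr// sume_ge0.
exact: nneseries_lim_ge.
Qed.

Lemma measurable_nneseries d (X : measurableType d) (u : nat -> X -> \bar R) :
  (forall m, measurable_fun setT (u m)) -> (forall m x, 0 <= u m x)%E ->
  measurable_fun setT (fun x => \sum_(0 <= m <oo) u m x)%E.
Proof.
move=> mu u0.
apply: (emeasurable_fun_cvg (fun N x => \sum_(0 <= m < N) u m x)%E).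
  by move=> N; exact: emeasurable_sum.
by move=> x _; apply: is_cvg_nneseries.
Qed.

Lemma powR_exprn a b m : 0 <= b -> (b `^ a) ^+ m = (b ^+ m) `^ a.
Proof.
move=> b0; rewrite -[LHS]powR_mulrn; last exact: powR_ge0.
by rewrite -powRrM mulrC powRrM powR_mulrn.
Qed.

Lemma gt1_ltr_powR b r c : 1 < b -> r < c -> b `^ r < b `^ c.
Proof.
move=> b1 rc; have b0 : b != 0 by rewrite gt_eqF// (lt_trans ltr01).
by rewrite /powR (negbTE b0) ltr_expR ltr_pM2r// ln_gt0.
Qed.

Section nonnegative_integrals.
Context d (X : measurableType d) (mu : {measure set X -> \bar R}).
Implicit Types F G : X -> R.

Lemma integralZ_EFin k F : 0 <= k -> measurable_fun setT F ->
  (forall x, 0 <= F x) ->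
  (\int[mu]_x (k * F x)%:E = k%:E * \int[mu]_x (F x)%:E)%E.
Proof.
move=> k0 mF F0; under eq_integral do rewrite EFinM.
by rewrite ge0_integralZl_EFin//; [move=> x _; rewrite lee_fin|exact/measurable_EFinP].
Qed.

Lemma integralD_EFin F G : measurable_fun setT F -> measurable_fun setT G ->
  (forall x, 0 <= F x) -> (forall x, 0 <= G x) ->
  (\int[mu]_x (F x + G x)%:E = \int[mu]_x (F x)%:E + \int[mu]_x (G x)%:E)%E.
Proof.
move=> mF mG F0 G0; under eq_integral do rewrite EFinD.
by rewrite ge0_integralD//; [move=> x _; rewrite lee_fin|exact/measurable_EFinP|
  move=> x _; rewrite lee_fin|exact/measurable_EFinP].
Qed.

End nonnegative_integrals.

End real_bounds.

(** * The kernel |y|^(-a) and its dyadic pieces *)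

Section one_scale.
Context (R : realType) (n : nat).
Local Notation V := 'rV[R]_n.
Local Notation Rn := (Rn R n).
Local Notation leb := (@leb R n).
Local Open Scope ereal_scope.

(** The kernel of the Riesz potential of order n - a, for the sup norm. *)
Definition riesz (a : R) (y : V) : R := (`|y| `^ (- a))%R.

Definition cross_op (k f g : V -> R) (x : V) : \bar R :=
  \int[leb]_y (f (x + y)%R * g (x - y)%R * k y)%:E.

Lemma borel_riesz a : borel (riesz a).
Proof. exact: (measurableT_comp (measurable_powR (- a)) (@borel_norm R n)). Qed.

Lemma riesz_ge0 a y : (0 <= riesz a y)%R.
Proof. exact: powR_ge0. Qed.

(** One term of the sum suffices: if 2^-(m+1) <= |y| < 2^-m then
    |y|^(-a) <= 2^a (2^a)^m, and if 2^m <= |y| < 2^(m+1) then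
    |y|^(-a) <= 2^a (2^a)^-(m+1). *)
Lemma riesz_le_cubes (a : R) (y : V) : (0 < a)%R -> (riesz a y)%:E <=
  (2 `^ a)%:E * (\sum_(0 <= m <oo)
    (((2 `^ a) ^+ m * \1_(cube (2 ^- m)) (y : Rn))%:E +
     ((2 `^ a) ^- m * \1_(cube (2 ^+ m)) (y : Rn))%:E)).
Proof.
move=> a0; set rho : R := (2 `^ a)%R.
have rho0 : (0 < rho)%R by exact: powR_gt0.
pose u (m : nat) : \bar R := (rho ^+ m * \1_(cube (2 ^- m)) (y : Rn))%:E +
     (rho ^- m * \1_(cube (2 ^+ m)) (y : Rn))%:E.
rewrite -/u.
have u0 m : 0 <= u m.
  by apply: adde_ge0; rewrite lee_fin mulr_ge0// ?indic_ge0// ?invr_ge0 exprn_ge0// ltW.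
have [y0|y0] := eqVneq y 0%R.
  have -> : riesz a y = 0%R by rewrite /riesz y0 normr0 powR0// oppr_eq0 gt_eqF.
  apply: mule_ge0; first by rewrite lee_fin ltW.
  by apply: nneseries_ge0 => m _ _; exact: u0.
suff [m hm] : exists m, (riesz a y)%:E <= rho%:E * u m.
  apply: (le_trans hm); rewrite lee_pmul2l//; exact: nneseries_ge_term.
have ny0 : (0 < `|y|)%R by rewrite normr_gt0.
have rhoX m : (rho ^+ m = (2 ^+ m) `^ a)%R.
  exact: powR_exprn.
have mono (s t : R) : (0 < s)%R -> (s <= t)%R -> (t `^ (- a) <= s `^ (- a))%R.
  move=> s0 st; rewrite !powRN lef_pV2 ?posrE ?powR_gt0// ?(lt_le_trans s0)//.
  by apply: ge0_ler_powR; rewrite ?nnegrE// ltW// (lt_le_trans s0).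
have [y1|y1] := ltP (`|y|)%R 1%R.
  have [|m /andP[m1 m2]] := @pow2_bracketr R (`|y|^-1)%R; first by rewrite invf_gt1.
  exists m.
  have ycube : \1_(cube (2 ^- m)) (y : Rn) = 1%R :> R.
    rewrite indicE mem_set//; apply/row_norm_lt; first by rewrite invr_gt0 exprn_gt0.
    by rewrite -[ltLHS]invrK ltf_pV2 ?posrE ?invr_gt0// exprn_gt0.
  rewrite /u ycube mulr1 -EFinD -EFinM lee_fin.
  apply: (@le_trans _ _ (rho ^+ m.+1)%R); last first.
    by rewrite exprS ler_wpM2l ?(ltW rho0)// lerDl mulr_ge0// ?indic_ge0// invr_ge0 exprn_ge0// ltW.
  rewrite rhoX -[(2 ^+ m.+1)%R]invrK -powR_inv1 ?invr_ge0 ?exprn_ge0// -powRrM mulN1r.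
  apply: mono; first by rewrite invr_gt0 exprn_gt0.
  by rewrite -[leRHS]invrK lef_pV2 ?posrE ?invr_gt0// exprn_gt0.
have [m /andP[m1 m2]] := pow2_bracketl y1.
exists m.+1.
have ycube : \1_(cube (2 ^+ m.+1)) (y : Rn) = 1%R :> R.
  by rewrite indicE mem_set//; apply/row_norm_lt => //; rewrite exprn_gt0.
rewrite /u ycube mulr1 -EFinD -EFinM lee_fin.
apply: (@le_trans _ _ (rho ^- m)%R); last first.
  have -> : (rho ^- m = rho * rho ^- m.+1)%R.
    by rewrite exprS invfM mulrA mulfV ?mul1r// gt_eqF.
  rewrite mulrDr lerDr.
  apply: mulr_ge0; first exact: ltW.
  by apply: mulr_ge0; [rewrite exprn_ge0// ltW|exact: indic_ge0].
rewrite rhoX -powRN; apply: mono => //; exact: exprn_gt0.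
Qed.

Lemma measurable_cross_arg (f g : V -> R) (x : V) : borel f -> borel g ->
  measurable_fun [set: Rn] (fun y : Rn => f (x + (y : V)) * g (x - (y : V)))%R.
Proof.
move=> bf bg; apply: measurable_funM.
  apply: (measurable_borel bf); apply: row_measurableD; last exact: row_measurable_id.
  exact: row_measurable_cst.
apply: (measurable_borel bg); apply: row_measurableB; last exact: row_measurable_id.
exact: row_measurable_cst.
Qed.

Lemma measurable_cube_indic s :
  measurable_fun [set: Rn] (\1_(cube s) : Rn -> R).
Proof. exact: (measurable_borel_id (borel_indic_cube s)). Qed.

Section cross_cube_bounds.
Variables (f g : V -> R) (bf : borel f) (bg : borel g).
Hypotheses (f0 : forall x, (0 <= f x)%R) (g0 : forall x, (0 <= g x)%R).

Lemma cross_op_riesz_le a x : (0 < a)%R ->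
  cross_op (riesz a) f g x <=
  (2 `^ a)%:E * (\sum_(0 <= m <oo)
    (((2 `^ a) ^+ m)%:E * cross_cube (2 ^- m) f g x +
     ((2 `^ a) ^- m)%:E * cross_cube (2 ^+ m) f g x)).
Proof.
move=> a0; set rho : R := (2 `^ a)%R.
have rho0 : (0 < rho)%R by exact: powR_gt0.
pose t (m : nat) (y : Rn) : \bar R := (f (x + (y : V)) * g (x - (y : V)))%:E *
   ((rho ^+ m * \1_(cube (2 ^- m)) (y : Rn))%:E +
     (rho ^- m * \1_(cube (2 ^+ m)) (y : Rn))%:E).
have fg0 (y : V) : (0 <= f (x + y) * g (x - y))%R by rewrite mulr_ge0.
have i0 m y : 0 <= (rho ^+ m * \1_(cube (2 ^- m)) (y : Rn))%:E :> \bar R.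
  by rewrite lee_fin mulr_ge0 ?indic_ge0// exprn_ge0// ltW.
have i0' m y : 0 <= (rho ^- m * \1_(cube (2 ^+ m)) (y : Rn))%:E :> \bar R.
  by rewrite lee_fin mulr_ge0 ?indic_ge0// invr_ge0 exprn_ge0// ltW.
have t0 m y : 0 <= t m y.
  by apply: mule_ge0; [rewrite lee_fin|apply: adde_ge0].
have mfg := measurable_cross_arg x bf bg.
have mt1 m : measurable_fun setT (fun y : Rn =>
    (rho ^+ m * (f (x + (y : V)) * g (x - (y : V)) * \1_(cube (2 ^- m)) (y : Rn)))%:E).
  apply/measurable_EFinP; apply: measurable_funM; first exact: measurable_cst.
  by apply: measurable_funM; [exact: mfg|exact: measurable_cube_indic].
have mt2 m : measurable_fun setT (fun y : Rn =>
    (rho ^- m * (f (x + (y : V)) * g (x - (y : V)) * \1_(cube (2 ^+ m)) (y : Rn)))%:E).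
  apply/measurable_EFinP; apply: measurable_funM; first exact: measurable_cst.
  by apply: measurable_funM; [exact: mfg|exact: measurable_cube_indic].
have tE m y : t m y =
  (rho ^+ m * (f (x + (y : V)) * g (x - (y : V)) * \1_(cube (2 ^- m)) (y : Rn)))%:E +
  (rho ^- m * (f (x + (y : V)) * g (x - (y : V)) * \1_(cube (2 ^+ m)) (y : Rn)))%:E.
  by rewrite /t -EFinD -EFinM -EFinD; congr EFin; ring.
have mt m : measurable_fun setT (t m).
  by rewrite (funext (tE m)); apply: emeasurable_funD.
apply: (@le_trans _ _ (rho%:E * \int[leb]_y (\sum_(0 <= m <oo) t m y))); last first.
  rewrite lee_pmul2l// integral_nneseries//.
  apply: lee_nneseries => [m _ _|m _]; first by apply: integral_ge0.
  rewrite (funext (tE m)) ge0_integralD; last first.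
  - exact: mt2.
  - by move=> y _; rewrite lee_fin mulr_ge0 ?invr_ge0 ?exprn_ge0 ?(ltW rho0)// mulr_ge0 ?indic_ge0.
  - exact: mt1.
  - by move=> y _; rewrite lee_fin mulr_ge0 ?exprn_ge0 ?(ltW rho0)// mulr_ge0 ?indic_ge0.
  - exact: measurableT.
  rewrite le_eqVlt; apply/orP; left; apply/eqP; congr (_ + _).
    apply: integralZ_EFin.
    - by rewrite exprn_ge0// ltW.
    - by apply: measurable_funM; [exact: mfg|exact: measurable_cube_indic].
    - by move=> y; rewrite mulr_ge0 ?indic_ge0.
  apply: integralZ_EFin.
  - by rewrite invr_ge0 exprn_ge0// ltW.
  - by apply: measurable_funM; [exact: mfg|exact: measurable_cube_indic].
  - by move=> y; rewrite mulr_ge0 ?indic_ge0.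
rewrite -ge0_integralZl; last first.
- by rewrite lee_fin ltW.
- by move=> y _; apply: nneseries_ge0 => m _ _; exact: t0.
- exact: measurable_nneseries.
- exact: measurableT.
apply: le_integralT => y; first by rewrite lee_fin mulr_ge0 ?riesz_ge0.
rewrite EFinM nneseriesZl; last first.
  by move=> m _; apply: adde_ge0; [exact: i0|exact: i0'].
rewrite muleCA; apply: lee_wpmul2l; first by rewrite lee_fin.
exact: riesz_le_cubes.
Qed.

Let one (_ : V) : R := 1%R.

Lemma cross_cube_le_cst s x : (0 <= s)%R -> (forall x, f x <= 1)%R ->
  (forall x, g x <= 1)%R -> cross_cube s f g x <= ((2 * s) ^+ n)%:E.
Proof.
move=> s0 f1 g1; rewrite -(integral_indic_cube _ s0).
apply: le_integralT => y; rewrite lee_fin.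
  by apply: mulr_ge0; [exact: mulr_ge0|exact: indic_ge0].
by rewrite ler_piMl ?indic_ge0// mulr_ile1.
Qed.

Lemma cross_cube_le_prod s x :
  cross_cube s f g x <= \int[leb]_y (f (x + (y : V)) * g (x - (y : V)))%:E.
Proof.
apply: le_integralT => y; rewrite lee_fin.
  by apply: mulr_ge0; [exact: mulr_ge0|exact: indic_ge0].
by rewrite ler_piMr ?mulr_ge0// indicE; case: (_ \in _).
Qed.

Lemma integral_cross_cube_le s :
  \int[leb]_x cross_cube s f g x <=
  \int[leb]_y (f y)%:E * \int[leb]_y (g y)%:E.
Proof.
apply: (@le_trans _ _ (\int[leb]_w \int[leb]_y (f ((w : V) + y) * g ((w : V) - y))%:E)).
  apply: le_integralT => x; first exact: cross_cube_ge0.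
  exact: cross_cube_le_prod.
rewrite (integral_cross bf bg f0 g0) -[leRHS]mul1e; apply: lee_wpmul2r.
  by apply: mule_ge0; apply: integral_ge0 => x _; rewrite lee_fin.
by rewrite lee_fin invf_le1 ?exprn_ege1 ?exprn_gt0 ?ler1n.
Qed.

Lemma cross_cubel_le s x : cross_cube s one g x <= \int[leb]_y (g y)%:E.
Proof.
have mg : measurable_fun [set: Rn] (fun y : Rn => (g (y : V))%:E).
  by apply/measurable_EFinP; exact: measurable_borel_id.
rewrite -(ge0_integral_reflect x mg); last by move=> y; rewrite lee_fin.
apply: le_integralT => y; rewrite lee_fin mul1r.
  by apply: mulr_ge0; [exact: g0|exact: indic_ge0].
by rewrite ler_piMr// indicE; case: (_ \in _).
Qed.

Lemma cross_cuber_le s x : cross_cube s f one x <= \int[leb]_y (f y)%:E.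
Proof.
have mf : measurable_fun [set: Rn] (fun y : Rn => (f (y : V))%:E).
  by apply/measurable_EFinP; exact: measurable_borel_id.
rewrite -(ge0_integral_shift x mf); last by move=> y; rewrite lee_fin.
apply: le_integralT => y; rewrite lee_fin mulr1.
  by apply: mulr_ge0; [exact: f0|exact: indic_ge0].
by rewrite ler_piMr// indicE; case: (_ \in _).
Qed.

Lemma integral_cross_cubel s : (0 <= s)%R ->
  \int[leb]_x cross_cube s one g x = ((2 * s) ^+ n)%:E * \int[leb]_y (g y)%:E.
Proof.
move=> s0.
have mg : measurable_fun [set: Rn] (fun y : Rn => (g (y : V))%:E).
  by apply/measurable_EFinP; exact: measurable_borel_id.
rewrite -(integral_cube_avg (F := fun z : Rn * Rn => (g ((z.1 : V) - z.2))%:E) s0).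
- apply: eq_integral => x _; apply: eq_integral => y _.
  by rewrite -EFinM mul1r.
- apply/measurable_EFinP; apply: (measurable_borel bg).
  by apply: row_measurableB; [exact: row_measurable_fst|exact: row_measurable_snd].
- by move=> z; rewrite lee_fin.
- move=> y; rewrite -(ge0_integral_shift (- (y : V))%R mg); last by move=> z; rewrite lee_fin.
  by apply: eq_integral => x _; rewrite addrC.
Qed.

Lemma integral_cross_cuber s : (0 <= s)%R ->
  \int[leb]_x cross_cube s f one x = ((2 * s) ^+ n)%:E * \int[leb]_y (f y)%:E.
Proof.
move=> s0.
have mf : measurable_fun [set: Rn] (fun y : Rn => (f (y : V))%:E).
  by apply/measurable_EFinP; exact: measurable_borel_id.
rewrite -(integral_cube_avg (F := fun z : Rn * Rn => (f ((z.1 : V) + z.2))%:E) s0).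
- apply: eq_integral => x _; apply: eq_integral => y _.
  by rewrite -EFinM mulr1.
- apply/measurable_EFinP; apply: (measurable_borel bf).
  by apply: row_measurableD; [exact: row_measurable_fst|exact: row_measurable_snd].
- by move=> z; rewrite lee_fin.
- move=> y; rewrite -(ge0_integral_shift (y : V) mf); last by move=> z; rewrite lee_fin.
  by apply: eq_integral => x _; rewrite addrC.
Qed.

(** The estimate of the bounded parts over large cubes. From
    (sg H1)^y1 (sg H2)^y2 <= 1 + sg H1 + sg H2 the integrand is at most
    sg^(-y1-y2) times 1 + sg H1 (x + y) + sg H2 (x - y). Over the cube, 1 contributes
    2^n sg, and H1 and H2 have integral at most 1. *)
Lemma cross_cube_powR_le (H1 H2 : V -> R) (y1 y2 s sg : R) x :
  borel H1 -> borel H2 ->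
  (forall x, 0 <= H1 x)%R -> (forall x, 0 <= H2 x)%R ->
  \int[leb]_y (H1 y)%:E <= 1 -> \int[leb]_y (H2 y)%:E <= 1 ->
  (0 <= y1)%R -> (0 <= y2)%R -> (y1 + y2 <= 1)%R -> (0 < s)%R -> sg = (s ^+ n)%R ->
  (forall x, f x <= H1 x `^ y1)%R -> (forall x, g x <= H2 x `^ y2)%R ->
  cross_cube s f g x <= ((2 ^+ n + 2) * sg `^ (1 - (y1 + y2)))%:E.
Proof.
move=> bH1 bH2 H10 H20 iH1 iH2 y10 y20 y12 s0 sgE fH gH.
have sg0 : (0 < sg)%R by rewrite sgE exprn_gt0.
pose c := (sg `^ (- (y1 + y2)))%R.
have c0 : (0 <= c)%R by exact: powR_ge0.
have mH1 : measurable_fun [set: Rn] (fun y : Rn => (H1 (y : V))%:E).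
  by apply/measurable_EFinP; exact: measurable_borel_id.
have mH2 : measurable_fun [set: Rn] (fun y : Rn => (H2 (y : V))%:E).
  by apply/measurable_EFinP; exact: measurable_borel_id.
have mH1x : measurable_fun [set: Rn] (fun y : Rn => (H1 (x + (y : V)))%:E).
  apply/measurable_EFinP; apply: (measurable_borel bH1).
  by apply: row_measurableD; [exact: row_measurable_cst|exact: row_measurable_id].
have mH2x : measurable_fun [set: Rn] (fun y : Rn => (H2 (x - (y : V)))%:E).
  apply/measurable_EFinP; apply: (measurable_borel bH2).
  by apply: row_measurableB; [exact: row_measurable_cst|exact: row_measurable_id].
have mI := measurable_cube_indic s.
apply: (@le_trans _ _ (\int[leb]_y (c * (\1_(cube s) (y : Rn) +
    sg * (H1 (x + (y : V)) + H2 (x - (y : V)))))%:E)).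
  apply: le_integralT => y.
    by rewrite lee_fin; apply: mulr_ge0; [exact: mulr_ge0|exact: indic_ge0].
  rewrite lee_fin.
  have [I0 I1] : (0 <= \1_(cube s) (y : Rn) :> R)%R /\ (\1_(cube s) (y : Rn) <= 1 :> R)%R.
    by rewrite indicE; case: (_ \in _).
  have h : (f (x + y) * g (x - y) <= c * (1 + sg * H1 (x + y) + sg * H2 (x - y)))%R.
    apply: (@le_trans _ _ (H1 (x + y) `^ y1 * H2 (x - y) `^ y2)%R).
      by apply: ler_pM.
    have -> : (H1 (x + y) `^ y1 * H2 (x - y) `^ y2 =
       c * ((sg * H1 (x + y)) `^ y1 * (sg * H2 (x - y)) `^ y2))%R.
      rewrite !powRM ?(ltW sg0)//; rewrite [RHS](_ : _ =
        (c * (sg `^ y1 * sg `^ y2)) * (H1 (x + y) `^ y1 * H2 (x - y) `^ y2))%R; last by ring.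
      rewrite -powRD; last by rewrite (gt_eqF sg0) implybT.
      by rewrite /c powRN mulVf ?mul1r// gt_eqF// powR_gt0.
    rewrite ler_wpM2l//; apply: powR_mul_le_add => //; rewrite mulr_ge0// ltW//.
  apply: (@le_trans _ _ (c * (1 + sg * H1 (x + y) + sg * H2 (x - y)) * \1_(cube s) (y : Rn))%R).
    exact: ler_wpM2r.
  rewrite -mulrA ler_wpM2l//.
  have h1 : (0 <= sg * H1 (x + y))%R by rewrite mulr_ge0// ltW.
  have h2 : (0 <= sg * H2 (x - y))%R by rewrite mulr_ge0// ltW.
  by rewrite mulrDr !mulrDl mul1r -addrA lerD2l lerD// ler_piMr.
have mH : measurable_fun [set: Rn]
    (fun y : Rn => H1 (x + (y : V)) + H2 (x - (y : V)))%R.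
  by apply: measurable_funD; exact/measurable_EFinP.
have msgH : measurable_fun [set: Rn]
    (fun y : Rn => sg * (H1 (x + (y : V)) + H2 (x - (y : V))))%R.
  by apply: measurable_funM; [exact: measurable_cst|exact: mH].
have sgH0 (y : Rn) : (0 <= sg * (H1 (x + (y : V)) + H2 (x - (y : V))))%R.
  by apply: mulr_ge0; [exact: ltW|exact: addr_ge0].
rewrite integralZ_EFin; last first.
- by move=> y; apply: addr_ge0; [exact: indic_ge0|exact: sgH0].
- by apply: measurable_funD; [exact: mI|exact: msgH].
- exact: c0.
rewrite integralD_EFin; last first.
- exact: sgH0.
- by move=> y; exact: indic_ge0.
- exact: msgH.
- exact: mI.
rewrite integralZ_EFin; last first.
- by move=> y; exact: addr_ge0.
- exact: mH.
- exact: ltW.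
rewrite integralD_EFin; last first.
- by move=> y; exact: H20.
- by move=> y; exact: H10.
- exact/measurable_EFinP.
- exact/measurable_EFinP.
rewrite (ge0_integral_shift x mH1); last by move=> y; rewrite lee_fin.
rewrite (ge0_integral_reflect x mH2); last by move=> y; rewrite lee_fin.
rewrite (integral_indic_cube _ (ltW s0)) exprMn -sgE.
apply: (@le_trans _ _ (c%:E * ((2 ^+ n * sg)%:E + sg%:E * (1 + 1)))).
  apply: lee_wpmul2l; first by rewrite lee_fin.
  by apply: leeD2l; apply: lee_wpmul2l; [rewrite lee_fin ltW|exact: leeD].
rewrite (_ : c%:E * _ = (c * (2 ^+ n * sg + sg * (1 + 1)))%:E)//.
rewrite lee_fin le_eqVlt; apply/orP; left; apply/eqP.
rewrite powRD; last by rewrite (gt_eqF sg0) implybT.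
rewrite powRr1 ?ltW// -/c; ring.
Qed.

End cross_cube_bounds.

(** * Small and large values *)

Definition low (x : R) (h : R) : R := if (h <= 1)%R then (h `^ x)%R else 0%R.
Definition high (x : R) (h : R) : R := if (h <= 1)%R then 0%R else (h `^ x)%R.

Lemma low_high x h : (h `^ x = low x h + high x h)%R.
Proof. by rewrite /low/high; case: ifP; rewrite ?addr0 ?add0r. Qed.

Lemma low_ge0 x h : (0 <= low x h)%R.
Proof. by rewrite /low; case: ifP => // _; exact: powR_ge0. Qed.

Lemma high_ge0 x h : (0 <= high x h)%R.
Proof. by rewrite /high; case: ifP => // _; exact: powR_ge0. Qed.

Lemma low_le_powR x y h : (0 <= h)%R -> (0 < y)%R -> (y <= x)%R -> (low x h <= h `^ y)%R.
Proof.
move=> h0 y0 yx; rewrite /low; case: ifP => h1; last exact: powR_ge0.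
have [->|hn0] := eqVneq h 0%R; first by rewrite !powR0 ?gt_eqF// (lt_le_trans y0).
by apply: ger_powR => //; rewrite lt_neqAle eq_sym hn0 h0.
Qed.

Lemma low_le1 x h : (0 <= h)%R -> (0 <= x)%R -> (low x h <= 1)%R.
Proof.
move=> h0 x0; rewrite /low; case: ifP => h1; last exact: ler01.
apply: (@le_trans _ _ (1 `^ x)%R); last by rewrite powR1.
by apply: ge0_ler_powR; rewrite ?nnegrE.
Qed.

Lemma high_le x h : (x <= 1)%R -> (0 <= h)%R -> (high x h <= h)%R.
Proof.
move=> x1' h0; rewrite /high; case: ifPn => //; rewrite -ltNge => h1.
by rewrite -[leRHS]powRr1//; apply: ler_powR => //; exact: ltW.
Qed.

Lemma measurable_low x : measurable_fun setT (low x).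
Proof.
apply: measurable_fun_ifT.
- by apply: measurable_fun_ler; [exact: measurable_id|exact: measurable_cst].
- exact: measurable_powR.
- exact: measurable_cst.
Qed.

Lemma measurable_high x : measurable_fun setT (high x).
Proof.
apply: measurable_fun_ifT.
- by apply: measurable_fun_ler; [exact: measurable_id|exact: measurable_cst].
- exact: measurable_cst.
- exact: measurable_powR.
Qed.

Lemma low_high_mul_le (u1 v1 u2 v2 : R) : (0 <= u1 <= 1)%R -> (0 <= u2 <= 1)%R ->
  (0 <= v1)%R -> (0 <= v2)%R ->
  ((u1 + v1) * (u2 + v2) <= u1 * u2 + (v1 * 1 + 1 * v2) + v1 * v2)%R.
Proof. nra. Qed.

(** As u1, u2 <= 1, the mixed products u1 v2 and v1 u2 are at most v2 and v1. *)
Lemma cross_cube_split (u1 v1 u2 v2 : V -> R) s x :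
  borel u1 -> borel v1 -> borel u2 -> borel v2 ->
  (forall x, 0 <= u1 x <= 1)%R -> (forall x, 0 <= u2 x <= 1)%R ->
  (forall x, 0 <= v1 x)%R -> (forall x, 0 <= v2 x)%R ->
  cross_cube s (fun y => u1 y + v1 y)%R (fun y => u2 y + v2 y)%R x <=
  cross_cube s u1 u2 x +
  (cross_cube s v1 (cst 1%R) x + cross_cube s (cst 1%R) v2 x) +
  cross_cube s v1 v2 x.
Proof.
move=> bu1 bv1 bu2 bv2 u10 u20 v10 v20.
have b1 : borel (cst 1%R : V -> R) by exact: measurable_cst.
have m (f g : V -> R) : borel f -> borel g -> measurable_fun [set: Rn]
    (fun y : Rn => f (x + (y : V)) * g (x - (y : V)) * \1_(cube s) (y : Rn))%R.
  move=> bf bg; apply: measurable_funM; first exact: measurable_cross_arg.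
  exact: measurable_cube_indic.
have p0 (f g : V -> R) (y : Rn) : (forall x, 0 <= f x)%R -> (forall x, 0 <= g x)%R ->
    (0 <= f (x + (y : V)) * g (x - (y : V)) * \1_(cube s) (y : Rn))%R.
  by move=> f0 g0; apply: mulr_ge0; [exact: mulr_ge0|exact: indic_ge0].
have u1p y : (0 <= u1 y)%R by case/andP: (u10 y).
have u2p y : (0 <= u2 y)%R by case/andP: (u20 y).
have one0 (y : V) : (0 <= cst (1 : R) y)%R by exact: ler01.
rewrite /cross_cube -integralD_EFin; last first.
- by move=> y; exact: p0.
- by move=> y; exact: p0.
- exact: m.
- exact: m.
rewrite -integralD_EFin; last first.
- by move=> y; apply: addr_ge0; exact: p0.
- by move=> y; exact: p0.
- by apply: measurable_funD; exact: m.
- exact: m.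
rewrite -integralD_EFin; last first.
- by move=> y; exact: p0.
- by move=> y; apply: addr_ge0; [|apply: addr_ge0]; exact: p0.
- exact: m.
- by apply: measurable_funD; [|apply: measurable_funD]; exact: m.
apply: le_integralT => y; rewrite lee_fin.
  by apply: mulr_ge0; [apply: mulr_ge0; exact: addr_ge0|exact: indic_ge0].
rewrite -!mulrDl ler_wpM2r ?indic_ge0//.
exact: low_high_mul_le.
Qed.

Lemma measurable_cross_op (k f g : V -> R) : borel k -> borel f -> borel g ->
  (forall x, 0 <= k x)%R -> (forall x, 0 <= f x)%R -> (forall x, 0 <= g x)%R ->
  measurable_fun [set: Rn] (cross_op k f g : Rn -> \bar R).
Proof.
move=> bk bf bg k0 f0 g0.
apply: (measurable_fun_fubini_tonelli_F (fun z : Rn * Rn =>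
  (f ((z.1 : V) + z.2) * g ((z.1 : V) - z.2) * k (z.2 : V))%:E)); last first.
  by move=> z; rewrite lee_fin; apply: mulr_ge0 => //; exact: mulr_ge0.
apply/measurable_EFinP; apply: measurable_funM; first apply: measurable_funM.
- apply: (measurable_borel bf).
  by apply: row_measurableD; [exact: row_measurable_fst|exact: row_measurable_snd].
- apply: (measurable_borel bg).
  by apply: row_measurableB; [exact: row_measurable_fst|exact: row_measurable_snd].
- by apply: (measurable_borel bk); exact: row_measurable_snd.
Qed.

Lemma poweR12_ge (a : \bar R) : 0 <= a -> a `^ 2^-1 <= 1 -> a <= a `^ 2^-1.
Proof.
case: a => [a| |]//= a0; last by rewrite invr_eq0 pnatr_eq0.
rewrite powR12_sqrt// !lee_fin => a1.
by rewrite -{1}(sqr_sqrtr a0) expr2 ler_piMr// sqrtr_ge0.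
Qed.

(** Once the sum of the square roots is at most 1, every term is at most 1 and so
    at most its square root. *)
Lemma nneseries_poweR12_ge (d : nat -> \bar R) : (forall m, 0 <= d m) ->
  \sum_(0 <= m <oo) (d m) `^ 2^-1 <= 1 ->
  \sum_(0 <= m <oo) d m <= \sum_(0 <= m <oo) (d m) `^ 2^-1.
Proof.
move=> d0 d1; apply: lee_nneseries => // m _; apply: poweR12_ge => //.
apply: le_trans d1; apply: (nneseries_ge_term (u := fun m => d m `^ 2^-1)) => k.
exact: poweR_ge0.
Qed.

End one_scale.

(** * The level set estimate at unit scale *)

Section level_set_unit_scale.
Context (R : realType) (n : nat).
Local Notation V := 'rV[R]_n.
Local Notation Rn := (Rn R n).
Local Notation leb := (@leb R n).
Local Open Scope ereal_scope.
Variables (al x1 x2 : R).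
Hypotheses (n0 : (0 < n)%N) (al0 : (0 < al)%R) (aln : (al < n%:R)%R).
Hypotheses (x10 : (0 < x1)%R) (x11 : (x1 < 1)%R) (x20 : (0 < x2)%R) (x21 : (x2 < 1)%R).
Hypothesis (alx : (al / n%:R < x1 + x2)%R).

Let a : R := (n%:R - al)%R.
Let rho : R := (2 `^ a)%R.
Let N : R := (2 ^+ n)%R.

Let a0 : (0 < a)%R. Proof. by rewrite subr_gt0. Qed.
Let rho1 : (1 < rho)%R.
Proof.
by rewrite /rho -[ltLHS](powRr0 2); apply: gt1_ltr_powR => //; rewrite ltr1n.
Qed.
Let rho0 : (0 < rho)%R. Proof. exact: lt_trans rho1. Qed.
Let N0 : (0 < N)%R. Proof. by rewrite exprn_gt0. Qed.
Let NE : N = (2 `^ n%:R)%R. Proof. by rewrite powR_mulrn. Qed.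

(** Exponents below x1, x2 whose sum is at most 1 but still exceeds al / n, as
    [cross_cube_powR_le] requires: (x1, x2) itself or its rescaling to sum 1. *)
Let scaling : exists y1 y2 : R, [/\ (0 < y1 <= x1)%R, (0 < y2 <= x2)%R,
  (y1 + y2 <= 1)%R & (al < n%:R * (y1 + y2))%R].
Proof.
have nr0 : (0 < n%:R :> R)%R by rewrite ltr0n.
have [x121|x121] := leP (x1 + x2)%R 1%R.
  exists x1, x2; split; rewrite ?lexx ?andbT//.
  by rewrite mulrC -ltr_pdivrMr.
have x0 : (0 < x1 + x2)%R by rewrite addr_gt0.
exists (x1 / (x1 + x2))%R, (x2 / (x1 + x2))%R; split.
- by rewrite divr_gt0//= ler_pdivrMr// ler_peMr ?ltW.
- by rewrite divr_gt0//= ler_pdivrMr// ler_peMr ?ltW.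
- by rewrite -mulrDl divff// gt_eqF.
- by rewrite -mulrDl divff ?mulr1// gt_eqF.
Qed.

(** A common bound on the ratios of the geometric series to come, in terms of
    rho = 2^(n - al) and N = 2^n: small cubes against a bounded function, large
    cubes against u1 u2, large cubes against v_i, and the square roots. *)
Let ratio y : (y <= 1)%R -> (al < n%:R * y)%R -> exists q : R,
  [/\ (0 <= q < 1)%R, (rho / N <= q)%R, (N `^ (1 - y) / rho <= q)%R,
    (rho^-1 <= q)%R & (Num.sqrt (rho / N) <= q)%R].
Proof.
move=> y1 aly.
exists (Num.max (Num.max (rho / N) (N `^ (1 - y) / rho)) (Num.max rho^-1 (Num.sqrt (rho / N))))%R.
have h1 : (rho / N < 1)%R.
  rewrite ltr_pdivrMr// mul1r NE /rho; apply: gt1_ltr_powR; first by rewrite ltr1n.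
  by rewrite ltrBlDr ltrDl.
split; rewrite ?le_max ?lexx ?orbT//.
rewrite invr_ge0 (ltW rho0) orbT/= !gt_max h1/= invf_lt1// rho1/=.
have -> : (Num.sqrt (rho / N) < 1)%R by rewrite -[ltRHS]sqrtr1 ltr_sqrt.
rewrite andbT.
rewrite ltr_pdivrMr// mul1r NE -powRrM /rho; apply: gt1_ltr_powR; first by rewrite ltr1n.
by rewrite mulrBr mulr1 ltrD2l ltrN2.
Qed.

(** The operator is at most rho times the sum over m of a constant multiple of q^m,
    of a term [e m] with small integral, and of the term [d m] containing v1 v2 over
    the cube of half-side 2^-m. If the sums over m of [e m] and of sqrt (d m) are at
    most 1 then so is that of [d m], and the operator is at most
    K = rho (Kc + 2). The measure of the exceptional set is therefore at most the
    integral of the sums of [e m] and sqrt (d m). *)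
Lemma level_set_unit_scale : exists K C : R, [/\ (0 < K)%R, (0 <= C)%R &
  forall H1 H2 : V -> R, borel H1 -> borel H2 ->
  (forall x, 0 <= H1 x)%R -> (forall x, 0 <= H2 x)%R ->
  \int[leb]_y (H1 y)%:E <= 1 -> \int[leb]_y (H2 y)%:E <= 1 ->
  leb [set x : Rn | K%:E <
    cross_op (riesz a) (fun y => H1 y `^ x1)%R (fun y => H2 y `^ x2)%R (x : V)] <=
  C%:E * (\int[leb]_y (high x1 (H1 (y : V)))%:E + \int[leb]_y (high x2 (H2 (y : V)))%:E)].
Proof.
have [y1 [y2 [/andP[y10 yx1] /andP[y20 yx2] y12 aly]]] := scaling.
have [q [/andP[q0 q1] qlow qhigh qinv qsqrt]] := ratio y12 aly.
have q10 : (0 < 1 - q)%R by rewrite subr_gt0.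
pose Kc := ((2 * N + 4) / (1 - q))%R.
pose C := ((N + 1 + (1 + N) * N) / (1 - q))%R.
have Kc0 : (0 <= Kc)%R.
  by rewrite divr_ge0 ?(ltW q10)// addr_ge0// mulr_ge0// ltW.
exists (rho * (Kc + 2))%R, C; split.
- by rewrite mulr_gt0// ltr_wpDl.
- have NN := ltW N0; rewrite divr_ge0 ?(ltW q10)// !addr_ge0// mulr_ge0// addr_ge0//.
move=> H1 H2 bH1 bH2 H10 H20 iH1 iH2.
pose u1 (y : V) := low x1 (H1 y). pose v1 (y : V) := high x1 (H1 y).
pose u2 (y : V) := low x2 (H2 y). pose v2 (y : V) := high x2 (H2 y).
have bu1 : borel u1 by exact: (measurableT_comp (measurable_low x1) bH1).
have bv1 : borel v1 by exact: (measurableT_comp (measurable_high x1) bH1).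
have bu2 : borel u2 by exact: (measurableT_comp (measurable_low x2) bH2).
have bv2 : borel v2 by exact: (measurableT_comp (measurable_high x2) bH2).
have u1p y : (0 <= u1 y)%R by exact: low_ge0.
have u2p y : (0 <= u2 y)%R by exact: low_ge0.
have v1p y : (0 <= v1 y)%R by exact: high_ge0.
have v2p y : (0 <= v2 y)%R by exact: high_ge0.
have u1l y : (u1 y <= 1)%R by apply: low_le1; rewrite ?(ltW x10).
have u2l y : (u2 y <= 1)%R by apply: low_le1; rewrite ?(ltW x20).
have iv1 : \int[leb]_y (v1 (y : V))%:E <= 1.
  apply: le_trans iH1; apply: le_integralT => y; rewrite lee_fin//.
  by apply: high_le => //; exact: ltW.
have iv2 : \int[leb]_y (v2 (y : V))%:E <= 1.
  apply: le_trans iH2; apply: le_integralT => y; rewrite lee_fin//.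
  by apply: high_le => //; exact: ltW.
have bone : borel (cst 1%R : V -> R) by exact: measurable_cst.
have onep (y : V) : (0 <= cst (1 : R) y)%R by exact: ler01.
set f1 := fun y : V => (H1 y `^ x1)%R. set f2 := fun y : V => (H2 y `^ x2)%R.
have f1E : f1 = (fun y => u1 y + v1 y)%R by apply/funext => y; exact: low_high.
have f2E : f2 = (fun y => u2 y + v2 y)%R by apply/funext => y; exact: low_high.
have bf1 : borel f1 by rewrite f1E; exact: measurable_funD.
have bf2 : borel f2 by rewrite f2E; exact: measurable_funD.
have f1p y : (0 <= f1 y)%R by exact: powR_ge0.
have f2p y : (0 <= f2 y)%R by exact: powR_ge0.
have rX m : (0 < rho ^+ m)%R by rewrite exprn_gt0.
have rXi m : (0 < rho ^- m)%R by rewrite invr_gt0.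
have s1 m : (0 < 2 ^- m :> R)%R by rewrite invr_gt0 exprn_gt0.
have s2 m : (0 < 2 ^+ m :> R)%R by rewrite exprn_gt0.
pose e m (x : V) : \bar R := (rho ^+ m)%:E *
    (cross_cube (2 ^- m) v1 (cst 1%R) x + cross_cube (2 ^- m) (cst 1%R) v2 x) +
  (rho ^- m)%:E * cross_cube (2 ^+ m) v1 v2 x.
pose d m (x : V) : \bar R := (rho ^+ m)%:E * cross_cube (2 ^- m) v1 v2 x.
have cc0 s f g x : (forall y, 0 <= f y)%R -> (forall y, 0 <= g y)%R -> 0 <= @cross_cube R n s f g x.
  exact: cross_cube_ge0.
have e0 m x : 0 <= e m x.
  apply: adde_ge0; apply: mule_ge0; rewrite ?lee_fin ?(ltW (rX m)) ?(ltW (rXi m))//.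
    by apply: adde_ge0; exact: cc0.
  exact: cc0.
have d0 m x : 0 <= d m x.
  by apply: mule_ge0; [rewrite lee_fin ltW|exact: cc0].
(* N * q ^+ m comes from u1 u2 on the small cube, (N + 2) * q ^+ m from u1 u2 on
   the large one, and 2 * q ^+ m from the masses of v1 and v2, at most 1 each *)
have term m x : (rho ^+ m)%:E * cross_cube (2 ^- m) f1 f2 x +
    (rho ^- m)%:E * cross_cube (2 ^+ m) f1 f2 x <=
    ((2 * N + 4) * q ^+ m)%:E + e m x + d m x.
  have fs s : cross_cube s f1 f2 x <= cross_cube s u1 u2 x +
      (cross_cube s v1 (cst 1%R) x + cross_cube s (cst 1%R) v2 x) +
      cross_cube s v1 v2 x.
    rewrite f1E f2E; apply: cross_cube_split => // y;
    by apply/andP; split.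
  have qm : (0 <= q ^+ m)%R by rewrite exprn_ge0.
  have low1 : (rho ^+ m)%:E * cross_cube (2 ^- m) u1 u2 x <= (N * q ^+ m)%:E.
    apply: (@le_trans _ _ ((rho ^+ m)%:E * ((2 * 2 ^- m) ^+ n)%:E)).
      apply: lee_wpmul2l; first by rewrite lee_fin ltW.
      by apply: cross_cube_le_cst => //; exact: ltW.
    rewrite -EFinM lee_fin exprMn -/N exprVn -exprM mulnC exprM -/N mulrCA ler_wpM2l ?(ltW N0)//.
    rewrite -expr_div_n lerXn2r ?nnegrE// divr_ge0// ltW//.
  have high1 : (rho ^- m)%:E * cross_cube (2 ^+ m) u1 u2 x <= ((N + 2) * q ^+ m)%:E.
    apply: (@le_trans _ _ ((rho ^- m)%:E * ((2 ^+ n + 2) * (N ^+ m) `^ (1 - (y1 + y2)))%:E)).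
      apply: lee_wpmul2l; first by rewrite lee_fin ltW.
      have sE : (N ^+ m = (2 ^+ m) ^+ n)%R by rewrite -!exprM mulnC.
      apply: (cross_cube_powR_le u1p u2p x bH1 bH2 H10 H20 iH1 iH2
        (ltW y10) (ltW y20) y12 (s2 m) sE) => y; exact: low_le_powR.
    rewrite -EFinM lee_fin mulrCA -/N ler_wpM2l ?addr_ge0 ?(ltW N0)//.
    rewrite -powR_exprn ?(ltW N0)// mulrC -expr_div_n lerXn2r ?nnegrE//.
    by rewrite divr_ge0// ?powR_ge0// ltW.
  have qi : (rho ^- m <= q ^+ m)%R.
    by rewrite -exprVn lerXn2r ?nnegrE// invr_ge0 ltW.
  have high2 : (rho ^- m)%:E * (cross_cube (2 ^+ m) v1 (cst 1%R) x +
      cross_cube (2 ^+ m) (cst 1%R) v2 x) <= (2 * q ^+ m)%:E.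
    apply: (@le_trans _ _ ((rho ^- m)%:E * (1 + 1))).
      apply: lee_wpmul2l; first by rewrite lee_fin ltW.
      apply: leeD; [apply: le_trans iv1|apply: le_trans iv2].
        exact: cross_cuber_le.
      exact: cross_cubel_le.
    by rewrite (_ : _ * (1 + 1) = (rho ^- m * 2)%:E)// lee_fin mulrC ler_wpM2l.
  have J0 s f g h k : (forall y, 0 <= f y)%R -> (forall y, 0 <= g y)%R ->
     (forall y, 0 <= h y)%R -> (forall y, 0 <= k y)%R ->
     0 <= @cross_cube R n s f g x + @cross_cube R n s h k x.
    by move=> *; apply: adde_ge0; exact: cc0.
  have A1 : (rho ^+ m)%:E * cross_cube (2 ^- m) f1 f2 x <= (N * q ^+ m)%:E +
      (rho ^+ m)%:E * (cross_cube (2 ^- m) v1 (cst 1%R) x +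
        cross_cube (2 ^- m) (cst 1%R) v2 x) + d m x.
    apply: le_trans (_ : (rho ^+ m)%:E * _ <= _).
      by apply: lee_wpmul2l; [rewrite lee_fin ltW|exact: fs].
    rewrite ge0_muleDr; [|by apply: adde_ge0; [exact: cc0|exact: J0]|exact: cc0].
    rewrite ge0_muleDr; [|exact: cc0|exact: J0].
    by apply: leeD2r; apply: leeD2r; exact: low1.
  have A2 : (rho ^- m)%:E * cross_cube (2 ^+ m) f1 f2 x <= ((N + 4) * q ^+ m)%:E +
      (rho ^- m)%:E * cross_cube (2 ^+ m) v1 v2 x.
    apply: le_trans (_ : (rho ^- m)%:E * _ <= _).
      by apply: lee_wpmul2l; [rewrite lee_fin ltW|exact: fs].
    rewrite ge0_muleDr; [|by apply: adde_ge0; [exact: cc0|exact: J0]|exact: cc0].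
    rewrite ge0_muleDr; [|exact: cc0|exact: J0].
    apply: leeD2r; apply: le_trans (leeD high1 high2) _.
    by rewrite -EFinD lee_fin -mulrDl -addrA -natrD.
  apply: (le_trans (leeD A1 A2)); rewrite addeAC addeACA /e.
  rewrite (_ : (N * q ^+ m)%:E + ((N + 4) * q ^+ m)%:E = ((2 * N + 4) * q ^+ m)%:E)//.
  by rewrite -EFinD; congr EFin; ring.
have mcc s f g : borel f -> borel g -> (forall y, 0 <= f y)%R -> (forall y, 0 <= g y)%R ->
    measurable_fun [set: Rn] (fun x : Rn => @cross_cube R n s f g (x : V)).
  move=> bf bg f0 g0.
  by apply: measurable_cross_cube; [exact: row_measurable_id|exact: bf|exact: bg|exact: f0|exact: g0].
have me1 m : measurable_fun [set: Rn] (fun x : Rn => cross_cube (2 ^- m) v1 (cst 1%R) (x : V) +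
   cross_cube (2 ^- m) (cst 1%R) v2 (x : V)).
  by apply: emeasurable_funD; exact: mcc.
have me2 m : measurable_fun [set: Rn] (fun x : Rn =>
    (rho ^+ m)%:E * (cross_cube (2 ^- m) v1 (cst 1%R) (x : V) +
   cross_cube (2 ^- m) (cst 1%R) v2 (x : V))).
  by apply: emeasurable_funM; [exact: measurable_cst|exact: me1].
have me3 m : measurable_fun [set: Rn] (fun x : Rn =>
    (rho ^- m)%:E * cross_cube (2 ^+ m) v1 v2 (x : V)).
  by apply: emeasurable_funM; [exact: measurable_cst|exact: mcc].
have me m : measurable_fun [set: Rn] (e m : Rn -> \bar R).
  by apply: emeasurable_funD; [exact: me2|exact: me3].
have mdd m : measurable_fun [set: Rn] (d m : Rn -> \bar R).
  by apply: emeasurable_funM; [exact: measurable_cst|exact: mcc].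
have md m : measurable_fun [set: Rn] (fun x : Rn => (d m (x : V)) `^ 2^-1).
  exact: (measurableT_comp (measurable_poweR 2^-1%R) (mdd m)).
have ie m : \int[leb]_x e m (x : V) <= ((N + 1) * q ^+ m)%:E *
  (\int[leb]_y (v1 (y : V))%:E + \int[leb]_y (v2 (y : V))%:E).
  have qm : (0 <= q ^+ m)%R by rewrite exprn_ge0.
  have V10 : 0 <= \int[leb]_y (v1 (y : V))%:E by apply: integral_ge0 => y _; rewrite lee_fin.
  have V20 : 0 <= \int[leb]_y (v2 (y : V))%:E by apply: integral_ge0 => y _; rewrite lee_fin.
  have l0 (x : Rn) : 0 <= cross_cube (2 ^- m) v1 (cst 1%R) (x : V) + cross_cube (2 ^- m) (cst 1%R) v2 (x : V).
    by apply: adde_ge0; exact: cc0.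
  rewrite ge0_integralD; last first.
  - exact: me3.
  - by move=> x _; apply: mule_ge0; [rewrite lee_fin ltW|exact: cc0].
  - exact: me2.
  - by move=> x _; apply: mule_ge0; [rewrite lee_fin ltW|exact: l0].
  - exact: measurableT.
  rewrite ge0_integralZl; last first.
  - by rewrite lee_fin ltW.
  - by move=> x _; exact: l0.
  - exact: me1.
  - exact: measurableT.
  rewrite ge0_integralZl; last first.
  - by rewrite lee_fin ltW.
  - by move=> x _; exact: cc0.
  - exact: mcc.
  - exact: measurableT.
  rewrite ge0_integralD; last first.
  - exact: mcc.
  - by move=> x _; exact: cc0.
  - exact: mcc.
  - by move=> x _; exact: cc0.
  - exact: measurableT.
  rewrite (integral_cross_cuber bv1 v1p (ltW (s1 m))) (integral_cross_cubel bv2 v2p (ltW (s1 m))).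
  rewrite -ge0_muleDr// muleA.
  have -> : ((N + 1) * q ^+ m)%:E = (N * q ^+ m)%:E + (q ^+ m)%:E.
    by rewrite -EFinD; congr EFin; ring.
  rewrite [leRHS]ge0_muleDl; last 2 first.
    by rewrite lee_fin mulr_ge0// ltW.
    by rewrite lee_fin.
  apply: leeD.
    apply: lee_wpmul2r; first exact: adde_ge0.
    rewrite -EFinM lee_fin exprMn -/N exprVn -exprM mulnC exprM -/N mulrCA ler_wpM2l ?(ltW N0)//.
    by rewrite -expr_div_n lerXn2r ?nnegrE// divr_ge0// ltW.
  apply: (@le_trans _ _ ((q ^+ m)%:E * (\int[leb]_y (v1 (y : V))%:E * \int[leb]_y (v2 (y : V))%:E))).
    apply: lee_pmul; first by rewrite lee_fin ltW.
    - by apply: integral_ge0 => x _; exact: cc0.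
    - by rewrite lee_fin -exprVn lerXn2r ?nnegrE// invr_ge0 ltW.
    - exact: integral_cross_cube_le.
  apply: lee_wpmul2l; first by rewrite lee_fin.
  apply: (@le_trans _ _ (\int[leb]_y (v1 (y : V))%:E)); last by rewrite leeDl.
  by rewrite -[leRHS]mule1; exact: lee_wpmul2l.
have id m : \int[leb]_x (d m (x : V)) `^ 2^-1 <= ((1 + N) * N * q ^+ m)%:E *
  (\int[leb]_y (v1 (y : V))%:E + \int[leb]_y (v2 (y : V))%:E).
  have V0 : 0 <= \int[leb]_y (v1 (y : V))%:E + \int[leb]_y (v2 (y : V))%:E.
    by apply: adde_ge0; apply: integral_ge0 => y _; rewrite lee_fin.
  have dE (x : Rn) : (d m (x : V)) `^ 2^-1 =
      (Num.sqrt (rho ^+ m))%:E * (cross_cube (2 ^- m) v1 v2 (x : V)) `^ 2^-1.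
    rewrite /d poweRM; [|by rewrite lee_fin ltW|exact: cc0].
    by rewrite poweR_EFin powR12_sqrt// ltW.
  under eq_integral do rewrite dE.
  rewrite ge0_integralZl; last first.
  - by rewrite lee_fin sqrtr_ge0.
  - by move=> x _; exact: poweR_ge0.
  - by apply: (measurableT_comp (measurable_poweR 2^-1%R)); exact: mcc.
  - exact: measurableT.
  have sg0 : (0 < Num.sqrt ((2 ^- m) ^+ n) :> R)%R by rewrite sqrtr_gt0 exprn_gt0.
  have sgE : (Num.sqrt ((2 ^- m) ^+ n) ^+ 2 = (2 ^- m) ^+ n :> R)%R.
    by rewrite sqr_sqrtr// ltW// exprn_gt0.
  apply: (@le_trans _ _ ((Num.sqrt (rho ^+ m))%:E * (((1 + N) * N * Num.sqrt ((2 ^- m) ^+ n))%:E *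
     (\int[leb]_y (v1 (y : V))%:E + \int[leb]_y (v2 (y : V))%:E)))).
    apply: lee_wpmul2l; first by rewrite lee_fin sqrtr_ge0.
    exact: (integral_sqrt_cross_cube (s1 m) sg0 sgE).
  rewrite muleA -EFinM; apply: lee_wpmul2r; first exact: V0.
  rewrite lee_fin mulrCA; apply: ler_wpM2l.
    by rewrite mulr_ge0 ?addr_ge0// ltW.
  rewrite -sqrtrM ?(ltW (rX m))// exprVn -exprM mulnC exprM -/N -expr_div_n.
  rewrite (_ : Num.sqrt _ = Num.sqrt (rho / N) ^+ m)%R.
    by rewrite lerXn2r ?nnegrE// sqrtr_ge0.
  elim: m {dE sg0 sgE} => [|m IH]; first by rewrite !expr0 sqrtr1.
  by rewrite exprS sqrtrM ?IH ?exprS// divr_ge0// ltW.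
pose S := \int[leb]_y (v1 (y : V))%:E + \int[leb]_y (v2 (y : V))%:E.
have S0 : 0 <= S by apply: adde_ge0; apply: integral_ge0 => y _; rewrite lee_fin.
pose E (x : Rn) := \sum_(0 <= m <oo) e m (x : V).
pose D (x : Rn) := \sum_(0 <= m <oo) (d m (x : V)) `^ 2^-1.
have dom (x : Rn) : (rho * (Kc + 2))%:E < cross_op (riesz a) f1 f2 (x : V) -> 1 <= E x + D x.
  move=> lt; rewrite leNgt; apply/negP => ED; move: lt; apply/negP; rewrite -leNgt.
  have E0 : 0 <= E x by apply: nneseries_ge0 => m _ _; exact: e0.
  have D0 : 0 <= D x by apply: nneseries_ge0 => m _ _; exact: poweR_ge0.
  have E1 : E x <= 1 by apply: le_trans (ltW ED); exact: leeDl.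
  have D1 : D x <= 1 by apply: le_trans (ltW ED); exact: leeDr.
  apply: (le_trans (cross_op_riesz_le bf1 bf2 f1p f2p x a0)).
  rewrite EFinM; apply: lee_wpmul2l; first by rewrite lee_fin ltW.
  have k0 m : 0 <= ((2 * N + 4) * q ^+ m)%:E.
    by rewrite lee_fin mulr_ge0 ?exprn_ge0// addr_ge0// mulr_ge0// ltW.
  apply: (@le_trans _ _ (\sum_(0 <= m <oo)
     (((2 * N + 4) * q ^+ m)%:E + e m (x : V) + d m (x : V)))).
    apply: lee_nneseries => [m _ _|m _]; last exact: term.
    by apply: adde_ge0; apply: mule_ge0; rewrite ?lee_fin ?(ltW (rX m)) ?(ltW (rXi m))//; exact: cc0.
  rewrite nneseriesD; [|by move=> m _ _; exact: adde_ge0|by move=> m _ _].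
  rewrite nneseriesD; [|by move=> m _ _|by move=> m _ _].
  rewrite (_ : (Kc + 2)%:E = Kc%:E + 1 + 1); last by rewrite -!EFinD -addrA.
  apply: leeD; first apply: leeD.
  - by apply: nneseries_geometric_le => //; rewrite addr_ge0// mulr_ge0// ltW.
  - exact: E1.
  - exact: (le_trans (nneseries_poweR12_ge _ D1)).
have mB := measurable_cross_op (borel_riesz a) bf1 bf2 (riesz_ge0 a) f1p f2p.
pose A := [set x : Rn | (rho * (Kc + 2))%:E < cross_op (riesz a) f1 f2 (x : V)].
have mA : measurable A.
  have := emeasurable_fun_o_infty measurableT mB (rho * (Kc + 2))%:E.
  by rewrite setTI.
rewrite -/A -/S.
have -> : leb A = \int[leb]_x (\1_A x)%:E by rewrite integral_indic ?setIT.
apply: (@le_trans _ _ (\int[leb]_x (E x + D x))).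
  apply: le_integralT => x; first by rewrite lee_fin indic_ge0.
  rewrite indicE; case: (boolP (_ \in _)) => [/[!inE] /dom//|_].
  apply: adde_ge0; apply: nneseries_ge0 => m _ _; [exact: e0|exact: poweR_ge0].
rewrite ge0_integralD; last first.
- by apply: measurable_nneseries => [m|m x]; [exact: md|exact: poweR_ge0].
- by move=> x _; apply: nneseries_ge0 => m _ _; exact: poweR_ge0.
- by apply: measurable_nneseries => [m|m x]; [exact: me|exact: e0].
- by move=> x _; apply: nneseries_ge0 => m _ _; exact: e0.
- exact: measurableT.
rewrite integral_nneseries; last first.
- by move=> m x _; exact: e0.
- exact: me.
- exact: measurableT.
rewrite integral_nneseries; last first.
- by move=> m x _; exact: poweR_ge0.
- exact: md.
- exact: measurableT.
have geo c : (0 <= c)%R -> \sum_(0 <= m <oo) ((c * q ^+ m)%:E * S) <= (c / (1 - q))%:E * S.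
  have Sfin : S \is a fin_num.
    by rewrite ge0_fin_numE// (le_lt_trans (leeD iv1 iv2))// -EFinD ltry.
  move=> c0; rewrite -(fineK Sfin); under eq_eseriesr do rewrite muleC.
  rewrite nneseriesZl; last by move=> m _; rewrite lee_fin mulr_ge0// exprn_ge0.
  by rewrite muleC; apply: lee_wpmul2r; [rewrite fineK|exact: nneseries_geometric_le].
have NN := ltW N0.
rewrite /C mulrDl EFinD ge0_muleDl; last 2 first.
  by rewrite lee_fin divr_ge0// ?(ltW q10)// addr_ge0.
  by rewrite lee_fin divr_ge0// ?(ltW q10)// mulr_ge0// addr_ge0.
apply: leeD; (apply: le_trans; last apply: geo).
- apply: lee_nneseries => [m _ _|m _]; last exact: ie.
  by apply: integral_ge0 => x _; exact: e0.
- by rewrite addr_ge0.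
- apply: lee_nneseries => [m _ _|m _]; last exact: id.
  by apply: integral_ge0 => x _; exact: poweR_ge0.
- by rewrite mulr_ge0// addr_ge0.
Qed.

End level_set_unit_scale.

(** * Series over the powers of a base *)

Section integer_sums.
Context (R : realType).
Implicit Types (b h x s : R) (u : int -> \bar R).

(** The sum over the integers of nonnegative terms, pairing m >= 0 with -(m+1). *)
Definition zseries u : \bar R :=
  (\sum_(0 <= m <oo) (u (Posz m) + u (Negz m)))%E.

Lemma zseries_ge_term u (j : int) : (forall j, 0 <= u j)%E -> (u j <= zseries u)%E.
Proof.
move=> u0; have h m : (u (Posz m) + u (Negz m) <= zseries u)%E.
  apply: (nneseries_ge_term (u := fun m => u (Posz m) + u (Negz m))%E) => k.
  exact: adde_ge0.
by case: j => m; apply: le_trans (h m); [exact: leeDl|exact: leeDr].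
Qed.

Lemma le_zseries u v : (forall j, 0 <= u j)%E -> (forall j, u j <= v j)%E ->
  (zseries u <= zseries v)%E.
Proof.
move=> u0 uv; apply: lee_nneseries => [m _ _|m _]; first exact: adde_ge0.
exact: leeD.
Qed.

Lemma zseriesZl u c : 0 <= c -> (forall j, 0 <= u j)%E ->
  (zseries (fun j => c%:E * u j) = c%:E * zseries u)%E.
Proof.
move=> c0 u0; rewrite /zseries -nneseriesZl; last by move=> m _; exact: adde_ge0.
by apply: eq_eseriesr => m _; rewrite ge0_muleDr.
Qed.

Lemma zseriesD u v : (forall j, 0 <= u j)%E -> (forall j, 0 <= v j)%E ->
  (zseries (fun j => u j + v j) = zseries u + zseries v)%E.
Proof.
move=> u0 v0; rewrite /zseries -nneseriesD; try by move=> m _ _; exact: adde_ge0.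
by apply: eq_eseriesr => m _; rewrite addeACA.
Qed.

Lemma integral_zseries d (X : measurableType d) (mu : {measure set X -> \bar R})
    (u : int -> X -> \bar R) :
  (forall j, measurable_fun setT (u j)) -> (forall j z, 0 <= u j z)%E ->
  (\int[mu]_z zseries (u ^~ z) = zseries (fun j => \int[mu]_z u j z))%E.
Proof.
move=> mu_ u0; rewrite /zseries integral_nneseries//.
- by apply: eq_eseriesr => m _; rewrite ge0_integralD.
- by move=> m; exact: emeasurable_funD.
- by move=> m x _; exact: adde_ge0.
Qed.

Lemma measurable_zseries d (X : measurableType d) (u : int -> X -> \bar R) :
  (forall j, measurable_fun setT (u j)) -> (forall j z, 0 <= u j z)%E ->
  measurable_fun setT (fun z => zseries (u ^~ z)).
Proof.
move=> mu_ u0; apply: measurable_nneseries => [m|m x].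
  exact: emeasurable_funD.
exact: adde_ge0.
Qed.

Lemma exprn_unbounded b s : 2 <= b -> exists m, s < b ^+ m.
Proof.
move=> b2; have [m hm] := pow2_unbounded s; exists m; apply: lt_le_trans hm _.
by rewrite lerXn2r ?nnegrE//; apply: le_trans b2.
Qed.

Lemma exprz_bracket b s : 2 <= b -> 0 < s -> exists j : int, b ^ j < s <= b ^ (j + 1).
Proof.
move=> b2 s0; have b0 : 0 < b by rewrite (lt_le_trans _ b2).
have [s1|s1] := ltP 1 s.
  have ub : exists m, s <= b ^+ m by have [m /ltW] := exprn_unbounded s b2; exists m.
  have := ex_minnP ub; case=> -[|m]; first by rewrite expr0 leNgt s1.
  move=> sm hm; exists (Posz m); rewrite -exprnP -PoszD addn1 -exprnP sm andbT.
  by rewrite ltNge; apply/negP => /hm; rewrite ltnn.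
have := ex_minnP (exprn_unbounded s^-1 b2); case=> -[|m].
  by rewrite expr0 invf_lt1// ltNge s1.
move=> sm hm; exists (Negz m); rewrite NegzE -exprnN.
have -> : - m.+1%:Z + 1 = - m%:Z by rewrite -addn1 PoszD opprD addrNK.
rewrite -exprnN -[X in _ < X <= _]invrK ltf_pV2 ?posrE ?invr_gt0 ?exprn_gt0// sm/=.
rewrite -[X in X <= _]invrK lef_pV2 ?posrE ?invr_gt0 ?exprn_gt0//.
by rewrite ?invrK leNgt; apply/negP => /hm; rewrite ltnn.
Qed.

(** If b^j < s <= b^(j+1), the j-th term alone gives s / b. *)
Lemma powers_layer_cake b s : 2 <= b -> 0 <= s ->
  (s%:E <= b%:E * zseries (fun j => (b ^ j * (b ^ j < s)%R%:R)%R%:E))%E.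
Proof.
move=> b2 s0; have b0 : 0 < b by rewrite (lt_le_trans _ b2).
have u0 (j : int) : (0 <= (b ^ j * (b ^ j < s)%R%:R)%R%:E)%E.
  by rewrite lee_fin mulr_ge0// exprz_ge0// ltW.
have [->|sn0] := eqVneq s 0.
  apply: mule_ge0; first by rewrite lee_fin ltW.
  apply: nneseries_ge0 => m _ _.
  by apply: adde_ge0; rewrite lee_fin mulr_ge0// exprz_ge0// ltW.
have sp : 0 < s by rewrite lt_neqAle eq_sym sn0.
have [j /andP[js sj]] := exprz_bracket b2 sp.
apply: (@le_trans _ _ (b%:E * (b ^ j * (b ^ j < s)%R%:R)%R%:E)%E).
  rewrite js mulr1 -EFinM lee_fin (le_trans sj)// expfzDr ?gt_eqF// expr1z mulrC//.
apply: lee_wpmul2l; first by rewrite lee_fin ltW.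
exact: (zseries_ge_term (u := fun j => (b ^ j * (b ^ j < s)%R%:R)%R%:E)).
Qed.

Lemma zseries_powers_pinfty b : 2 <= b ->
  zseries (fun j => (b ^ j)%:E) = +oo%E.
Proof.
move=> b2; have b0 : 0 < b by rewrite (lt_le_trans _ b2).
have u0 (j : int) : (0 <= (b ^ j)%:E)%E by rewrite lee_fin exprz_ge0// ltW.
apply/eqyP => A A0; have [m hm] := exprn_unbounded A b2.
apply: (@le_trans _ _ (b ^ Posz m)%:E); first by rewrite lee_fin -exprnP ltW.
exact: (zseries_ge_term (u := fun j => (b ^ j)%:E)).
Qed.

Lemma invr_powR b x : 0 <= b -> b^-1 `^ x = b `^ (- x).
Proof. by move=> b0; rewrite -powR_inv1// -powRrM mulN1r. Qed.

Lemma powR_subr x b : 0 <= b -> b `^ x * b `^ (1 - x) = b.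
Proof.
move=> b0; rewrite -powRD; last by rewrite subrKC oner_eq0.
by rewrite subrKC powRr1.
Qed.

(** Where b^j < h, the summand is h^x (b^j)^(1-x), which is a constant times
    h^x (t_j - t_(j-1)) for t_j = min (b^j, h)^(1-x). The sum telescopes and
    t_j <= h^(1-x). *)
Lemma zseries_powers_le b x : 2 <= b -> 0 < x -> x < 1 -> exists c, 0 <= c /\
  forall h, 0 <= h -> (zseries (fun j => (b ^ j * high x (h / b ^ j))%:E) <= (c * h)%:E)%E.
Proof.
move=> b2 x0 x1; have b0 : 0 < b by rewrite (lt_le_trans _ b2).
have bn0 : b != 0 by rewrite gt_eqF.
have bj0 (j : int) : 0 < b ^ j by exact: exprz_gt0.
pose y := 1 - x; have y0 : 0 < y by rewrite subr_gt0.
have yge0 := ltW y0.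
have by1 : b `^ (- y) < 1.
  rewrite -[ltRHS](powRr0 b); apply: gt1_ltr_powR; last by rewrite oppr_lt0.
  by rewrite (lt_le_trans _ b2)// ltr1n.
pose c := (1 - b `^ (- y))^-1.
have c0 : 0 < c by rewrite invr_gt0 subr_gt0.
exists c; split; [exact: ltW|move=> h h0].
pose th (j : int) := (Num.min (b ^ j) h) `^ y.
have thle j : th j <= h `^ y.
  by apply: ge0_ler_powR; rewrite ?nnegrE ?le_min ?h0 ?(ltW (bj0 _))// ge_min lexx orbT.
have th0 j : 0 <= th j by exact: powR_ge0.
have thD j : b ^ j * high x (h / b ^ j) <= h `^ x * c * (th j - th (j - 1)).
  have bjD : b ^ j = b * b ^ (j - 1) by rewrite expfzDr// mulrCA exprN1 mulfV// mulr1.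
  have thm : th (j - 1) <= th j.
    apply: ge0_ler_powR; rewrite ?nnegrE ?le_min ?h0 ?(ltW (bj0 _))//.
    rewrite ge_min; apply/andP; split; last by rewrite ge_min lexx orbT.
    by rewrite bjD ler_peMl ?(ltW (bj0 _))// (le_trans _ b2)// ler1n.
  rewrite /high; case: ifPn => [_|].
    by rewrite mulr0 mulr_ge0 ?subr_ge0// mulr_ge0 ?powR_ge0// ltW.
  rewrite -ltNge ltr_pdivlMr// mul1r => bjh.
  have b1h : b ^ (j - 1) < h.
    apply: le_lt_trans bjh; rewrite bjD ler_peMl ?(ltW (bj0 _))//.
    by rewrite (le_trans _ b2)// ler1n.
  rewrite /th (min_l (ltW bjh)) (min_l (ltW b1h)) -mulrA.
  have -> : b ^ (j - 1) = b ^ j / b by rewrite expfzDr// exprN1.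
  rewrite [(b ^ j / b) `^ y]powRM ?invr_ge0 ?(ltW b0) ?(ltW (bj0 _))//.
  rewrite invr_powR ?(ltW b0)//.
  rewrite -[X in _ <= _ * (_ * (X - _))]mulr1 -mulrBr [c * _]mulrCA /c.
  rewrite mulVf ?mulr1; last by rewrite gt_eqF// subr_gt0.
  have Bx : (b ^ j) `^ x != 0 by rewrite gt_eqF// powR_gt0.
  rewrite powRM ?invr_ge0 ?(ltW (bj0 _))// invr_powR ?(ltW (bj0 _))//.
  rewrite mulrCA ler_wpM2l ?powR_ge0// -[X in X * _](powR_subr x (ltW (bj0 j))).
  by rewrite powRN mulrAC mulfV// mul1r.
have part M : \sum_(0 <= m < M) ((th (Posz m) - th (Posz m - 1)) +
    (th (Negz m) - th (Negz m - 1))) = th (Posz M - 1) - th (- Posz M - 1).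
  elim: M => [|M IH]; first by rewrite big_nil oppr0 subrr.
  rewrite big_nat_recr//= IH NegzE -addn1 PoszD addrK opprD; ring.
have w0 j : (0 <= (b ^ j * high x (h / b ^ j))%:E)%E.
  by rewrite lee_fin mulr_ge0 ?high_ge0// ltW.
apply: lime_le.
  by apply: is_cvg_nneseries => m _ _; apply: adde_ge0.
apply: nearW => M.
apply: (@le_trans _ _ (\sum_(0 <= m < M) (h `^ x * c * ((th (Posz m) - th (Posz m - 1)) +
    (th (Negz m) - th (Negz m - 1)))))%:E).
  rewrite -sumEFin; apply: lee_sum => m _.
  by rewrite -EFinD lee_fin mulrDr lerD.
rewrite lee_fin -mulr_sumr part -[h in leRHS](powR_subr x h0) mulrA [c * _]mulrC.
apply: ler_wpM2l; first by rewrite mulr_ge0 ?powR_ge0// ltW.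
by rewrite lerBlDr (le_trans (thle _))// lerDl.
Qed.

End integer_sums.

(** * The strong bound for the kernel |y|^(al - n) *)

Section level_set_all_scales.
Context (R : realType) (n : nat).
Local Notation V := 'rV[R]_n.
Local Notation Rn := (Rn R n).
Local Notation leb := (@leb R n).
Local Open Scope ereal_scope.
Variables (al x1 x2 p : R).
Hypotheses (n0 : (0 < n)%N) (al0 : (0 < al)%R) (aln : (al < n%:R)%R).
Hypotheses (x10 : (0 < x1)%R) (x11 : (x1 < 1)%R) (x20 : (0 < x2)%R) (x21 : (x2 < 1)%R).
Hypotheses (p0 : (0 < p)%R) (px : (p^-1 + al / n%:R = x1 + x2)%R).

Let a : R := (n%:R - al)%R.

Lemma borel_dilate (h : V -> R) (r c : R) : borel h -> borel (fun y => c * h (r *: y))%R.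
Proof.
move=> bh; apply: measurable_funM; first exact: measurable_cst.
apply: (measurable_borel bh) => i.
have : measurable_fun setT (fun t : n.-tuple (measurableTypeR R) => r * tnth t i : R)%R.
  by apply: measurable_funM; [exact: measurable_cst|exact: measurable_tnth].
by apply: eq_measurable_fun => t _; rewrite !mxE.
Qed.

Lemma integral_dilate_EFin (h : V -> R) (r : R) : (0 < r)%R -> borel h ->
  (forall x, 0 <= h x)%R ->
  \int[leb]_y (h (r^-1 *: (y : V)))%:E = (r ^+ n)%:E * \int[leb]_y (h (y : V))%:E.
Proof.
move=> r0 bh h0; have r0' : (0 < r^-1)%R by rewrite invr_gt0.
rewrite (ge0_integral_dilate (f := fun y : Rn => (h (y : V))%:E) r0').
- by rewrite exprVn invrK.
- by apply/measurable_EFinP; exact: measurable_borel_id.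
- by move=> y; rewrite lee_fin.
Qed.

Lemma cross_op_dilate (f g : V -> R) (r : R) x : (0 < r)%R -> borel f -> borel g ->
  (forall x, 0 <= f x)%R -> (forall x, 0 <= g x)%R ->
  cross_op (riesz a) (fun y => f (r^-1 *: y)) (fun y => g (r^-1 *: y)) x =
  (r `^ al)%:E * cross_op (riesz a) f g (r^-1 *: x).
Proof.
move=> r0 bf bg f0 g0; have r0' : (0 < r^-1)%R by rewrite invr_gt0.
pose Phi (y : V) := (f (r^-1 *: x + y) * g (r^-1 *: x - y) * riesz a y)%R.
have Phi0 y : (0 <= Phi y)%R by rewrite mulr_ge0 ?riesz_ge0// mulr_ge0.
have mPhi : measurable_fun [set: Rn] (Phi : Rn -> R).
  apply: measurable_funM; first exact: measurable_cross_arg.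
  exact: (measurable_borel_id (borel_riesz a)).
transitivity (\int[leb]_y (r `^ (- a) * Phi (r^-1 *: (y : V)))%:E).
  apply: eq_integral => y _; congr EFin; rewrite /Phi scalerDr scalerBr.
  rewrite [RHS]mulrCA; congr (_ * _)%R.
  rewrite /riesz normrZ gtr0_norm// powRM ?invr_ge0 ?(ltW r0)//.
  rewrite invr_powR ?(ltW r0)// mulrA -powRD; last by rewrite (gt_eqF r0) implybT.
  by rewrite addrN powRr0 mul1r.
have mPhir : measurable_fun [set: Rn] (fun y : Rn => Phi (r^-1 *: (y : V))).
  apply: measurable_funM; last first.
    apply: (measurable_borel (borel_riesz a)).
    by apply: row_measurableZ; exact: row_measurable_id.
  apply: measurable_funM.
    apply: (measurable_borel bf); apply: row_measurableD; first exact: row_measurable_cst.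
    by apply: row_measurableZ; exact: row_measurable_id.
  apply: (measurable_borel bg); apply: row_measurableB; first exact: row_measurable_cst.
  by apply: row_measurableZ; exact: row_measurable_id.
rewrite integralZ_EFin; [|exact: powR_ge0|exact: mPhir|by move=> y; exact: Phi0].
rewrite (ge0_integral_dilate (f := fun y : Rn => (Phi (y : V))%:E) r0'); last 2 first.
- by apply/measurable_EFinP; exact: mPhi.
- by move=> y; rewrite lee_fin; exact: Phi0.
rewrite muleA -EFinM; congr (_%:E * _).
rewrite exprVn invrK -powR_mulrn ?(ltW r0)// -powRD; last by rewrite (gt_eqF r0) implybT.
by congr (_ `^ _)%R; rewrite /a; ring.
Qed.

Lemma leb_dilate (B : set Rn) (r : R) : (0 < r)%R ->
  leb [set x : Rn | B (r^-1 *: (x : V))%R] = (r ^+ n)%:E * leb B.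
Proof.
move=> r0; have rn0 : (r^-1 != 0)%R by rewrite invr_eq0 gt_eqF.
have := leb_affine 0%R B rn0; rewrite gtr0_norm ?invr_gt0// exprVn invrK => <-.
by congr (leb _); apply/seteqP; split => x /=; rewrite addr0.
Qed.

Lemma cross_opZ (k f g : V -> R) : borel k -> borel f -> borel g ->
  (forall x, 0 <= k x)%R -> (forall x, 0 <= f x)%R -> (forall x, 0 <= g x)%R ->
  forall x (c d : R), (0 <= c)%R -> (0 <= d)%R ->
  cross_op k (fun y => c * f y)%R (fun y => d * g y)%R x =
  (c * d)%:E * cross_op k f g x.
Proof.
move=> bk bf bg k0 f0 g0 x c d c0 d0; rewrite /cross_op -integralZ_EFin.
- by apply: eq_integral => y _; congr EFin; ring.
- exact: mulr_ge0.
- apply: measurable_funM; first exact: measurable_cross_arg.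
  exact: measurable_borel_id.
- by move=> y; apply: mulr_ge0; [exact: mulr_ge0|exact: k0].
Qed.

(** Apply the unit scale estimate to H_i(y) = r^-n h_i(y / r), which have the same
    integrals as h_i. The powers of r add up to r^(-n/p) by the relation between
    p, x1, x2 and al. *)
Lemma level_set_all_scales : exists K C : R, [/\ (0 < K)%R, (0 <= C)%R &
  forall h1 h2 : V -> R, borel h1 -> borel h2 ->
  (forall x, 0 <= h1 x)%R -> (forall x, 0 <= h2 x)%R ->
  \int[leb]_y (h1 y)%:E <= 1 -> \int[leb]_y (h2 y)%:E <= 1 ->
  forall r : R, (0 < r)%R ->
  leb [set x : Rn | (K * r `^ (n%:R / p))%:E <
    cross_op (riesz a) (fun y => h1 y `^ x1)%R (fun y => h2 y `^ x2)%R (x : V)] <=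
  C%:E * (\int[leb]_y (high x1 (h1 (y : V) / r ^+ n))%:E +
          \int[leb]_y (high x2 (h2 (y : V) / r ^+ n))%:E)].
Proof.
have alx : (al / n%:R < x1 + x2)%R by rewrite -px ltrDr invr_gt0.
have [K [C [K0 C0 KC]]] := level_set_unit_scale n0 al0 aln x10 x11 x20 x21 alx.
rewrite -/a in KC.
exists K, C; split => // h1 h2 bh1 bh2 h10 h20 ih1 ih2 r r0.
have rn0 : (0 < r ^+ n)%R by rewrite exprn_gt0.
pose H (h : V -> R) (y : V) := ((r ^+ n)^-1 * h (r^-1 *: y))%R.
have bH h : borel h -> borel (H h) by exact: borel_dilate.
have H0 h : (forall x, 0 <= h x)%R -> forall y, (0 <= H h y)%R.
  by move=> h0 y; rewrite mulr_ge0// invr_ge0 ltW.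
have iH h : borel h -> (forall x, 0 <= h x)%R -> \int[leb]_y (h (y : V))%:E <= 1 ->
    \int[leb]_y (H h (y : V))%:E <= 1.
  move=> bh h0 ih; rewrite integralZ_EFin; last first.
  - by move=> y; exact: h0.
  - apply: (measurable_borel bh); apply: row_measurableZ; exact: row_measurable_id.
  - by rewrite invr_ge0 ltW.
  by rewrite integral_dilate_EFin// muleA -EFinM mulVf ?mul1e// gt_eqF.
have := KC _ _ (bH _ bh1) (bH _ bh2) (H0 _ h10) (H0 _ h20) (iH _ bh1 h10 ih1) (iH _ bh2 h20 ih2).
have iHH h x : borel h -> (forall x, 0 <= h x)%R ->
  \int[leb]_y (high x (H h (y : V)))%:E =
  (r ^+ n)%:E * \int[leb]_y (high x (h (y : V) / r ^+ n))%:E.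
  move=> bh h0.
  rewrite -(integral_dilate_EFin (h := fun y => high x (h y / r ^+ n)%R) r0).
  - by apply: eq_integral => y _; rewrite /H mulrC.
  - apply: (measurableT_comp (measurable_high x)); apply: measurable_funM; first exact: bh.
    exact: measurable_cst.
  - by move=> y; exact: high_ge0.
rewrite !iHH// -ge0_muleDr; last 2 first.
  by apply: integral_ge0 => y _; rewrite lee_fin high_ge0.
  by apply: integral_ge0 => y _; rewrite lee_fin high_ge0.
pose f1 (y : V) := (h1 y `^ x1)%R. pose f2 (y : V) := (h2 y `^ x2)%R.
have bf1 : borel f1 by exact: (measurableT_comp (measurable_powR x1) bh1).
have bf2 : borel f2 by exact: (measurableT_comp (measurable_powR x2) bh2).
have f10 y : (0 <= f1 y)%R by exact: powR_ge0.
have f20 y : (0 <= f2 y)%R by exact: powR_ge0.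
have HE h x y : (forall z, 0 <= h z)%R ->
    (H h y `^ x = ((r ^+ n) `^ (- x)) * (h (r^-1 *: y) `^ x))%R.
  by move=> h0; rewrite /H powRM ?invr_ge0 ?(ltW rn0)// invr_powR ?(ltW rn0).
have TE x : cross_op (riesz a) (fun y => H h1 y `^ x1)%R (fun y => H h2 y `^ x2)%R x =
    (r `^ (- (n%:R / p)))%:E * cross_op (riesz a) f1 f2 (r^-1 *: x).
  rewrite (funext (fun y => HE h1 x1 y h10)) (funext (fun y => HE h2 x2 y h20)).
  pose g1 (y : V) := f1 (r^-1 *: y). pose g2 (y : V) := f2 (r^-1 *: y).
  have bg (f : V -> R) : borel f -> borel (fun y => f (r^-1 *: y)).
    move=> bf; have := borel_dilate r^-1 1 bf.
    by under eq_fun do rewrite mul1r.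
  rewrite (cross_opZ (borel_riesz a) (bg _ bf1) (bg _ bf2) (riesz_ge0 a)
    (fun y => f10 (r^-1 *: y)) (fun y => f20 (r^-1 *: y)) x (powR_ge0 _ (- x1)) (powR_ge0 _ (- x2))).
  rewrite (cross_op_dilate x r0 bf1 bf2 f10 f20) muleA -EFinM; congr (_%:E * _).
  rewrite -powR_mulrn ?(ltW r0)// -!powRrM -!powRD; try by rewrite (gt_eqF r0) implybT.
  congr (_ `^ _)%R; have nn : (n%:R != 0 :> R)%R by rewrite pnatr_eq0 -lt0n.
  have e : (n%:R * (x1 + x2) = n%:R / p + al)%R.
    by rewrite -px mulrDr mulrCA divff// mulr1.
  by rewrite !mulrN -opprD -mulrDr e opprD addrNK.
pose A := [set x : Rn | (K * r `^ (n%:R / p))%:E < cross_op (riesz a) f1 f2 (x : V)].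
have AE : [set x : Rn | K%:E < cross_op (riesz a) (fun y => H h1 y `^ x1)%R
    (fun y => H h2 y `^ x2)%R (x : V)] = [set x : Rn | A (r^-1 *: (x : V))%R].
  have rp0 : (0 < r `^ (n%:R / p))%R by exact: powR_gt0.
  apply/seteqP; split => x; rewrite /mkset TE powRN lte_pdivlMl//;
  by rewrite -EFinM mulrC.
have fin (X Y Z : \bar R) : X = (r ^+ n)%:E * Y ->
    X <= C%:E * ((r ^+ n)%:E * Z) -> Y <= C%:E * Z.
  by move=> ->; rewrite muleCA lee_pmul2l.
move=> hKC; exact: (fin _ _ _ (etrans (congr1 (fun B => leb B) AE) (leb_dilate A r0)) hKC).
Qed.

(** With b = 2^n, the layer cake bound for (F / K)^p along the powers of b involves
    the sets where F > K b^(j/p), which are the level sets at scale r = 2^j. *)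
Lemma cross_op_riesz_bounded : exists2 M : R, (0 <= M)%R &
  forall h1 h2 : V -> R, borel h1 -> borel h2 ->
  (forall x, 0 <= h1 x)%R -> (forall x, 0 <= h2 x)%R ->
  \int[leb]_y (h1 y)%:E <= 1 -> \int[leb]_y (h2 y)%:E <= 1 ->
  \int[leb]_x (cross_op (riesz a) (fun y => h1 y `^ x1)%R
    (fun y => h2 y `^ x2)%R (x : V)) `^ p <= M%:E.
Proof.
have [K [C [K0 C0 KC]]] := level_set_all_scales.
pose b : R := (2 ^+ n)%R.
have b2 : (2 <= b)%R.
  by rewrite /b -[leLHS]expr1 ler_weXn2l// ler1n.
have b0 : (0 < b)%R by exact: exprn_gt0.
have bj0 (j : int) : (0 < b ^ j)%R by exact: exprz_gt0.
have [c1 [c10 hc1]] := zseries_powers_le b2 x10 x11.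
have [c2 [c20 hc2]] := zseries_powers_le b2 x20 x21.
exists (K `^ p * b * (C * (c1 + c2)))%R.
  by rewrite !mulr_ge0 ?powR_ge0 ?addr_ge0// ltW.
move=> h1 h2 bh1 bh2 h10 h20 ih1 ih2.
have bf1 : borel (fun y => h1 y `^ x1)%R by exact: (measurableT_comp (measurable_powR x1) bh1).
have bf2 : borel (fun y => h2 y `^ x2)%R by exact: (measurableT_comp (measurable_powR x2) bh2).
have f10 y : (0 <= h1 y `^ x1)%R by exact: powR_ge0.
have f20 y : (0 <= h2 y `^ x2)%R by exact: powR_ge0.
pose F (x : Rn) := cross_op (riesz a) (fun y => h1 y `^ x1)%R (fun y => h2 y `^ x2)%R (x : V).
have mF : measurable_fun setT F.
  exact: (measurable_cross_op (borel_riesz a) bf1 bf2 (riesz_ge0 a) f10 f20).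
have F0 x : 0 <= F x.
  apply: integral_ge0 => y _; rewrite lee_fin; apply: mulr_ge0; last exact: riesz_ge0.
  exact: mulr_ge0.
have level (j : int) : leb [set x | (K * (b ^ j) `^ (p^-1))%:E < F x] <=
    C%:E * (\int[leb]_y (high x1 (h1 (y : V) / b ^ j))%:E +
            \int[leb]_y (high x2 (h2 (y : V) / b ^ j))%:E).
  have r0 : (0 < 2 ^ j :> R)%R by exact: exprz_gt0.
  have rE : ((2 ^ j) ^+ n = b ^ j :> R)%R by rewrite /b !exprnP exprzAC.
  have eK : ((2 ^ j) `^ (n%:R / p) = (b ^ j) `^ p^-1 :> R)%R.
    by rewrite powRrM powR_mulrn ?(ltW r0)// rE.
  by have := KC h1 h2 bh1 bh2 h10 h20 ih1 ih2 _ r0; rewrite rE eK; exact.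
change (\int[leb]_x (F x) `^ p <= (K `^ p * b * (C * (c1 + c2)))%:E).
clearbody F.
pose A (j : int) := [set x | (K * (b ^ j) `^ (p^-1))%:E < F x].
have mA j : measurable (A j).
  have := emeasurable_fun_o_infty measurableT mF (K * (b ^ j) `^ (p^-1))%:E.
  by rewrite setTI.
have Kp0 : (0 < K `^ p)%R by exact: powR_gt0.
have pt x : (F x) `^ p <= (K `^ p * b)%:E *
    zseries (fun j => (b ^ j * \1_(A j) x)%:E).
  have pn0 : (p != 0)%R by rewrite gt_eqF.
  rewrite EFinM -muleA; have := F0 x; case Fx : (F x) => [t| |]// t0.
    have -> : (t%:E) `^ p = (K `^ p)%:E * ((t / K) `^ p)%:E.
      by rewrite poweR_EFin -EFinM -powRM ?(ltW K0) ?divr_ge0 ?(ltW K0)// mulrCA divff ?mulr1// gt_eqF.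
    apply: lee_wpmul2l; first by rewrite lee_fin ltW.
    apply: le_trans (powers_layer_cake b2 (powR_ge0 _ _)) _.
    apply: lee_wpmul2l; first by rewrite lee_fin ltW.
    apply: le_zseries => j; rewrite lee_fin; first by rewrite mulr_ge0// ltW.
    rewrite ler_wpM2l ?(ltW (bj0 _))// indicE.
    have [h|h] := ltP (b ^ j)%R ((t / K) `^ p)%R; last by case: (_ \in _).
    suff -> : x \in A j by [].
    apply: mem_set; rewrite /A/= Fx lte_fin mulrC -ltr_pdivlMr//.
    have -> : (t / K = ((t / K) `^ p) `^ p^-1)%R.
      by rewrite -powRrM mulfV// powRr1// divr_ge0// ltW.
    by apply: gt0_ltr_powR; rewrite ?invr_gt0 ?nnegrE ?powR_ge0// ltW.
  rewrite (_ : zseries _ = +oo).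
    by rewrite !gt0_muley ?lte_fin ?leey.
  rewrite -(zseries_powers_pinfty b2); congr zseries; apply/funext => j.
  by rewrite indicE mem_set ?mulr1// /A/= Fx ltry.
apply: (@le_trans _ _ (\int[leb]_x ((K `^ p * b)%:E *
    zseries (fun j => (b ^ j * \1_(A j) x)%:E)))).
  by apply: le_integralT => x; [exact: poweR_ge0|exact: pt].
have mAj j : measurable_fun [set: Rn] (fun x : Rn => (b ^ j * \1_(A j) x)%:E : \bar R).
  apply/measurable_EFinP; apply: measurable_funM; first exact: measurable_cst.
  exact: measurable_indic.
have A0 j x : 0 <= (b ^ j * \1_(A j) x)%:E :> \bar R.
  by rewrite lee_fin mulr_ge0 ?indic_ge0// ltW.
rewrite ge0_integralZl; last first.
- by rewrite lee_fin mulr_ge0// ltW.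
- by move=> x _; apply: nneseries_ge0 => m _ _; apply: adde_ge0; exact: A0.
- exact: measurable_zseries.
- exact: measurableT.
rewrite integral_zseries; [|exact: mAj|exact: A0].
rewrite [leRHS]EFinM; apply: lee_wpmul2l; first by rewrite lee_fin mulr_ge0// ltW.
have iA j : \int[leb]_x (b ^ j * \1_(A j) x)%:E = (b ^ j)%:E * leb (A j).
  rewrite integralZ_EFin; last first.
  - by move=> x; exact: indic_ge0.
  - exact: measurable_indic.
  - exact: ltW.
  by rewrite integral_indic ?setIT.
have mhi x h (j : int) : borel h -> measurable_fun [set: Rn]
    (fun y : Rn => high x (h (y : V) / b ^ j)%R).
  move=> bh; apply: (measurableT_comp (measurable_high x)).
  by apply: measurable_funM; [exact: measurable_borel_id|exact: measurable_cst].
have piece h x c : borel h -> (forall y, 0 <= h y)%R ->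
    \int[leb]_y (h (y : V))%:E <= 1 -> (0 <= c)%R ->
    (forall t, (0 <= t)%R -> zseries (fun j => (b ^ j * high x (t / b ^ j))%:E) <= (c * t)%:E) ->
    zseries (fun j => (b ^ j)%:E * \int[leb]_y (high x (h (y : V) / b ^ j))%:E) <= c%:E.
  move=> bh h0 ih c0 hc.
  have -> : (fun j : int => (b ^ j)%:E * \int[leb]_y (high x (h (y : V) / b ^ j))%:E) =
     (fun j => \int[leb]_y (b ^ j * high x (h (y : V) / b ^ j))%:E).
    apply/funext => j; rewrite integralZ_EFin.
    - by [].
    - exact: ltW.
    - exact: mhi.
    - by move=> y; exact: high_ge0.
  rewrite -(integral_zseries leb (u := fun j (y : Rn) => (b ^ j * high x (h (y : V) / b ^ j))%:E)); last 2 first.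
  - move=> j; apply/measurable_EFinP; apply: measurable_funM; first exact: measurable_cst.
    exact: mhi.
  - by move=> j y; rewrite lee_fin mulr_ge0 ?high_ge0// ltW.
  apply: (@le_trans _ _ (\int[leb]_y (c * h (y : V))%:E)).
    apply: le_integralT => y; last exact: hc.
    apply: nneseries_ge0 => m _ _; apply: adde_ge0; rewrite lee_fin mulr_ge0 ?high_ge0// ltW//.
  rewrite integralZ_EFin; [|exact: c0|exact: measurable_borel_id|by move=> y; exact: h0].
  by rewrite -[leRHS]mule1; apply: lee_wpmul2l; [rewrite lee_fin|exact: ih].
have hi0 x h (j : int) : 0 <= \int[leb]_y (high x (h (y : V) / b ^ j))%:E.
  by apply: integral_ge0 => y _; rewrite lee_fin high_ge0.
have bh0 x h (j : int) : 0 <= (b ^ j)%:E * \int[leb]_y (high x (h (y : V) / b ^ j))%:E.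
  by apply: mule_ge0; [rewrite lee_fin ltW|exact: hi0].
apply: (@le_trans _ _ (zseries (fun j => C%:E *
  ((b ^ j)%:E * \int[leb]_y (high x1 (h1 (y : V) / b ^ j))%:E +
   (b ^ j)%:E * \int[leb]_y (high x2 (h2 (y : V) / b ^ j))%:E)))).
  apply: le_zseries => j; first by apply: integral_ge0 => x _; exact: A0.
  rewrite iA -ge0_muleDr; [|exact: hi0|exact: hi0].
  by rewrite muleCA; apply: lee_wpmul2l; [rewrite lee_fin ltW|exact: level].
rewrite zseriesZl; [|exact: C0|by move=> j; apply: adde_ge0; exact: bh0].
rewrite [leRHS]EFinM; apply: lee_wpmul2l; first by rewrite lee_fin.
rewrite zseriesD; [|by move=> j; exact: bh0|by move=> j; exact: bh0].
by rewrite EFinD; apply: leeD; exact: piece.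
Qed.

End level_set_all_scales.

(** * Radially decreasing weak L^r functions *)

Lemma le_poweR (R : realType) (r : R) (x y : \bar R) :
  0 <= r -> (0 <= x)%E -> (x <= y)%E -> (x `^ r <= y `^ r)%E.
Proof.
move=> r0 x0 xy; apply: gt0_ler_poweR => //; rewrite in_itv/= leey andbT//.
exact: le_trans xy.
Qed.

Section radial.
Context (R : realType) (n : nat).
Local Notation V := 'rV[R]_n.
Local Notation Rn := (Rn R n).
Local Notation leb := (@leb R n).
Hypothesis n0 : (0 < n)%N.

Lemma row_norm_le_eucl (y : V) : `|y| <= eucl_norm y.
Proof.
apply/row_norm_le; first exact: sqrtr_ge0.
move=> i; rewrite -sqrtr_sqr ler_wsqrtr// (bigD1 i)//= lerDl.
by apply: sumr_ge0 => j _; exact: sqr_ge0.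
Qed.

Lemma cube_eucl_le (z : V) (s : R) : 0 <= s -> cube (s / n%:R) z -> eucl_norm z <= s.
Proof.
move=> s0 cz; have nr1 : 1 <= n%:R :> R by rewrite ler1n.
have nr0 : 0 < n%:R :> R by rewrite ltr0n.
rewrite /eucl_norm -[leRHS](ger0_norm s0) -sqrtr_sqr ler_wsqrtr//.
apply: (@le_trans _ _ (\sum_(i < n) (s / n%:R) ^+ 2)).
  apply: ler_sum => i _; rewrite -[leLHS]real_normK ?num_real//.
  by rewrite lerXn2r ?nnegrE ?divr_ge0 ?(ltW nr0)// ltW.
rewrite sumr_const card_ord.
have -> : (s / n%:R) ^+ 2 *+ n = s ^+ 2 / n%:R.
  by rewrite -mulr_natr; field; rewrite gt_eqF.
by rewrite ler_piMr ?sqr_ge0// invf_le1.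
Qed.

Lemma outer_measure0_negligible (N : set Rn) :
  leb N = 0%E -> leb.-negligible N.
Proof.
move=> N0; have [B mB [NB B0]] := borel_null_hull N0.
by exists (tuple_of_row (n := n) @^-1` B); split => //; exact: measurable_tuple_preimage.
Qed.

(** The origin is fixed by dilations and has finite measure. *)
Lemma leb_set0_origin : leb [set 0 : V] = 0%E.
Proof.
have E0 : [set x : Rn | [set (0 : V)] (2 *: (x : V) + 0)] = [set (0 : V)].
  apply/seteqP; split => x /=; rewrite addr0.
    by move/eqP; rewrite scaler_eq0 pnatr_eq0/= => /eqP.
  by move=> ->; rewrite scaler0.
have h2 : 2 != 0 :> R by rewrite pnatr_eq0.
have := leb_affine 0 [set (0 : V) : Rn] h2.
rewrite E0 gtr0_norm; last exact: ltr0n.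
have fin : leb [set 0 : V] \is a fin_num.
  rewrite ge0_fin_numE//; apply: (@le_lt_trans _ _ (leb (cube 1))).
    by apply: le_lebesgue_outer => x /= -> i; rewrite mxE normr0.
  by rewrite leb_cube// ltry.
rewrite -(fineK fin) -EFinM => -[] /eqP.
rewrite -subr_eq0 -[X in X - _]mul1r -mulrBl mulf_eq0 => /orP[|/eqP -> //].
rewrite subr_eq0 eq_sym lt_eqF// invf_lt1 ?exprn_gt0// exprn_egt1//.
  by rewrite -lt0n.
by rewrite (ltr_nat R 1 2).
Qed.

Lemma norm_weakLr_ge0 r (g : V -> R) : (0 <= norm_weakLr r g)%E.
Proof.
apply: le_trans (ereal_sup_ubound (x := (1%:E * (leb [set y : Rn | (1 < `|g y|)%R]) `^ r^-1)%E) _).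
  by rewrite mul1e poweR_ge0.
by exists 1 => //=.
Qed.

(** If l < psi s, then g > l on the ball of radius s, up to a null set and the
    origin, and this ball contains the cube of half-side s / n, of volume
    (2 s / n)^n. The weak bound gives l <= w (2 s / n)^(-n/r), and l is arbitrary
    below psi s. The constant is (2 / n)^(-n/r), and the sup norm is at most the
    Euclidean one. *)
Lemma radially_decreasing_le_riesz (r al : R) (g : V -> R) : 1 < r ->
  al = n%:R * (1 - r^-1) -> (forall y, 0 <= g y) ->
  radially_decreasing g -> in_weakLr r g ->
  {ae leb, forall y : Rn, g (y : V) <=
     (n%:R / 2) `^ (n%:R / r) * fine (norm_weakLr r g) * riesz (n%:R - al) (y : V)}.
Proof.
move=> r1 alE g0 [psi [psi0 psi_dec gpsi]] [mg Woo].
have r0 : 0 < r by exact: lt_trans r1.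
have nr0 : 0 < n%:R :> R by rewrite ltr0n.
set w := fine _.
have W0 := norm_weakLr_ge0 r g.
have Wfin : norm_weakLr r g \is a fin_num by rewrite ge0_fin_numE.
have w0 : 0 <= w by exact: fine_ge0.
have aE : n%:R - al = n%:R / r by rewrite alE; ring.
have [Z [mZ Z0 gZ]] := gpsi.
have level s l : 0 < s -> 0 < l -> l < psi s ->
    l <= w * ((2 * (s / n%:R)) ^+ n) `^ (- r^-1).
  move=> s0 l0 lpsi; have c0 : 0 < (2 * (s / n%:R)) ^+ n.
    by rewrite exprn_gt0// mulr_gt0// divr_gt0.
  have vol : (((2 * (s / n%:R)) ^+ n)%:E <= leb [set y : Rn | (l < `|g y|)%R])%E.
    rewrite -(@leb_cube R n (s / n%:R)); last by rewrite divr_ge0// ltW.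
    apply: (@le_trans _ _ (@lebesgue_outer R n ([set y : Rn | (l < `|g y|)%R] `|` (Z `|` [set (0 : V)])))).
      apply: le_lebesgue_outer => z cz /=.
      have [->|zn0] := eqVneq z 0; first by right; right.
      have [Zz|nZz] := pselect (Z z); first by right; left.
      left; have gz : g z = psi (eucl_norm z).
        by apply: contrapT => h; apply: nZz; apply: gZ.
      have ez0 : 0 < eucl_norm z.
        by apply: lt_le_trans (row_norm_le_eucl z); rewrite normr_gt0.
      rewrite gz ger0_norm; last exact: psi0.
      by apply: (lt_le_trans lpsi); apply: psi_dec => //; apply: cube_eucl_le => //; exact: ltW.
    apply: le_trans (outer_measureU2 (@lebesgue_outer R n) _ _) _ => /=.
    rewrite -[leRHS]adde0; apply: leeD => //.
    apply: le_trans (outer_measureU2 (@lebesgue_outer R n) _ _) _ => /=.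
    rewrite [X in (_ + X)%E](leb_set0_origin) [X in (X + _)%E]Z0 adde0//.
  have : (l%:E * (leb [set y : Rn | (l < `|g y|)%R]) `^ r^-1 <= norm_weakLr r g)%E.
    by apply: ereal_sup_ubound; exists l.
  move=> h; have {h} : (l%:E * ((((2 * (s / n%:R)) ^+ n)%:E) `^ r^-1) <= norm_weakLr r g)%E.
    apply: le_trans h; apply: lee_wpmul2l; first by rewrite lee_fin ltW.
    by apply: le_poweR; rewrite ?invr_ge0 ?lee_fin ?(ltW r0) ?(ltW c0).
  rewrite -(fineK Wfin) poweR_EFin -EFinM lee_fin -/w powRN => h.
  by rewrite ler_pdivlMr// powR_gt0.
have decay s : 0 < s -> psi s <= w * ((2 * (s / n%:R)) ^+ n) `^ (- r^-1).
  move=> s0; rewrite leNgt; apply/negP => lt.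
  set B := w * _ in lt *; have B0 : 0 <= B by rewrite mulr_ge0// powR_ge0.
  have := level s ((B + psi s) / 2) s0; rewrite -/B.
  have h1 : 0 < (B + psi s) / 2 by lra.
  have h2 : (B + psi s) / 2 < psi s by lra.
  move=> /(_ h1 h2); lra.
apply: (@negligibleS _ _ _ leb (Z `|` [set (0 : V)] : set Rn)); last first.
  apply: negligibleU; first by exists Z; split.
  by apply: outer_measure0_negligible; exact: leb_set0_origin.
move=> y /= ng; have [->|yn0] := eqVneq y 0; first by right.
left; apply: gZ => /= gy; apply: ng.
have ny0 : 0 < `|y| by rewrite normr_gt0.
have ney := row_norm_le_eucl y.
have ey0 : 0 < eucl_norm y by exact: lt_le_trans ney.
have c0 : 0 < 2 / n%:R :> R by rewrite divr_gt0.
rewrite gy; apply: (le_trans (decay _ ey0)).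
rewrite [leRHS](_ : _ = w * ((n%:R / 2) `^ (n%:R / r) * riesz (n%:R - al) y)); last by ring.
rewrite ler_wpM2l//.
have -> : 2 * (eucl_norm y / n%:R) = (2 / n%:R) * eucl_norm y by ring.
rewrite -powR_mulrn ?mulr_ge0 ?(ltW c0) ?(ltW ey0)// -powRrM mulrN.
rewrite powRM ?(ltW c0) ?(ltW ey0)//; apply: ler_pM; rewrite ?powR_ge0//.
  by rewrite -invr_powR ?(ltW c0)// invf_div.
rewrite /riesz aE !powRN lef_pV2 ?posrE ?powR_gt0//.
apply: ge0_ler_powR => //; rewrite ?nnegrE ?divr_ge0// ltW//.
Qed.

End radial.

Section pentagon.
Context (R : realType) (n : nat).

(** The pentagon lies in the unit square, so its interior lies in the open square. *)
Lemma Palpha_bounds (al u v : R) : (0 < n)%N -> 0 < al -> al < n%:R ->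
  Palpha n al (u, v) -> [/\ 0 < u, u < 1, 0 < v & v < 1].
Proof.
move=> n0 al0 aln.
pose Q : set (R^o * R^o) := [set z | [/\ 0 <= z.1, z.1 <= 1, 0 <= z.2 & z.2 <= 1]].
have PQ : pentagon n al `<=` Q.
  have nr0 : 0 < n%:R :> R by rewrite ltr0n.
  have q0 : 0 <= al / n%:R by rewrite divr_ge0// ltW.
  have q1 : al / n%:R <= 1 by rewrite ler_pdivrMr// mul1r ltW.
  apply: smallest_sub; last first.
    move=> z /=; rewrite !inE => /orP[|/orP[|/orP[|/orP[]]]] /eqP -> /=;
    by split; rewrite ?lexx ?ler01.
  move=> x y t; rewrite !inE => -[a1 a2 a3 a4] [b1 b2 b3 b4].
  have t0 : 0 <= t%:num by [].
  have t1 : t%:num <= 1 by [].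
  have s0 : 0 <= 1 - t%:num by rewrite subr_ge0.
  have E1 : (conv t x y).1 = t%:num * x.1 + (1 - t%:num) * y.1 by [].
  have E2 : (conv t x y).2 = t%:num * x.2 + (1 - t%:num) * y.2 by [].
  have conv_le1 (c d : R) : c <= 1 -> d <= 1 -> t%:num * c + (1 - t%:num) * d <= 1.
    by move=> c1 d1; nra.
  split; rewrite ?E1 ?E2.
  - by rewrite addr_ge0// mulr_ge0.
  - exact: conv_le1.
  - by rewrite addr_ge0// mulr_ge0.
  - exact: conv_le1.
move=> /nbhs_ballP[e /= e0 he].
have e2 : 0 < e / 2 by rewrite divr_gt0.
have ee : e / 2 < e by rewrite ltr_pdivrMr// mulr_natr mulr2n ltrDl.
have inb u' v' : `|u - u'| < e -> `|v - v'| < e -> Q (u', v').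
  by move=> hu hv; exact: (PQ _ (he (u', v') (conj hu hv))).
have uu : `|u - u| < e by rewrite subrr normr0.
have vv : `|v - v| < e by rewrite subrr normr0.
have h1 (z : R) : `|z - (z - e / 2)| < e by rewrite opprB subrKC gtr0_norm.
have h2 (z : R) : `|z - (z + e / 2)| < e by rewrite opprD addNKr normrN gtr0_norm.
have [/= ? _ _ _] := inb _ _ (h1 u) vv.
have [/= _ ? _ _] := inb _ _ (h2 u) vv.
have [/= _ _ ? _] := inb _ _ uu (h1 v).
have [/= _ _ _ ?] := inb _ _ uu (h2 v).
by split; lra.
Qed.

End pentagon.

(** * Reduction to nonnegative Borel functions *)

Section reduction.
Context (R : realType) (n : nat).
Local Notation V := 'rV[R]_n.
Local Notation Rn := (Rn R n).
Local Notation leb := (@leb R n).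

Lemma ae_affine (a : R) (b : V) (P : V -> Prop) : a != 0 ->
  {ae leb, forall y : Rn, P y} -> {ae leb, forall y : Rn, P (a *: (y : V) + b)}.
Proof.
move=> a0 [Z [mZ Z0 PZ]]; exists [set y : Rn | Z (a *: (y : V) + b)]; split.
- exact: caratheodory_affine.
- by rewrite leb_affine// Z0 mule0.
- by move=> y /= nP; apply: PZ.
Qed.

Lemma ae_shift (x : V) (P : V -> Prop) :
  {ae leb, forall y : Rn, P y} -> {ae leb, forall y : Rn, P (x + (y : V))}.
Proof.
move=> /(ae_affine x (oner_neq0 R)); apply: filterS => y.
by rewrite scale1r addrC.
Qed.

Lemma ae_reflect (x : V) (P : V -> Prop) :
  {ae leb, forall y : Rn, P y} -> {ae leb, forall y : Rn, P (x - (y : V))}.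
Proof.
have N1 : -1 != 0 :> R by rewrite oppr_eq0 oner_neq0.
move=> /(ae_affine x N1); apply: filterS => y.
by rewrite scaleN1r addrC.
Qed.

Lemma cmeasurable_affine (f : V -> R[i]) (a : R) (b : V) : a != 0 ->
  cmeasurable f -> cmeasurable (fun y => f (a *: y + b)).
Proof.
move=> a0 [mre mim]; have h := measurable_affine_Rn b a0; split.
- exact: (measurableT_comp mre h).
- exact: (measurableT_comp mim h).
Qed.

Lemma cmeasurable_shift (f : V -> R[i]) x :
  cmeasurable f -> cmeasurable (fun y => f (x + y)).
Proof.
move=> /(cmeasurable_affine x (oner_neq0 R)).
by under eq_fun do rewrite scale1r addrC.
Qed.

Lemma cmeasurable_reflect (f : V -> R[i]) x :
  cmeasurable f -> cmeasurable (fun y => f (x - y)).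
Proof.
have N1 : -1 != 0 :> R by rewrite oppr_eq0 oner_neq0.
move=> /(cmeasurable_affine x N1).
by under eq_fun do rewrite scaleN1r addrC.
Qed.

Lemma cmeasurableM (f g : V -> R[i]) :
  cmeasurable f -> cmeasurable g -> cmeasurable (fun y => f y * g y).
Proof.
move=> [mf mf'] [mg mg']; split.
  have := measurable_funB (measurable_funM mf mg) (measurable_funM mf' mg').
  by apply: eq_measurable_fun => y _ /=; case: (f y) => ? ?; case: (g y).
have := measurable_funD (measurable_funM mf mg') (measurable_funM mf' mg).
by apply: eq_measurable_fun => y _ /=; case: (f y) => ? ?; case: (g y).
Qed.

Lemma cmeasurable_T_integrand (g : V -> R) (f1 f2 : V -> R[i]) x :
  measurable_fun [set: Rn] (g : Rn -> R) -> cmeasurable f1 -> cmeasurable f2 ->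
  cmeasurable (T_integrand g f1 f2 x).
Proof.
move=> mg m1 m2; apply: cmeasurableM; first apply: cmeasurableM.
- exact: cmeasurable_shift.
- exact: cmeasurable_reflect.
- by split; [exact: mg|exact: measurable_cst].
Qed.

Lemma measurable_normc (f : V -> R[i]) : cmeasurable f ->
  measurable_fun [set: Rn] (fun y : Rn => Normc.normc (f (y : V))).
Proof.
move=> [mre mim].
have m2 := measurable_funD (measurable_funM mre mre) (measurable_funM mim mim).
have := measurableT_comp (measurable_powR 2^-1) m2.
apply: eq_measurable_fun => y _ /=; case: (f y) => u v /=.
by rewrite powR12_sqrt ?addr_ge0 -?expr2 ?sqr_ge0.
Qed.

Lemma normc_ge0 (z : R[i]) : 0 <= Normc.normc z.
Proof. by case: z => u v /=; exact: sqrtr_ge0. Qed.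

Lemma abs_Re_le_normc (z : R[i]) : `|complex.Re z| <= Normc.normc z.
Proof. by case: z => u v /=; rewrite -sqrtr_sqr ler_wsqrtr// lerDl sqr_ge0. Qed.

Lemma abs_Im_le_normc (z : R[i]) : `|complex.Im z| <= Normc.normc z.
Proof. by case: z => u v /=; rewrite -sqrtr_sqr ler_wsqrtr// lerDr sqr_ge0. Qed.

Lemma normc_le_add (u v : R) : Normc.normc (Complex u v) <= `|u| + `|v|.
Proof.
rewrite /= -[leRHS]ger0_norm ?addr_ge0// -sqrtr_sqr ler_wsqrtr//.
rewrite sqrrD !real_normK ?num_real// -addrA [X in _ <= _ + X]addrC addrA lerDl.
by rewrite mulrn_wge0// mulr_ge0.
Qed.

Lemma normc_T_integrand (g : V -> R) (f1 f2 : V -> R[i]) x y : 0 <= g y ->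
  Normc.normc (T_integrand g f1 f2 x y) =
  Normc.normc (f1 (x + y)) * Normc.normc (f2 (x - y)) * g y.
Proof.
move=> gy; rewrite /T_integrand !Normc.normcM; congr (_ * _).
by rewrite /= expr0n addr0 sqrtr_sqr ger0_norm.
Qed.

Local Open Scope ereal_scope.

(** The factor 2 comes from bounding the modulus by the sum of the absolute values
    of the real and imaginary parts. *)
Lemma cmod_cintegral_le (f : V -> R[i]) : cmeasurable f ->
  (Normc.normc (cintegral f))%:E <= 2%:E * \int[leb]_y cmod f y.
Proof.
move=> [mre mim].
have part (h : Rn -> R) : measurable_fun [set: Rn] h ->
    (forall y : Rn, `|h y| <= Normc.normc (f (y : V)))%R ->
    (`|\int[leb]_(y in [set: Rn]) h y|)%R%:E <= \int[leb]_y cmod f y.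
  move=> mh hf; rewrite /Rintegral.
  apply: (@le_trans _ _ (`|\int[leb]_y (h y)%:E|)).
    by case: (\int[leb]_y (h y)%:E) => [t| |] //=; rewrite ?leey// normr0 lee_fin.
  have mh' : measurable_fun [set: Rn] (EFin \o h) by exact/measurable_EFinP.
  apply: le_trans (le_abse_integral leb measurableT mh') _.
  by apply: le_integralT => y //=; rewrite lee_fin.
rewrite mulr2n EFinD ge0_muleDl ?lee_fin ?ler01// !mul1e.
apply: le_trans (leeD (part _ mre _) (part _ mim _)).
- by rewrite -EFinD lee_fin normc_le_add.
- by move=> y; exact: abs_Re_le_normc.
- by move=> y; exact: abs_Im_le_normc.
Qed.

(** For every x the integrands compare for almost every y, since translations and
    reflections preserve null sets; hence the inequality at every x. *)
Lemma integral_cmod_T_le (g : V -> R) (f1 f2 : V -> R[i]) (F1 F2 : V -> R) (a c : R) x :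
  (forall y, 0 <= g y)%R -> (0 <= c)%R ->
  measurable_fun [set: Rn] (g : Rn -> R) -> cmeasurable f1 -> cmeasurable f2 ->
  borel F1 -> borel F2 -> (forall y, 0 <= F1 y)%R -> (forall y, 0 <= F2 y)%R ->
  {ae leb, forall y : Rn, Normc.normc (f1 (y : V)) = F1 (y : V)} ->
  {ae leb, forall y : Rn, Normc.normc (f2 (y : V)) = F2 (y : V)} ->
  {ae leb, forall y : Rn, (g (y : V) <= c * riesz a (y : V))%R} ->
  \int[leb]_y cmod (T_integrand g f1 f2 x) y <= c%:E * cross_op (riesz a) F1 F2 x.
Proof.
move=> g0 c0 mg m1 m2 b1 b2 F10 F20 ae1 ae2 aeg.
have mF : measurable_fun [set: Rn] (fun y : Rn =>
    F1 (x + (y : V)) * F2 (x - (y : V)) * riesz a (y : V))%R.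
  apply: measurable_funM; first exact: measurable_cross_arg.
  exact: (measurable_borel_id (borel_riesz a)).
have F0 (y : Rn) : (0 <= F1 (x + (y : V)) * F2 (x - (y : V)) * riesz a (y : V))%R.
  by apply: mulr_ge0; [exact: mulr_ge0|exact: riesz_ge0].
rewrite /cross_op -integralZ_EFin; [|exact: c0|exact: mF|exact: F0].
apply: ae_ge0_le_integral.
- exact: measurableT.
- by move=> y _; rewrite /cmod lee_fin normc_ge0.
- apply/measurable_EFinP; apply: measurable_normc.
  exact: cmeasurable_T_integrand.
- by move=> y _; rewrite lee_fin mulr_ge0.
- by apply/measurable_EFinP; apply: measurable_funM; [exact: measurable_cst|exact: mF].
have h1 := ae_shift x ae1. have h2 := ae_reflect x ae2.
apply: filterS3 h1 h2 aeg => y e1 e2 eg _.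
rewrite /cmod lee_fin normc_T_integrand// e1 e2 mulrCA.
by apply: ler_wpM2l => //; exact: mulr_ge0.
Qed.

End reduction.

(** * The bilinear estimate *)

Section bilinear_estimate.
Context (R : realType) (n : nat).
Local Notation V := 'rV[R]_n.
Local Notation Rn := (Rn R n).
Local Notation leb := (@leb R n).
Local Open Scope ereal_scope.

(** By homogeneity, the bound for functions of unit mass gives the L^p bound. *)
Lemma cross_op_riesz_homogeneous (al x1 x2 p : R) :
  (0 < n)%N -> (0 < al)%R -> (al < n%:R)%R -> (0 < x1)%R -> (x1 < 1)%R ->
  (0 < x2)%R -> (x2 < 1)%R -> (0 < p)%R -> (p^-1 + al / n%:R = x1 + x2)%R ->
  exists2 M : R, (0 <= M)%R & forall (F1 F2 : V -> R) (c1 c2 : R),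
  borel F1 -> borel F2 -> (forall y, 0 <= F1 y)%R -> (forall y, 0 <= F2 y)%R ->
  (0 < c1)%R -> (0 < c2)%R ->
  \int[leb]_y (F1 (y : V) `^ x1^-1)%:E <= (c1 `^ x1^-1)%:E ->
  \int[leb]_y (F2 (y : V) `^ x2^-1)%:E <= (c2 `^ x2^-1)%:E ->
  \int[leb]_x (cross_op (riesz (n%:R - al)) F1 F2 (x : V)) `^ p <=
    ((c1 * c2) `^ p * M)%:E.
Proof.
move=> n0 al0 aln x10 x11 x20 x21 p0 px.
have [M M0 hM] := cross_op_riesz_bounded n0 al0 aln x10 x11 x20 x21 p0 px.
exists M => // F1 F2 c1 c2 b1 b2 F10 F20 c10 c20 i1 i2.
pose h (F : V -> R) (c x : R) (y : V) : R := ((c^-1 * F y) `^ x^-1)%R.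
have hb F c x : borel F -> borel (h F c x).
  move=> bF; apply: (measurableT_comp (measurable_powR x^-1)).
  by apply: measurable_funM; [exact: measurable_cst|exact: bF].
have h0 F c x y : (0 <= h F c x y)%R by exact: powR_ge0.
have hi F c x : borel F -> (forall y, 0 <= F y)%R -> (0 < c)%R ->
    \int[leb]_y (F (y : V) `^ x^-1)%:E <= (c `^ x^-1)%:E ->
    \int[leb]_y (h F c x (y : V))%:E <= 1.
  move=> bF F0 c0 iF; have cx0 : (0 < c `^ x^-1)%R by exact: powR_gt0.
  have mF : measurable_fun [set: Rn] (fun y : Rn => (F (y : V) `^ x^-1)%R).
    by apply: (measurableT_comp (measurable_powR x^-1)); exact: measurable_borel_id.
  under eq_integral => y _ do
    rewrite /h powRM ?invr_ge0 ?(ltW c0) ?F0// invr_powR ?(ltW c0)// powRN.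
  rewrite integralZ_EFin; [|by rewrite invr_ge0 ltW|exact: mF|by move=> y; exact: powR_ge0].
  by rewrite lee_pdivrMl// mule1.
have hE F c x y : (0 <= F y)%R -> (0 < c)%R -> (0 < x)%R -> (F y = c * (h F c x y `^ x))%R.
  move=> F0 c0 x0; rewrite /h -powRrM mulVf ?gt_eqF// powRr1 ?mulr_ge0 ?invr_ge0 ?(ltW c0)//.
  by rewrite mulrA divff ?mul1r// gt_eqF.
have hpb F c x : borel F -> borel (fun y => h F c x y `^ x)%R.
  by move=> bF; exact: (measurableT_comp (measurable_powR x) (hb F c x bF)).
pose S (x : Rn) := cross_op (riesz (n%:R - al)) (fun y => h F1 c1 x1 y `^ x1)%R
  (fun y => h F2 c2 x2 y `^ x2)%R (x : V).
have S0 x : 0 <= S x.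
  apply: integral_ge0 => y _; rewrite lee_fin; apply: mulr_ge0; last exact: riesz_ge0.
  by apply: mulr_ge0; exact: powR_ge0.
have mS : measurable_fun [set: Rn] S.
  exact: (measurable_cross_op (borel_riesz _) (hpb F1 c1 x1 b1) (hpb F2 c2 x2 b2)
    (riesz_ge0 _) (fun y => powR_ge0 _ _) (fun y => powR_ge0 _ _)).
have SE x : cross_op (riesz (n%:R - al)) F1 F2 x = (c1 * c2)%:E * S x.
  rewrite -(cross_opZ (borel_riesz _) (hpb F1 c1 x1 b1) (hpb F2 c2 x2 b2)
    (riesz_ge0 _) (fun y => powR_ge0 _ _) (fun y => powR_ge0 _ _) x (ltW c10) (ltW c20)).
  congr (cross_op _ _ _ _); apply/funext => y.
  - exact: (hE F1 c1 x1 y (F10 y) c10 x10).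
  - exact: (hE F2 c2 x2 y (F20 y) c20 x20).
have SM : \int[leb]_x (S x) `^ p <= M%:E.
  exact: (hM _ _ (hb F1 c1 x1 b1) (hb F2 c2 x2 b2) (h0 F1 c1 x1) (h0 F2 c2 x2)
    (hi F1 c1 x1 b1 F10 c10 i1) (hi F2 c2 x2 b2 F20 c20 i2)).
clearbody S.
have cc0 : (0 <= c1 * c2)%R by rewrite mulr_ge0// ltW.
under eq_integral => x _ do rewrite SE poweRM ?S0 ?lee_fin// poweR_EFin.
rewrite ge0_integralZl; last first.
- by rewrite lee_fin powR_ge0.
- by move=> x _; exact: poweR_ge0.
- exact: (measurableT_comp (measurable_poweR p) mS).
- exact: measurableT.
by rewrite [leRHS]EFinM; apply: lee_wpmul2l; [rewrite lee_fin powR_ge0|exact: SM].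
Qed.

(** Lets functions be normalised by N_i + e > 0 in place of their norms N_i, which
    may vanish. *)
Lemma le_mul_of_gt0_shifts (t A N1 N2 : R) :
  (0 <= A)%R -> (0 <= N1)%R -> (0 <= N2)%R ->
  (forall e, 0 < e -> t <= A * ((N1 + e) * (N2 + e)))%R ->
  (t <= A * (N1 * N2))%R.
Proof.
move=> A0 N10 N20 h; apply/ler_addgt0Pr => d d0.
pose B : R := (A * (N1 + N2 + 1) + 1)%R.
have B0 : (0 < B)%R by rewrite ltr_wpDl// mulr_ge0// !addr_ge0.
pose e := Num.min 1%R (d / B)%R.
have e0 : (0 < e)%R by rewrite lt_min ltr01 divr_gt0.
have e1 : (e <= 1)%R by rewrite ge_min lexx.
have ed : (e * B <= d)%R by rewrite -ler_pdivlMr// ge_min lexx orbT.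
apply: (le_trans (h _ e0)); apply: (@le_trans _ _ (A * (N1 * N2) + e * B)%R); last by rewrite lerD2l.
have -> : (A * ((N1 + e) * (N2 + e)) = A * (N1 * N2) + e * (A * (N1 + N2 + e)))%R by ring.
rewrite lerD2l ler_wpM2l ?(ltW e0)// /B.
by apply: ler_wpDr => //; apply: ler_wpM2l => //; rewrite lerD2l.
Qed.

Lemma integral_powR_le_normLp (f : V -> R[i]) (F : V -> R) (p : R) :
  (0 < p)%R -> cmeasurable f -> borel F -> (forall y, 0 <= F y)%R ->
  {ae leb, forall y : Rn, Normc.normc (f (y : V)) = F (y : V)} ->
  \int[leb]_y (F (y : V) `^ p)%:E <= normLp p f `^ p.
Proof.
move=> p0 mf bF F0 fF; rewrite /normLp poweR_Lnorm; last by rewrite gt_eqF.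
have mn := measurable_normc mf.
have mn1 : measurable_fun [set: Rn] (fun y : Rn => (`|Normc.normc (f (y : V))| `^ p)%R).
  apply: (measurableT_comp (measurable_powR p)).
  exact: (measurableT_comp (@normr_measurable R setT) mn).
have mF : measurable_fun [set: Rn] (fun y : Rn => (F (y : V) `^ p)%R).
  by apply: (measurableT_comp (measurable_powR p)); exact: measurable_borel_id.
have -> : \int[leb]_x `|cmod f x| `^ p =
    \int[leb]_x (`|Normc.normc (f (x : V))| `^ p)%:E by [].
apply: ae_ge0_le_integral.
- exact: measurableT.
- by move=> y _; rewrite lee_fin powR_ge0.
- exact/measurable_EFinP.
- by move=> y _; rewrite lee_fin powR_ge0.
- exact/measurable_EFinP.
apply: filterS fF => y e _; rewrite e ger0_norm; last exact: F0.
exact: lexx.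
Qed.

End bilinear_estimate.

Theorem proposition7p4 (R : realType) (n : nat) (r p1 p2 p alpha : R) :
  (0 < n)%N ->
  1 < r ->
  alpha = n%:R * (1 - r^-1) ->
  Palpha n alpha (p1^-1, p2^-1) ->
  0 < p ->
  p^-1 + alpha / n%:R = p1^-1 + p2^-1 ->
  exists C : R, 0 < C /\
    forall g : 'rV[R]_n -> R,
      (forall y, 0 <= g y) ->
      radially_decreasing g ->
      in_weakLr r g ->
      forall f1 f2 : 'rV[R]_n -> R[i],
        inLp p1 f1 -> inLp p2 f2 ->
        {ae @leb R n, forall x : Rn R n, T_defined g f1 f2 x} /\
        (normLp p (T_op g f1 f2)
           <= C%:E * normLp p1 f1 * normLp p2 f2 * norm_weakLr r g)%E.
Proof.
move=> n0 r1 alE hP p0 pE.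
have r0 : 0 < r by exact: lt_trans r1.
have nr0 : 0 < n%:R :> R by rewrite ltr0n.
have ri0 : 0 < r^-1 by rewrite invr_gt0.
have ri1 : r^-1 < 1 by rewrite invf_lt1.
have al0 : 0 < alpha by rewrite alE mulr_gt0// subr_gt0.
have aln : alpha < n%:R by rewrite alE gtr_pMr// gtrBl.
have [x10 x11 x20 x21] := Palpha_bounds n0 al0 aln hP.
have p10 : 0 < p1 by rewrite -invr_gt0.
have p20 : 0 < p2 by rewrite -invr_gt0.
have [M M0 hM] := cross_op_riesz_homogeneous n0 al0 aln x10 x11 x20 x21 p0 pE.
pose D : R := (n%:R / 2) `^ (n%:R / r).
have D0 : 0 <= D by exact: powR_ge0.
have M'0 : 0 <= M `^ p^-1 by exact: powR_ge0.
exists (2 * D * M `^ p^-1 + 1); split; first by rewrite ltr_wpDl// !mulr_ge0.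
move=> g g0 rdg wg f1 f2 [m1 N1oo] [m2 N2oo].
have Wfin : norm_weakLr r g \is a fin_num by rewrite ge0_fin_numE ?norm_weakLr_ge0//; case: wg.
have N1fin : normLp p1 f1 \is a fin_num by rewrite ge0_fin_numE// Lnorm_ge0.
have N2fin : normLp p2 f2 \is a fin_num by rewrite ge0_fin_numE// Lnorm_ge0.
have aeg := radially_decreasing_le_riesz n0 r1 alE g0 rdg wg.
have mg := wg.1.
set w := fine (norm_weakLr r g) in aeg.
have w0 : 0 <= w by apply: fine_ge0; exact: norm_weakLr_ge0.
pose N1 := fine (normLp p1 f1). pose N2 := fine (normLp p2 f2).
have N10 : 0 <= N1 by apply: fine_ge0; exact: Lnorm_ge0.
have N20 : 0 <= N2 by apply: fine_ge0; exact: Lnorm_ge0.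
have [F1 [b1 F10 ae1]] := borel_ae_eq (measurable_normc m1) (fun y => normc_ge0 _).
have [F2 [b2 F20 ae2]] := borel_ae_eq (measurable_normc m2) (fun y => normc_ge0 _).
pose S (x : Rn R n) := cross_op (riesz (n%:R - alpha)) F1 F2 x.
have c0 : 0 <= D * w by rewrite mulr_ge0.
have TS x : (\int[@leb R n]_y cmod (T_integrand g f1 f2 x) y <= (D * w)%:E * S x)%E.
  exact: (integral_cmod_T_le x g0 c0 mg m1 m2 b1 b2 F10 F20 ae1 ae2 aeg).
have S0 x : (0 <= S x)%E.
  apply: integral_ge0 => y _; rewrite lee_fin; apply: mulr_ge0; last exact: riesz_ge0.
  exact: mulr_ge0.
have mS : measurable_fun [set: Rn R n] S.
  exact: (measurable_cross_op (borel_riesz _) b1 b2 (riesz_ge0 _) F10 F20).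
have Sp e : 0 < e -> (\int[@leb R n]_x (S x) `^ p <=
    (((N1 + e) * (N2 + e)) `^ p * M)%:E)%E.
  move=> e0; have N1e : 0 < N1 + e by rewrite ltr_wpDl.
  have N2e : 0 < N2 + e by rewrite ltr_wpDl.
  apply: hM => //; rewrite invrK.
    apply: le_trans (integral_powR_le_normLp p10 m1 b1 F10 ae1) _.
    rewrite -(fineK N1fin) poweR_EFin lee_fin.
    by apply: ge0_ler_powR; rewrite ?nnegrE ?(ltW p10) ?(ltW N1e)// lerDl ltW.
  apply: le_trans (integral_powR_le_normLp p20 m2 b2 F20 ae2) _.
  rewrite -(fineK N2fin) poweR_EFin lee_fin.
  by apply: ge0_ler_powR; rewrite ?nnegrE ?(ltW p20) ?(ltW N2e)// lerDl ltW.
clearbody S; split.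
  (* S^p is integrable, so S is finite almost everywhere, and S x dominates the
     integral of the modulus of the integrand at x *)
  have mSp : measurable_fun [set: Rn R n] (fun x => (S x `^ p)%E).
    exact: (measurableT_comp (measurable_poweR p) mS).
  have iSp : (@leb R n).-integrable [set: Rn R n] (fun x => (S x `^ p)%E).
    apply/integrableP; split; first exact: mSp.
    under eq_integral => x _ do rewrite gee0_abs ?poweR_ge0//.
    by apply: le_lt_trans (Sp 1 ltr01) _; rewrite ltry.
  apply: filterS (integrable_ae measurableT iSp) => x /(_ I) Sx; split.
    exact: cmeasurable_T_integrand.
  apply: le_lt_trans (TS x) _; rewrite lte_mul_pinfty ?lee_fin//.
  apply: (@lty_poweRy _ _ p); first by rewrite gt_eqF.
  by rewrite -ge0_fin_numE ?poweR_ge0.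
have T_le x : (cmod (T_op g f1 f2) x <= (2 * (D * w))%:E * S x)%E.
  apply: le_trans (cmod_cintegral_le (cmeasurable_T_integrand x mg m1 m2)) _.
  by rewrite EFinM -muleA; apply: lee_wpmul2l; [rewrite lee_fin|exact: TS].
have B0 : 0 <= 2 * (D * w) by rewrite mulr_ge0.
have normT e : 0 < e -> (normLp p (T_op g f1 f2) <=
    (2 * (D * w) * M `^ p^-1 * ((N1 + e) * (N2 + e)))%:E)%E.
  move=> e0; have cc0 : 0 <= (N1 + e) * (N2 + e) by rewrite mulr_ge0// addr_ge0// ltW.
  have pi0 : 0 <= p^-1 by rewrite invr_ge0 ltW.
  have Bp0 : 0 <= (2 * (D * w)) `^ p by exact: powR_ge0.
  rewrite /normLp unlock.
  apply: (@le_trans _ _ (((((2 * (D * w)) `^ p)%:E *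
      (((N1 + e) * (N2 + e)) `^ p * M)%:E) `^ p^-1)%E)).
    apply: le_poweR => //; first by apply: integral_ge0 => x _; exact: poweR_ge0.
    apply: (@le_trans _ _ (\int[@leb R n]_x (((2 * (D * w)) `^ p)%:E * S x `^ p))%E).
      apply: le_integralT => x; first exact: poweR_ge0.
      rewrite -poweR_EFin -poweRM ?lee_fin//; apply: le_poweR; rewrite ?(ltW p0)//.
      rewrite gee0_abs; first exact: T_le.
      by rewrite /cmod lee_fin normc_ge0.
    rewrite ge0_integralZl; last first.
    - by rewrite lee_fin.
    - by move=> x _; exact: poweR_ge0.
    - exact: (measurableT_comp (measurable_poweR p) mS).
    - exact: measurableT.
    by apply: lee_wpmul2l; [rewrite lee_fin|exact: Sp].
  rewrite -EFinM poweR_EFin lee_fin.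
  have K (z : R) : 0 <= z -> (z `^ p) `^ p^-1 = z.
    by move=> z0; rewrite -powRrM mulfV ?gt_eqF// powRr1.
  move: (2 * (D * w)) ((N1 + e) * (N2 + e)) B0 Bp0 cc0 => B c B0' Bp0' cc0'.
  rewrite powRM ?mulr_ge0 ?powR_ge0// powRM ?powR_ge0// !K//.
  by rewrite [c * _]mulrC mulrA.
have Tfin : normLp p (T_op g f1 f2) \is a fin_num.
  rewrite ge0_fin_numE ?Lnorm_ge0//.
  by apply: le_lt_trans (normT 1 ltr01) _; rewrite ltry.
rewrite -(fineK Tfin) -(fineK N1fin) -(fineK N2fin) -(fineK Wfin) -!EFinM lee_fin -/w -/N1 -/N2.
apply: (@le_trans _ _ (2 * (D * w) * M `^ p^-1 * (N1 * N2))).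
  apply: le_mul_of_gt0_shifts => //; first by rewrite mulr_ge0.
  by move=> e /normT; rewrite -{1}(fineK Tfin) lee_fin.
rewrite [leRHS](_ : _ = (2 * D * M `^ p^-1 + 1) * (w * (N1 * N2))); last by ring.
rewrite [leLHS](_ : _ = (2 * D * M `^ p^-1) * (w * (N1 * N2))); last by ring.
by apply: ler_wpM2r; rewrite ?mulr_ge0// lerDl.
Qed.
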